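(* (Nodal domains) Let $p\ge2$ and let $\Omega\subset\mathbb{R}^N$ be an open, bounded, connected set with $C^{1,\alpha}$ boundary for some $\alpha\in(0,1)$. Let $\lambda>\lambda_1(\Omega)$ be an eigenvalue of $\mathcal{L}_{J,p}$ in $\Omega$ and let $\phi_\lambda$ be an associated eigenfunction (taken with its continuous representative). Set $$\Omega^+:=\{x\in\Omega:\phi_\lambda(x)>0\},\qquad\Omega^-:=\{x\in\Omega:\phi_\lambda(x)<0\}.$$ Then $\lambda>\max\{\lambda_1(\Omega^+),\lambda_1(\Omega^-)\}$.
   Context: The kernel $J:\mathbb{R}^N\to\mathbb{R}$ is a nonnegative continuous function with compact support, radially symmetric and decreasing (i.e. $J(x)$ is a nonincreasing function of $|x|$), with $J(0)>0$ and $\int_{\mathbb{R}^N}J(x)\,dx=1$. For any open set $U\subset\mathbb{R}^N$, functions in $W^{1,p}_0(U)$ are extended by $0$ to $\mathbb{R}^N\setminus U$. For $u,\phi\in W^{1,p}_0(\Omega)$ put $$\mathcal{H}_{J,p}(u,\phi)=\int_\Omega|\nabla u|^{p-2}\nabla u\cdot\nabla\phi\,dx+\int_{\mathbb{R}^N}\int_{\mathbb{R}^N}|u(x)-u(y)|^{p-2}(u(x)-u(y))(\phi(x)-\phi(y))J(x-y)\,dx\,dy.$$ A number $\lambda$ is an eigenvalue of $\mathcal{L}_{J,p}=-\Delta_p-\Delta_{J,p}$ in $\Omega$ (with $u=0$ in $\mathbb{R}^N\setminus\Omega$), with eigenfunction $u\in W^{1,p}_0(\Omega)$, $u\neq0$,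 if $\mathcal{H}_{J,p}(u,\phi)=\lambda\int_\Omega|u|^{p-2}u\,\phi\,dx$ for all $\phi\in W^{1,p}_0(\Omega)$. Every eigenfunction belongs to $C^{1,\beta}(\overline\Omega)$ for some $\beta\in(0,1)$, and eigenfunctions of eigenvalues greater than $\lambda_1(\Omega)$ change sign, so $\Omega^+$ and $\Omega^-$ are nonempty open sets. For a nonempty bounded open set $U\subset\mathbb{R}^N$, $$\lambda_1(U)=\inf\left\{\int_U|\nabla u|^p\,dx+\int_{\mathbb{R}^N}\int_{\mathbb{R}^N}|u(x)-u(y)|^pJ(x-y)\,dx\,dy:\ u\in W^{1,p}_0(U),\ \int_U|u|^p\,dx=1\right\}.$$ *)

(* Defs.v *)
From HB Require Import structures.
From mathcomp Require Import all_boot all_order all_algebra.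
From mathcomp Require Import all_classical all_reals all_analysis.

Set Implicit Arguments.
Unset Strict Implicit.
Unset Printing Implicit Defensive.
Import Order.TTheory GRing.Theory Num.Theory.
Import numFieldNormedType.Exports.

Local Open Scope classical_set_scope.
Local Open Scope ring_scope.

Definition rV_coord (R : realType) n (i : 'I_n) (x : 'rV[R]_n) :
  measurableTypeR R := x ord0 i.

(* 'rV[R]_n carries the product (= Borel) sigma-algebra: the smallest one for
   which the n coordinates are measurable. *)
Section measurable_rV.
Context (R : realType) (n : nat).

Let rV_set0 : g_sigma_preimage (@rV_coord R n) set0.
Proof. exact: sigma_algebra0. Qed.

Let rV_setC A : g_sigma_preimage (@rV_coord R n) A ->
  g_sigma_preimage (@rV_coord R n) (~` A).
Proof. exact: sigma_algebraC. Qed.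

Let rV_bigcup (F : _^nat) : (forall i, g_sigma_preimage (@rV_coord R n) (F i)) ->
  g_sigma_preimage (@rV_coord R n) (\bigcup_i (F i)).
Proof. exact: sigma_algebra_bigcup. Qed.

HB.instance Definition _ := @isMeasurable.Build default_measure_display
  'rV[R]_n (g_sigma_preimage (@rV_coord R n)) rV_set0 rV_setC rV_bigcup.

End measurable_rV.

Lemma measurable_rV_coord (R : realType) n (i : 'I_n) :
  measurable_fun setT (@rV_coord R n i).
Proof.
move=> _ A mA; apply: sub_sigma_algebra.
case: n i => [[] []//|n i].
rewrite -bigcup_mkord_ord; exists i; first exact: ltn_ord.
by exists A => //; rewrite inord_val.
Qed.

Lemma measurable_fun_rV (R : realType) n d (T : measurableType d)
    (f : T -> 'rV[R]_n) :
  (forall i, measurable_fun setT (rV_coord i \o f)) -> measurable_fun setT f.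
Proof.
move=> mf _ A gA.
suff : g_sigma_preimage (fun i => rV_coord i \o f) `<=` measurable.
  by apply; rewrite g_sigma_preimage_comp; exists A.
apply: smallest_sub; first exact: sigma_algebra_measurable.
case: n => [|n] in f mf A gA *; first by rewrite big_ord0.
rewrite -bigcup_mkord_ord; apply: bigcup_sub => i Ii.
by move=> B [C mC <-]; exact: mf.
Qed.

Definition rV_cons (R : realType) n (z : measurableTypeR R * 'rV[R]_n) :
  'rV[R]_n.+1 := row_mx (z.1 : R)%:M z.2.

Definition rV_uncons (R : realType) n (x : 'rV[R]_n.+1) :
  measurableTypeR R * 'rV[R]_n := (x ord0 ord0, col' ord0 x).

Lemma rV_consK (R : realType) n : cancel (@rV_cons R n) (@rV_uncons R n).
Proof.
move=> [a v]; rewrite /rV_uncons /rV_cons; congr pair.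
  by rewrite mxE; case: splitP => // j _; rewrite /= (ord1 j) mxE mulr1n.
apply/rowP => j; rewrite mxE mxE.
case: splitP => k /=; first by rewrite (ord1 k).
by rewrite /bump /= add1n => -[jk]; congr (v _ _); apply: val_inj.
Qed.

Lemma measurable_rV_cons (R : realType) n :
  measurable_fun setT (@rV_cons R n).
Proof.
apply: measurable_fun_rV => i.
case: (unliftP ord0 i) => [j ->|->].
- rewrite (_ : _ \o _ = rV_coord j \o snd).
    by apply: measurableT_comp; [exact: measurable_rV_coord|exact: measurable_snd].
  by apply/funext => z; rewrite /= -[in RHS](rV_consK z) /rV_coord /= [RHS]mxE.
- rewrite (_ : _ \o _ = fst); first exact: measurable_fst.
  by apply/funext => z; rewrite /= -[in RHS](rV_consK z).
Qed.

Lemma measurable_rV_uncons (R : realType) n :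
  measurable_fun setT (@rV_uncons R n).
Proof.
apply/measurable_fun_pairP; split; first exact: (measurable_rV_coord ord0).
apply: measurable_fun_rV => i.
rewrite (_ : _ \o _ = rV_coord (lift ord0 i)); first exact: measurable_rV_coord.
by apply/funext => x; rewrite /rV_coord /= mxE.
Qed.

Section lebesgue_rV_succ.
Context (R : realType) (n : nat).
Variable m : {sigma_finite_measure set 'rV[R]_n -> \bar R}.

Definition lebesgue_rV_succ : set 'rV[R]_n.+1 -> \bar R :=
  pushforward (@lebesgue_measure R \x m)%E (@rV_cons R n).

Let succ0 : lebesgue_rV_succ set0 = 0%E.
Proof. by rewrite /lebesgue_rV_succ /pushforward preimage_set0 measure0. Qed.

Let succ_ge0 A : (0 <= lebesgue_rV_succ A)%E.
Proof. by rewrite /lebesgue_rV_succ /pushforward measure_ge0. Qed.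

Let succ_sigma_additive : semi_sigma_additive lebesgue_rV_succ.
Proof.
have mp (A : set 'rV[R]_n.+1) :
  measurable A -> measurable (@rV_cons R n @^-1` A).
  by move=> mA; rewrite -[X in measurable X]setTI; exact: measurable_rV_cons.
move=> F mF tF mUF; rewrite /lebesgue_rV_succ /pushforward preimage_bigcup.
apply: measure_semi_sigma_additive.
- by move=> i; exact: mp.
- apply/trivIsetP => /= i j _ _ ij; rewrite -preimage_setI.
  by move/trivIsetP : tF => /(_ _ _ _ _ ij) ->//; rewrite preimage_set0.
- by rewrite -preimage_bigcup; exact: mp.
Qed.

HB.instance Definition _ := isMeasure.Build _ _ _ lebesgue_rV_succ
  succ0 succ_ge0 succ_sigma_additive.

Let succ_sigma_finite : sigma_finite setT lebesgue_rV_succ.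
Proof.
have /sigma_finiteP[F [TF ndF Foo]] := sigma_finiteT (@lebesgue_measure R).
have /sigma_finiteP[G [TG ndG Goo]] := sigma_finiteT m.
exists (fun k => @rV_uncons R n @^-1` (F k `*` G k)).
  rewrite -preimage_bigcup -[LHS](preimage_setT (@rV_uncons R n)).
  congr (_ @^-1` _); rewrite -setXTT TF TG predeqE => -[x y]; split.
    move=> [/= [k _ Fkx] [l _ Gly]]; exists (maxn k l) => //; split.
    - by move: x Fkx; exact/subsetPset/ndF/leq_maxl.
    - by move: y Gly; exact/subsetPset/ndG/leq_maxr.
  by move=> [k _ []/= ? ?]; split; exists k.
move=> k; have [mF Fk] := Foo k; have [mG Gk] := Goo k; split.
  rewrite -[X in measurable X]setTI; apply: measurable_rV_uncons => //.
  exact: measurableX.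
rewrite /lebesgue_rV_succ /pushforward -comp_preimage.
rewrite (_ : _ \o _ = id); last by apply/funext; exact: rV_consK.
by rewrite preimage_id product_measure1E// lte_mul_pinfty// ge0_fin_numE.
Qed.

HB.instance Definition _ := Measure_isSigmaFinite.Build _ _ _
  lebesgue_rV_succ succ_sigma_finite.

End lebesgue_rV_succ.

(* n-dimensional Lebesgue measure, as the n-fold product of the Lebesgue measure
   on R (a point mass when n = 0). *)
Fixpoint lebesgue_rV (R : realType) (n : nat) :
    {sigma_finite_measure set 'rV[R]_n -> \bar R} :=
  match n with
  | 0 => \d_(0 : 'rV[R]_0)
  | n'.+1 => lebesgue_rV_succ (lebesgue_rV R n')
  end.

Section calculus.
Context {R : realType} {n : nat}.
Implicit Types (x y : 'rV[R]_n) (f : 'rV[R]_n -> R) (U : set 'rV[R]_n).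

Definition dotv x y : R := \sum_i x ord0 i * y ord0 i.

(* Euclidean norm; the library norm `|x| on row vectors is the sup norm. *)
Definition enorm x : R := Num.sqrt (dotv x x).

Definition partial (i : 'I_n) f x : R := 'D_(delta_mx ord0 i : 'rV[R]_n) f x.

Definition grad f x : 'rV[R]_n := \row_i partial i f x.

Fixpoint class_C (k : nat) f : Prop :=
  match k with
  | 0 => continuous f
  | k'.+1 => continuous f /\ forall i,
      (forall x, derivable f x (delta_mx ord0 i)) /\ class_C k' (partial i f)
  end.

Definition smooth f := forall k, class_C k f.

Definition supp f : set 'rV[R]_n := closure [set x | f x != 0].

Definition test_function U f :=
  [/\ smooth f, compact (supp f) & supp f `<=` U].

Definition class_C1holder (alpha : R) f :=
  class_C 1 f /\ exists C : R, forall x y,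
    enorm (grad f x - grad f y) <= C * enorm (x - y) `^ alpha.

Definition boundary U : set 'rV[R]_n := closure U `\` interior U.

End calculus.

(* Near each boundary point, in the orthonormal coordinates y = x *m Q, the set
   is the strict epigraph y_0 > gamma(y_1, ..., y_n) of a C^{1,alpha}
   function. *)
Definition C1holder_boundary (R : realType) (n : nat) (alpha : R)
    (U : set 'rV[R]_n.+1) :=
  forall x0, boundary U x0 ->
    exists (r : R) (Q : 'M[R]_n.+1) (gamma : 'rV[R]_n -> R),
      [/\ 0 < r, Q *m Q^T = 1%:M, class_C1holder alpha gamma &
          forall x, enorm (x - x0) < r ->
            (U x <-> gamma (col' ord0 (x *m Q)) < (x *m Q) ord0 ord0)].

Section sobolev.
Context {R : realType} {n : nat}.
Implicit Types (p : R) (U : set 'rV[R]_n) (u v : 'rV[R]_n -> R)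
  (g gu gv : 'rV[R]_n -> 'rV[R]_n).
Local Notation mu := (lebesgue_rV R n).

Definition weak_gradient U u g :=
  forall psi, test_function U psi -> forall i,
    (\int[mu]_(x in U) (u x * partial i psi x))%R =
    - (\int[mu]_(x in U) (g x ord0 i * psi x))%R.

(* The gradient of a Sobolev function, being defined only almost everywhere, is
   passed along with the function: W1p p U u g means that u is in W^{1,p}(U)
   and that g is a representative of its weak gradient. *)
Definition W1p p U u g :=
  [/\ measurable_fun U u, measurable_fun U g, weak_gradient U u g,
      (\int[mu]_(x in U) (`|u x| `^ p)%:E < +oo)%E &
      (\int[mu]_(x in U) (enorm (g x) `^ p)%:E < +oo)%E].

(* W^{1,p}_0(U) is the closure of the test functions in W^{1,p}(U), its elements
   being extended by 0 outside U. *)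
Definition W1p0 p U u g :=
  [/\ W1p p U u g, forall x, ~ U x -> u x = 0 &
      forall eps : R, 0 < eps -> exists2 psi, test_function U psi &
        (\int[mu]_(x in U) (`|u x - psi x| `^ p)%:E +
         \int[mu]_(x in U) (enorm (g x - grad psi x) `^ p)%:E < eps%:E)%E].

Record is_kernel (J : 'rV[R]_n -> R) : Prop := {
  kernel_ge0 : forall x, 0 <= J x ;
  kernel_continuous : continuous J ;
  kernel_compact : compact (supp J) ;
  (* enorm x = enorm y yields J x = J y, i.e. radial symmetry *)
  kernel_radial_decreasing : forall x y, enorm x <= enorm y -> J y <= J x ;
  kernel_gt0 : 0 < J 0 ;
  kernel_integral : (\int[mu]_x (J x)%:E = 1)%E }.

Definition energy p (J : 'rV[R]_n -> R) U u gu : \bar R :=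
  (\int[mu]_(x in U) (enorm (gu x) `^ p)%:E +
   \int[mu \x mu]_z (`|u z.1 - u z.2| `^ p * J (z.1 - z.2))%:E)%E.

(* The infimum is taken in the extended reals, so that it is +oo, and not a
   default value, when there is no admissible function. *)
Definition lambda1 p (J : 'rV[R]_n -> R) U : \bar R :=
  ereal_inf [set e | exists u gu, [/\ W1p0 p U u gu,
    (\int[mu]_(x in U) (`|u x| `^ p)%:E = 1)%E & e = energy p J U u gu]].

Definition H_form p (J : 'rV[R]_n -> R) U u gu v gv : R :=
  (\int[mu]_(x in U) (enorm (gu x) `^ (p - 2) * dotv (gu x) (gv x)))%R +
  (\int[(mu \x mu)%E]_z (`|u z.1 - u z.2| `^ (p - 2) * (u z.1 - u z.2) *
                         (v z.1 - v z.2) * J (z.1 - z.2)))%R.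

Definition is_eigenfunction p (J : 'rV[R]_n -> R) U (lambda : R) u :=
  ~ {ae mu, forall x, u x = 0} /\
  exists2 gu, W1p0 p U u gu & forall v gv, W1p0 p U v gv ->
    H_form p J U u gu v gv =
    lambda * (\int[mu]_(x in U) (`|u x| `^ (p - 2) * u x * v x))%R.

Definition is_eigenvalue p (J : 'rV[R]_n -> R) U (lambda : R) :=
  exists u, is_eigenfunction p J U lambda u.

End sobolev.

(* Main.v *)
(* Let g be a weak gradient of the eigenfunction phi, and O+, O- the sets where
   phi is positive and negative.

   If J (x - y) > 0 for some x in O+ and y in O-, test the equation with the
   positive part phi^+, which lies in W^{1,p}_0(O+).  Pointwise,
   |a - b|^(p-2) (a - b) (a^+ - b^+) >= |a^+ - b^+|^p, strictly when a and b have
   opposite signs, so the energy of phi^+ is strictly below lambda times the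
   integral of (phi^+)^p: lambda1(O+) < lambda.  Apply this to phi and - phi.

   Otherwise J never connects O+ to O-; say O+ is nonempty.  Near a point of
   Omega in the closure of O+, phi is nonnegative, and testing the equation with
   |eta|^p (phi + e)^(1-p) for e tending to 0 shows, by the local and discrete
   Picone inequalities, that {phi = 0} is negligible there: on this set the
   nonlocal term contributes - e^(1-p) times a positive potential.  Hence the
   closure of O+ is relatively open in Omega; as Omega is connected, phi >= 0
   and phi > 0 almost everywhere.  Then Picone's inequality gives
   lambda int |eta|^p <= E(eta) for every test function eta, whence
   lambda <= lambda1(Omega), a contradiction. *)
Require Import Defs.
From mathcomp Require Import all_boot all_order all_algebra.
From mathcomp Require Import all_classical all_reals all_analysis.
From mathcomp Require Import measurable_realfun ring lra.
Import Order.TTheory GRing.Theory Num.Theory.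
Import numFieldNormedType.Exports.
Local Open Scope classical_set_scope.
Local Open Scope ring_scope.

Set Implicit Arguments.
Unset Strict Implicit.
Unset Printing Implicit Defensive.

(** * Smooth functions *)

(** W^{1,p}_0 is a closure of test functions, so whatever is inserted in the equation must come with
    approximating test functions. Compositions are therefore made with smooth functions, and the
    non-smooth ones (positive part, |eta|^p) are reached by dominated convergence. The delicate
    point is that phi^+ lies in W^{1,p}_0(O+) and not merely in W^{1,p}_0(Omega): phi is continuous
    inside Omega only, so the sets {phi >= e} need not be compact. Multiplying F(phi) by G(chi),
    with chi a test function close to phi, restores compactness, and the factor disappears in the
    limit. Picone's inequality stands in for a strong maximum principle. Its test function has a
    cost bounded independently of e except on the zero set, where the weight is e^(1-p); this is
    seen by the nonlocal term, which compares a zero of phi with positive values at a distance.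
    Negligibility of the zero set matters again at the end, since zeros contribute nothing to the
    integral of |phi|^(p-2) phi |eta|^p (phi + e)^(1-p), whose limit has to be the whole integral of
    |eta|^p. *)

Section directional_smoothness.
Context {R : realType} {V : normedModType R}.

(** A directional derivative is the derivative at 0 of h |-> f (h v + x), so the one-variable chain
    rule applies with derivability along the single direction v. *)
Lemma is_derive_comp_dir (F : R -> R) (f : V -> R) x v a b :
  is_derive (f x) 1 F a -> is_derive x v f b ->
  is_derive x v (fun y => F (f y)) (a * b).
Proof.
move=> dF df; pose g := fun h : R => f (h *: v + x).
have g0 : g 0 = f x by rewrite /g scale0r add0r.
have dg : is_derive (0 : R) 1 g b.
  have [df1 df2] := df; split; first exact: ((derivable1P _ _ _).1 df1).
  rewrite -df2; rewrite /derive; set k1 := fun h => h^-1 *: _; set k2 := fun h => h^-1 *: _.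
  suff -> : k1 = k2 by [].
  by apply/funext => h; rewrite /k1 /k2 /= /g addr0 scale0r add0r [_%:A]mulr1.
have dFg : is_derive (g 0) 1 F a by rewrite g0.
have [d1 d2] := is_derive1_comp dFg dg.
split; first exact: ((derivable1P _ _ _).2 d1).
rewrite mulrC in d2; rewrite mulrC -d2 /derive; set k1 := fun h => h^-1 *: _; set k2 := fun h => h^-1 *: _.
suff -> : k1 = k2 by [].
by apply/funext => h; rewrite /k1 /k2 /= /g addr0 scale0r add0r [_%:A]mulr1.
Qed.

Context {I : Type}.

(* [class_C k] is the case of the canonical directions of R^n, and one-variable
   functions are covered by the single direction 1. *)
Fixpoint dir_C (e : I -> V) (k : nat) (f : V -> R) : Prop :=
  match k with
  | 0 => continuous f
  | k'.+1 => continuous f /\ forall i,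
      (forall x, derivable f x (e i)) /\ dir_C e k' ('D_(e i) f)
  end.

Variable e : I -> V.
Implicit Types f g : V -> R.

Lemma dir_CW k f : dir_C e k.+1 f -> dir_C e k f.
Proof.
elim: k f => [|k IH] f; first by case.
move=> [cf df]; split=> // i; have [dfi Cf] := df i; split=> //; exact: IH.
Qed.

Lemma dir_C_cst k (c : R) : dir_C e k (cst c).
Proof.
elim: k c => [|k IH] c; first by move=> x; exact: cvg_cst.
split=> [x|i]; first exact: cvg_cst.
split=> [x|]; first exact: derivable_cst.
by rewrite (_ : 'D_(e i) _ = cst 0)//; apply/funext => x; exact: derive_cst.
Qed.

Lemma dir_CD k f g : dir_C e k f -> dir_C e k g ->
  dir_C e k (fun x => f x + g x).
Proof.
elim: k f g => [|k IH] f g; first by move=> cf cg x; apply: cvgD; [exact: cf|exact: cg].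
move=> [cf df] [cg dg]; split; first by move=> x; apply: cvgD; [exact: cf|exact: cg].
move=> i; have [df1 df2] := df i; have [dg1 dg2] := dg i.
split=> [x|]; first exact: derivableD.
rewrite (_ : 'D_(e i) _ = fun x => 'D_(e i) f x + 'D_(e i) g x); first exact: IH.
by apply/funext => x; exact: deriveD.
Qed.

Lemma dir_CM k f g : dir_C e k f -> dir_C e k g ->
  dir_C e k (fun x => f x * g x).
Proof.
elim: k f g => [|k IH] f g.
  by move=> cf cg x; apply: cvgM; [exact: cf|exact: cg].
move=> Cf Cg; have fW := dir_CW Cf; have gW := dir_CW Cg.
case: Cf => cf df; case: Cg => cg dg.
split; first by move=> x; apply: cvgM; [exact: cf|exact: cg].
move=> i; have [df1 df2] := df i; have [dg1 dg2] := dg i.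
split=> [x|]; first exact: derivableM.
rewrite (_ : 'D_(e i) _ = fun x => f x * 'D_(e i) g x + g x * 'D_(e i) f x).
  by apply: dir_CD; apply: IH.
by apply/funext => x; exact: deriveM.
Qed.

Lemma dir_CZ k (c : R) f : dir_C e k f -> dir_C e k (fun x => c * f x).
Proof. by move=> Cf; apply: dir_CM => //; exact: dir_C_cst. Qed.

Lemma dir_C_prod k n (h : 'I_n -> V -> R) :
  (forall i, dir_C e k (h i)) -> dir_C e k (fun x => \prod_i h i x).
Proof.
elim: n h => [|n IH] h Ch.
  rewrite (_ : (fun x => _) = cst 1); first exact: dir_C_cst.
  by apply/funext => x; rewrite big_ord0.
rewrite (_ : (fun x => _) = fun x => h ord0 x * \prod_(i < n) h (lift ord0 i) x).
  by apply: dir_CM => //; exact: IH.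
by apply/funext => x; rewrite big_ord_recl.
Qed.

Lemma dir_C_sum k (T : Type) (s : seq T) (h : T -> V -> R) :
  (forall i, dir_C e k (h i)) -> dir_C e k (fun x => \sum_(i <- s) h i x).
Proof.
move=> Ch; elim: s => [|t s IH].
  rewrite (_ : (fun x => _) = cst 0); first exact: dir_C_cst.
  by apply/funext => x; rewrite big_nil.
rewrite (_ : (fun x => _) = fun x => h t x + \sum_(i <- s) h i x).
  exact: dir_CD.
by apply/funext => x; rewrite big_cons.
Qed.

End directional_smoothness.

Section one_variable.
Context {R : realType}.
Implicit Types F G : R -> R.

Definition real_C k F := dir_C (fun _ : unit => (1 : R)) k F.

Definition real_smooth F := forall k, real_C k F.

Lemma real_smooth_derivable F x : real_smooth F -> derivable F x 1.
Proof. by move=> /(_ 1%N) [_ /(_ tt) []]. Qed.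

Lemma real_smooth_continuous F : real_smooth F -> continuous F.
Proof. by move=> /(_ 0%N). Qed.

Lemma real_smoothS F : real_smooth F -> real_smooth ('D_1 F).
Proof. by move=> sF k; have [_ /(_ tt) []] := sF k.+1. Qed.

Lemma real_smooth_cst c : real_smooth (cst c).
Proof. by move=> k; exact: dir_C_cst. Qed.

Lemma real_smoothD F G : real_smooth F -> real_smooth G ->
  real_smooth (fun x => F x + G x).
Proof. by move=> sF sG k; apply: dir_CD; [exact: sF|exact: sG]. Qed.

Lemma real_smoothM F G : real_smooth F -> real_smooth G ->
  real_smooth (fun x => F x * G x).
Proof. by move=> sF sG k; apply: dir_CM; [exact: sF|exact: sG]. Qed.

Lemma real_smooth_id : real_smooth id.
Proof.
case=> [|k]; first by move=> x; exact: cvg_id.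
split=> [x|_]; first exact: cvg_id.
split=> [x|]; first exact: derivable_id.
rewrite (_ : 'D_(1 : R) id = cst 1); first exact: dir_C_cst.
by apply/funext => x; exact: derive_id.
Qed.

Lemma dir_C_comp (V : normedModType R) (I : Type) (e : I -> V) k F (f : V -> R) :
  real_smooth F -> dir_C e k f -> dir_C e k (fun x => F (f x)).
Proof.
elim: k F f => [|k IH] F f sF.
  move=> cf x; apply: (@continuous_comp _ _ _ f F); first exact: cf.
  exact: real_smooth_continuous.
move=> Cf; have fW := dir_CW Cf; case: Cf => cf df.
split.
  move=> x; apply: (@continuous_comp _ _ _ f F); first exact: cf.
  exact: real_smooth_continuous.
move=> i; have [df1 df2] := df i.
have dF x : is_derive x (e i) (fun y => F (f y)) ('D_1 F (f x) * 'D_(e i) f x).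
  apply: is_derive_comp_dir; apply: derivableP => //.
  exact: real_smooth_derivable.
split=> [x|]; first by case: (dF x).
rewrite (_ : 'D_(e i) _ = fun x => 'D_1 F (f x) * 'D_(e i) f x).
  by apply: dir_CM; [exact: (IH _ _ (real_smoothS sF) fW)|exact: df2].
by apply/funext => x; case: (dF x).
Qed.

Lemma real_smooth_comp F G : real_smooth F -> real_smooth G ->
  real_smooth (fun x => F (G x)).
Proof. by move=> sF sG k; apply: dir_C_comp => //; exact: sG. Qed.

Lemma real_smooth_affine (a b : R) : real_smooth (fun x => a * x + b).
Proof.
apply: real_smoothD; last exact: real_smooth_cst.
by apply: real_smoothM; [exact: real_smooth_cst|exact: real_smooth_id].
Qed.

Lemma is_derive_powR_comp F (a x : R) : (forall y, 0 < F y) ->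
  derivable F x 1 ->
  is_derive x 1 (fun y => F y `^ a) (a * (F x `^ (a - 1) * 'D_1 F x)).
Proof.
move=> F0 dF; rewrite mulrA.
apply: (@is_derive_comp_dir R R (fun y => y `^ a) F).
  exact: is_derive1_powR.
exact: derivableP.
Qed.

Lemma real_smooth_powR F (a : R) : (forall x, 0 < F x) -> real_smooth F ->
  real_smooth (fun x => F x `^ a).
Proof.
move=> F0 sF.
(* The exponent varies in the induction: differentiating F^b produces F^(b - 1). *)
suff H k b : real_C k (fun x => F x `^ b) by move=> k; exact: H.
have cP c : continuous (fun x => F x `^ c).
  move=> x; apply/differentiable_continuous/derivable1_diffP.
  by case: (is_derive_powR_comp c F0 (@real_smooth_derivable F x sF)).
elim: k b => [|k IH] b; first exact: cP.
have dP x := is_derive_powR_comp b F0 (@real_smooth_derivable F x sF).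
split=> // _; split=> [x|]; first by case: (dP x).
rewrite (_ : 'D_(1 : R) _ = fun x => b * (F x `^ (b - 1) * 'D_1 F x)).
  by apply: dir_CZ; apply: dir_CM; [exact: IH|exact: (real_smoothS sF)].
by apply/funext => x; case: (dP x).
Qed.

End one_variable.

(** * A smooth step built from exp(-1/t) *)

Section smooth_step.
Context {R : realType}.

(** The factor t^-k closes the family under differentiation: the derivative of [flat k] is
    [flat k.+2] - k [flat k.+1]. Smoothness of exp(-1/t) at 0 then follows by one induction for all
    k together. *)
Definition flat (k : nat) (t : R) : R :=
  if 0 < t then expR (- t^-1) * t^-1 ^+ k else 0.

Lemma flat_ge0 k t : 0 <= flat k t.
Proof.
rewrite /flat; case: ifPn => // t0.
by rewrite mulr_ge0 ?expR_ge0// exprn_ge0// invr_ge0 ltW.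
Qed.

Lemma flat_gt0 k t : 0 < t -> 0 < flat k t.
Proof. by move=> t0; rewrite /flat t0 mulr_gt0 ?expR_gt0// exprn_gt0// invr_gt0. Qed.

Lemma flat_le0 k t : t <= 0 -> flat k t = 0.
Proof. by rewrite /flat leNgt => /negbTE ->. Qed.

(** With w = 1/t this is exp w >= w^(k+1) / (k+1)!. *)
Lemma flat_le k t : flat k t <= k.+1`!%:R * `|t|.
Proof.
rewrite /flat; case: ifPn => t0; last by rewrite mulr_ge0.
rewrite gtr0_norm// -ler_pdivrMr//; set w := t^-1.
have w0 : 0 < w by rewrite invr_gt0.
rewrite -mulrA -exprSr expRN mulrC ler_pdivrMr ?expR_gt0//.
have f0 : (0 : R) < k.+1`!%:R by rewrite ltr0n fact_gt0.
rewrite mulrC -ler_pdivrMr//; apply: le_trans (expR_ge1Dxn k (ltW w0)).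
by rewrite lerDr ler01.
Qed.

Lemma flat_cvg0 k : flat k t @[t --> 0] --> 0.
Proof.
apply/cvgrPdist_le => /= eps e0.
have f0 : (0 : R) < k.+1`!%:R by rewrite ltr0n fact_gt0.
near=> t; rewrite sub0r normrN ger0_norm ?flat_ge0//.
rewrite (le_trans (flat_le _ _))// mulrC -ler_pdivlMr//.
near: t; have d0 : 0 < eps / k.+1`!%:R by rewrite divr_gt0.
exists (eps / k.+1`!%:R) => //= y /=; rewrite sub0r normrN; exact: ltW.
Unshelve. all: by end_near. Qed.

Lemma is_derive_flat k (t : R) :
  is_derive t 1 (flat k) (flat k.+2 t - k%:R * flat k.+1 t).
Proof.
have [t0|t0|->] := ltgtP t 0.
- rewrite !flat_le0 ?ltW// mulr0 subr0.
  apply: (@near_eq_is_derive R R R (cst 0)).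
  near=> y; rewrite flat_le0// ltW//; near: y.
  exact: lt_nbhsl.
- rewrite /flat t0.
  apply: (@near_eq_is_derive R R R (fun t => expR (- t^-1) * t^-1 ^+ k)).
    near=> y; rewrite ifT//; near: y; exact: lt_nbhsr.
  have dV : is_derive t 1 (fun y => y^-1) (- t ^- 2).
    have tn0 : t != 0 by rewrite gt_eqF.
    have := @is_deriveV R id t 1 1 tn0 (is_derive_id _ _).
    by move/is_derive_eq; apply; rewrite /GRing.scale/= mulr1.
  have dE : is_derive (t^-1) 1 (fun w : R => expR (- w) * w ^+ k)
     (- expR (- t^-1) * t^-1 ^+ k + expR (- t^-1) * (k%:R * t^-1 ^+ k.-1)).
    have d1 : is_derive (t^-1) 1 (fun w : R => expR (- w)) (- expR (- t^-1)).
      rewrite -[X in is_derive _ _ _ X]mulr1 mulNr -mulrN.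
      by apply: (@is_derive_comp_dir R R expR -%R).
    have d2 := @is_deriveX _ _ id k (t^-1) 1 1 (is_derive_id _ _).
    rewrite (_ : id ^+ k = fun w : R => w ^+ k) in d2; last first.
      by apply/funext => w; rewrite fctE.
    have := is_deriveM d1 d2; move/is_derive_eq; apply.
    by rewrite /GRing.scale/=; ring.
  have := is_derive_comp_dir dE dV; move/is_derive_eq; apply.
  rewrite -exprVn; case: k {dE} => [|k] /=; first by ring.
  by rewrite !exprS; ring.
- rewrite !flat_le0// mulr0 subr0.
  suff H : (fun h => h^-1 *: ((flat k \o shift 0) (h *: 1) - flat k 0)) @ 0^' --> (0 : R).
    by split; [apply/cvg_ex; exists 0|apply: cvg_lim].
  (* The difference quotient of [flat k] at 0 is exactly [flat k.+1]. *)
  rewrite (_ : (fun h => _) = flat k.+1).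
    by apply: cvg_within_filter; exact: flat_cvg0.
  apply/funext => h; rewrite /= addr0 /GRing.scale/= mulr1 (flat_le0 _ (lexx 0)) subr0.
  rewrite /flat; case: ifPn; last by rewrite mulr0.
  by move=> _; rewrite exprS mulrCA.
Unshelve. all: by end_near. Qed.

Lemma real_smooth_flat k : real_smooth (flat k).
Proof.
move=> m; elim: m k => [|m IH] k.
  move=> x; apply/differentiable_continuous/derivable1_diffP.
  by case: (is_derive_flat k x).
split=> [x|_].
  apply/differentiable_continuous/derivable1_diffP.
  by case: (is_derive_flat k x).
split=> [x|]; first by case: (is_derive_flat k x).
rewrite (_ : 'D_(1 : R) _ = fun x => flat k.+2 x + (- k%:R) * flat k.+1 x).
  by apply: dir_CD; [exact: IH|apply: dir_CZ; exact: IH].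
by apply/funext => x; rewrite mulNr; case: (is_derive_flat k x).
Qed.

Let flat_sum_gt0 (t : R) : 0 < flat 0 t + flat 0 (1 - t).
Proof.
have [t0|t0] := ltP 0 t; first by rewrite ltr_wpDr ?flat_ge0// flat_gt0.
by rewrite ltr_wpDl ?flat_ge0// flat_gt0// subr_gt0 (le_lt_trans t0).
Qed.

(** The denominator never vanishes, since t > 0 or 1 - t > 0. The quotient is written as a power so
    that [real_smooth_powR] applies to it. *)
Definition smooth_step (t : R) : R :=
  flat 0 t * (flat 0 t + flat 0 (1 - t)) `^ (-1).

Lemma smooth_stepE t : smooth_step t = flat 0 t / (flat 0 t + flat 0 (1 - t)).
Proof. by rewrite /smooth_step powR_inv1// ltW. Qed.

Lemma real_smooth_step : real_smooth smooth_step.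
Proof.
have s1 := real_smooth_flat 0.
have s2 : real_smooth (fun t => flat 0 (1 - t)).
  apply: (@real_smooth_comp _ (flat 0)) => //.
  rewrite (_ : (fun t => _) = fun t => -1 * t + 1); first exact: real_smooth_affine.
  by apply/funext => t; ring.
apply: real_smoothM => //; apply: real_smooth_powR => //.
exact: real_smoothD.
Qed.

Lemma smooth_step_ge0 t : 0 <= smooth_step t.
Proof. by rewrite smooth_stepE divr_ge0 ?flat_ge0// ltW. Qed.

Lemma smooth_step_le1 t : smooth_step t <= 1.
Proof. by rewrite smooth_stepE ler_pdivrMr// mul1r lerDl flat_ge0. Qed.

Lemma smooth_step_le0 t : t <= 0 -> smooth_step t = 0.
Proof. by move=> t0; rewrite smooth_stepE flat_le0// mul0r. Qed.

Lemma smooth_step_ge1 t : 1 <= t -> smooth_step t = 1.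
Proof.
move=> t1; rewrite smooth_stepE (@flat_le0 0 (1 - t)) ?subr_le0// addr0 divff//.
by rewrite gt_eqF// flat_gt0// (lt_le_trans _ t1).
Qed.

Lemma derive_smooth_step_lt0 t : t < 0 -> 'D_1 smooth_step t = 0.
Proof.
move=> t0; rewrite (@near_eq_derive R R R _ (cst 0)) ?derive_cst//.
near=> y; rewrite smooth_step_le0// ltW//; near: y; exact: lt_nbhsl.
Unshelve. all: by end_near. Qed.

Lemma derive_smooth_step_gt1 t : 1 < t -> 'D_1 smooth_step t = 0.
Proof.
move=> t0; rewrite (@near_eq_derive R R R _ (cst 1)) ?derive_cst//.
near=> y; rewrite smooth_step_ge1// ltW//; near: y; exact: lt_nbhsr.
Unshelve. all: by end_near. Qed.

Lemma bounded_vanishing (f : R -> R) a b : continuous f ->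
  (forall t, t < a -> f t = 0) -> (forall t, b < t -> f t = 0) ->
  exists2 C, 0 < C & forall t, `|f t| <= C.
Proof.
move=> cf fa fb; have [ab|ab] := leP a b; last first.
  exists 1 => // t; have [/fa ->|at_] := ltP t a; first by rewrite normr0.
  by rewrite fb ?normr0// (lt_le_trans ab).
have [] := @EVT_max R (fun t => `|f t|) a b ab.
  by apply: continuous_subspaceT => x; apply: cvg_norm; exact: cf.
move=> c _ Hc; exists (`|f c| + 1); first by rewrite ltr_wpDl.
move=> t; have [/fa ->|at_] := ltP t a; first by rewrite normr0 addr_ge0.
have [/fb ->|tb] := ltP b t; first by rewrite normr0 addr_ge0.
by rewrite (le_trans (Hc t _)) ?lerDl// in_itv/= at_.
Qed.

Lemma derive_smooth_step_bounded :
  exists2 C, 0 < C & forall t, `|'D_1 smooth_step t| <= C.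
Proof.
apply: (@bounded_vanishing _ 0 1); last exact: derive_smooth_step_gt1.
  exact/real_smooth_continuous/real_smoothS/real_smooth_step.
exact: derive_smooth_step_lt0.
Qed.

End smooth_step.

(** * Test functions, bumps and cut-offs *)

Section test_functions.
Context {R : realType} {n : nat}.
Implicit Types (x y c : 'rV[R]_n) (f g : 'rV[R]_n -> R) (U K : set 'rV[R]_n).

Local Notation dirs := (fun i : 'I_n => delta_mx ord0 i : 'rV[R]_n).

Lemma class_C_dirE k f : class_C k f <-> dir_C dirs k f.
Proof.
elim: k f => [|k IH] f //=; split=> -[cf df]; split=> // i; have [d1 d2] := df i;
  by split=> //; exact/IH.
Qed.

Lemma smooth_dirE f : smooth f <-> forall k, dir_C dirs k f.
Proof. by split=> sf k; exact/class_C_dirE. Qed.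

Lemma smooth_continuous f : smooth f -> continuous f.
Proof. by move=> /(_ 0%N). Qed.

Lemma smooth_derivable f i x : smooth f -> derivable f x (delta_mx ord0 i).
Proof. by move=> /(_ 1%N) [_ /(_ i) []]. Qed.

Lemma smooth_partial f i : smooth f -> smooth (partial i f).
Proof. by move=> sf k; have [_ /(_ i) []] := sf k.+1. Qed.

Lemma smooth_cst (a : R) : smooth (cst a : 'rV[R]_n -> R).
Proof. by apply/smooth_dirE => k; exact: dir_C_cst. Qed.

Lemma smoothM f g : smooth f -> smooth g -> smooth (fun x => f x * g x).
Proof.
move=> /smooth_dirE sf /smooth_dirE sg; apply/smooth_dirE => k.
by apply: dir_CM; [exact: sf|exact: sg].
Qed.

Lemma smooth_comp (F : R -> R) f : real_smooth F -> smooth f ->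
  smooth (fun x => F (f x)).
Proof.
move=> sF /smooth_dirE sf; apply/smooth_dirE => k.
by apply: dir_C_comp => //; exact: sf.
Qed.

Lemma smooth_prod m (h : 'I_m -> 'rV[R]_n -> R) : (forall i, smooth (h i)) ->
  smooth (fun x => \prod_i h i x).
Proof.
move=> sh; apply/smooth_dirE => k; apply: dir_C_prod => i.
by have /smooth_dirE := sh i.
Qed.

Lemma smooth_sum (T : Type) (s : seq T) (h : T -> 'rV[R]_n -> R) :
  (forall i, smooth (h i)) -> smooth (fun x => \sum_(i <- s) h i x).
Proof.
move=> sh; apply/smooth_dirE => k; apply: dir_C_sum => i.
by have /smooth_dirE := sh i.
Qed.

Lemma partial_cst i (a : R) : partial i (cst a : 'rV[R]_n -> R) = cst 0.
Proof. by apply/funext => x; exact: derive_cst. Qed.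

Lemma partialM i f g x : smooth f -> smooth g ->
  partial i (fun x => f x * g x) x = f x * partial i g x + g x * partial i f x.
Proof.
by move=> sf sg; rewrite /partial; apply: deriveM; exact: smooth_derivable.
Qed.

Lemma partial_comp i (F : R -> R) f x : real_smooth F -> smooth f ->
  partial i (fun x => F (f x)) x = 'D_1 F (f x) * partial i f x.
Proof.
move=> sF sf; have dF : is_derive (f x) 1 F ('D_1 F (f x)).
  by apply: derivableP; exact: real_smooth_derivable.
have df := derivableP (@smooth_derivable f i x sf).
by have [_] := is_derive_comp_dir dF df.
Qed.

Lemma near_eq_partial i f g x : (\near x, f x = g x) ->
  partial i f x = partial i g x.
Proof. exact: near_eq_derive. Qed.

Lemma is_derive_coord (i : 'I_n) x v :
  is_derive x v (fun y => y ord0 i) (v ord0 i).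
Proof.
have H : (fun h : R => h^-1 *: (((fun y : 'rV[R]_n => y ord0 i) \o shift x) (h *: v)
    - x ord0 i)) @ 0^' --> v ord0 i.
  apply: (@cvg_trans _ (cst (v ord0 i) @ (0:R)^')); last exact: cvg_cst.
  apply: near_eq_cvg; near=> h; rewrite /= !mxE addrK.
  have h0 : h != 0 by near: h; exact: nbhs_dnbhs_neq.
  by rewrite /GRing.scale/= mulrA mulVf// mul1r.
by split; [apply/cvg_ex; exists (v ord0 i)|apply: cvg_lim].
Unshelve. all: by end_near. Qed.

Lemma smooth_coord (i : 'I_n) : smooth (fun x => x ord0 i).
Proof.
apply/smooth_dirE => -[|k]; first by move=> x; exact: coord_continuous.
split=> [x|j]; first exact: coord_continuous.
split=> [x|]; first by case: (is_derive_coord i x (delta_mx ord0 j)).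
rewrite (_ : 'D__ _ = cst ((delta_mx ord0 j : 'rV[R]_n) ord0 i)).
  exact: dir_C_cst.
by apply/funext => x; case: (is_derive_coord i x (delta_mx ord0 j)).
Qed.

Lemma rV_ballP x y (e : R) : 0 < e ->
  ball x e y <-> forall i, `|x ord0 i - y ord0 i| < e.
Proof.
move=> e0; split.
  rewrite mx_norm_ball /ball_/= => xye i.
  apply: le_lt_trans xye; rewrite [leRHS]mx_normrE.
  have -> : x ord0 i - y ord0 i = (x - y) ord0 i by rewrite !mxE.
  by apply: le_trans (le_bigmax _ _ (ord0, i)).
move=> H; rewrite mx_norm_ball /ball_/= [ltLHS]mx_normrE.
apply: bigmax_lt => // -[a b] _; rewrite (ord1 a) /= !mxE; exact: H.
Qed.

Lemma suppN f x : ~ supp f x -> \near x, f x = 0.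
Proof.
move=> nx; have : nbhs x (~` supp f).
  by apply: open_nbhs_nbhs; split=> //; apply: closed_openC; exact: closed_closure.
apply: filterS => y ny; apply: contra_notP ny => /eqP fy.
exact: subset_closure.
Qed.

Lemma supp_eq0 f x : ~ supp f x -> f x = 0.
Proof. by move=> /suppN; exact: nbhs_singleton. Qed.

Lemma supp_sub f g : (forall x, f x != 0 -> supp g x) -> supp f `<=` supp g.
Proof.
move=> H x; rewrite [supp g](@closure_id _ _).1; last exact: closed_closure.
exact: closureS.
Qed.

Lemma suppS f g : (forall x, g x = 0 -> f x = 0) -> supp f `<=` supp g.
Proof.
move=> H; apply: closureS => x /=; apply: contraNN => /eqP gx.
by rewrite H.
Qed.

Lemma partial_suppN i f x : ~ supp f x -> partial i f x = 0.
Proof.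
by move=> /suppN fx; rewrite (@near_eq_partial i f (cst 0))// partial_cst.
Qed.

Lemma supp_partial i f : supp (partial i f) `<=` supp f.
Proof.
apply: supp_sub => x px; apply: contrapT => /(partial_suppN i) p0.
by rewrite p0 eqxx in px.
Qed.

Lemma compact_supp_sub f g : supp f `<=` supp g -> compact (supp g) ->
  compact (supp f).
Proof. by move=> fg cg; apply: subclosed_compact fg => //; exact: closed_closure. Qed.

Lemma supp_bounded f : continuous f -> compact (supp f) ->
  exists2 C : R, 0 < C & forall x, `|f x| <= C.
Proof.
move=> cf cpt; have [s0|s0] := pselect (supp f !=set0); last first.
  exists 1 => // x; rewrite supp_eq0 ?normr0// => sx; apply: s0; by exists x.
have [|c _ Hc] := @EVT_max_rV R n (fun x => `|f x|) _ s0 cpt.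
  apply: continuous_subspaceT => x; exact: (cvg_norm (cf x)).
exists (`|f c| + 1); first by rewrite ltr_wpDl.
move=> x; have [sx|/supp_eq0 ->] := pselect (supp f x).
  by rewrite (le_trans (Hc x _)) ?inE// lerDl.
by rewrite normr0 addr_ge0.
Qed.

Lemma test_bounded U f : test_function U f ->
  exists2 C : R, 0 < C & forall x, `|f x| <= C.
Proof. by case=> sf cf _; apply: supp_bounded => //; exact: smooth_continuous. Qed.

Lemma test_partial_bounded U f i : test_function U f ->
  exists2 C : R, 0 < C & forall x, `|partial i f x| <= C.
Proof.
case=> sf cf _; apply: supp_bounded; first exact/smooth_continuous/smooth_partial.
by apply: compact_supp_sub cf; exact: supp_partial.
Qed.

Lemma test_functionS U V f : U `<=` V -> test_function U f -> test_function V f.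
Proof. by move=> UV [sf cf fU]; split=> //; exact: subset_trans UV. Qed.

Lemma test_eq0 U f x : test_function U f -> ~ U x -> f x = 0.
Proof. by move=> [_ _ fU] Ux; apply: supp_eq0 => /fU. Qed.

Lemma test_partial_eq0 U f i x : test_function U f -> ~ U x -> partial i f x = 0.
Proof. by move=> [_ _ fU] Ux; apply: partial_suppN => /fU. Qed.

Lemma test_functionM U f g : test_function U f -> smooth g ->
  test_function U (fun x => f x * g x).
Proof.
move=> [sf cf fU] sg.
have S : supp (fun x => f x * g x) `<=` supp f.
  by apply: suppS => x ->; rewrite mul0r.
by split; [exact: smoothM|exact: compact_supp_sub cf|exact: subset_trans fU].
Qed.

Lemma test_function_comp U (F : R -> R) f : real_smooth F -> F 0 = 0 ->
  test_function U f -> test_function U (fun x => F (f x)).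
Proof.
move=> sF F0 [sf cf fU].
have S : supp (fun x => F (f x)) `<=` supp f by apply: suppS => x ->.
by split; [exact: smooth_comp|exact: compact_supp_sub cf|exact: subset_trans fU].
Qed.

(** A product over coordinates, positive exactly on the open cube that is the sup-norm ball; this
    matches the balls of the topology of ['rV[R]_n]. *)
Definition bump c (r : R) x : R :=
  \prod_i (flat 0 (1 - (x ord0 i - c ord0 i) / r) *
           flat 0 (1 + (x ord0 i - c ord0 i) / r)).

Lemma smooth_bump c (r : R) : smooth (bump c r).
Proof.
apply: smooth_prod => i; apply: smoothM.
  apply: (@smooth_comp (fun t => flat 0 (1 - (t - c ord0 i) / r))); last exact: smooth_coord.
  apply: (@real_smooth_comp _ (flat 0)); first exact: real_smooth_flat.
  rewrite (_ : (fun t => _) = fun t => (- r^-1) * t + (1 + c ord0 i / r)); first exact: real_smooth_affine.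
  by apply/funext => t; ring.
apply: (@smooth_comp (fun t => flat 0 (1 + (t - c ord0 i) / r))); last exact: smooth_coord.
apply: (@real_smooth_comp _ (flat 0)); first exact: real_smooth_flat.
rewrite (_ : (fun t => _) = fun t => r^-1 * t + (1 - c ord0 i / r)); first exact: real_smooth_affine.
by apply/funext => t; ring.
Qed.

Lemma bump_ge0 c (r : R) x : 0 <= bump c r x.
Proof. by apply: prodr_ge0 => i _; rewrite mulr_ge0// flat_ge0. Qed.

Lemma bump_gt0 c (r : R) x : 0 < r -> (0 < bump c r x) = (x \in (ball c r : set _)).
Proof.
move=> r0; apply/idP/idP => [H|].
  rewrite inE; apply/rV_ballP => // i; rewrite distrC ltNge; apply/negP => ri.
  move: H; rewrite /bump (bigD1 i)//= lt0r mulf_eq0 negb_or => /andP[/andP[+ _] _].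
  apply/negP; rewrite negbK mulf_eq0.
  move: ri; rewrite ler_normr => /orP[ri|ri]; apply/orP.
    by left; rewrite flat_le0// subr_le0 ler_pdivlMr// mul1r.
  right; rewrite flat_le0//.
  have : 1 <= - (x ord0 i - c ord0 i) / r by rewrite ler_pdivlMr// mul1r.
  by rewrite mulNr; lra.
rewrite inE => /rV_ballP -/(_ r0) H; apply: prodr_gt0 => i _.
have := H i; rewrite distrC ltr_norml => /andP[h1 h2].
rewrite mulr_gt0// flat_gt0//; first by rewrite subr_gt0 ltr_pdivrMr// mul1r.
have : -1 < (x ord0 i - c ord0 i) / r by rewrite ltr_pdivlMr// mulN1r.
by lra.
Qed.

Lemma supp_bump c (r : R) : 0 < r -> supp (bump c r) `<=` closed_ball c r.
Proof.
move=> r0; apply: closureS => x /= bx.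
have : 0 < bump c r x by rewrite lt0r bx bump_ge0.
by rewrite bump_gt0// inE.
Qed.

Lemma closed_ball_rV_compact c (r : R) : 0 < r -> compact (closed_ball c r).
Proof.
move=> r0; apply: bounded_closed_compact; last exact: closed_closure.
rewrite closed_ballE// /closed_ball_ /bounded_set.
exists (`|c| + r); split=> [|M cM x /= xr]; first exact: num_real.
rewrite -[x](subrK c) addrC (le_trans (ler_normD _ _))//.
by rewrite (le_trans _ (ltW cM))// lerD2l distrC.
Qed.

Lemma test_bump U c (r : R) : 0 < r -> closed_ball c r `<=` U ->
  test_function U (bump c r).
Proof.
move=> r0 rU; split; first exact: smooth_bump.
  apply: subclosed_compact (supp_bump r0); first exact: closed_closure.
  exact: closed_ball_rV_compact.
exact: subset_trans (supp_bump r0) rU.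
Qed.

Lemma open_closed_ball U x : open U -> U x ->
  exists2 r : R, 0 < r & closed_ball x r `<=` U.
Proof.
move=> oU Ux; have /nbhs_ballP[r/= r0 rU] : nbhs x U by exact: open_nbhs_nbhs.
exists (r / 2); first by rewrite divr_gt0.
by apply: subset_trans rU; exact: subset_closure_half.
Qed.

(** Finitely many bumps cover K and their sum B has a minimum m > 0 on K; the step applied to B / (m
    / 2) equals 1 wherever B >= m / 2. Halving m gives the value 1 on a neighbourhood of K, so that
    derivatives are unaffected there. *)
Lemma cutoff K U : compact K -> open U -> K `<=` U ->
  exists eta, [/\ test_function U eta, forall x, 0 <= eta x <= 1 &
    forall x, K x -> \near x, eta x = 1].
Proof.
move=> cK oU KU; have [K0|K0] := pselect (K !=set0); last first.
  exists (cst 0); split.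
  - have s0 : supp (cst 0 : 'rV[R]_n -> R) = set0.
      rewrite /supp (_ : [set x | _] = set0) ?closure0//.
      by apply/seteqP; split=> // x /=; rewrite eqxx.
    by split; [exact: smooth_cst|rewrite s0; exact: compact0|rewrite s0].
  - by move=> x; rewrite lexx ler01.
  - by move=> x Kx; exfalso; apply: K0; exists x.
have rad x : exists r : R, K x -> 0 < r /\ closed_ball x r `<=` U.
  have [Kx|nK] := pselect (K x); last by exists 1 => /nK.
  by have [r r0 rU] := open_closed_ball oU (KU _ Kx); exists r.
have [rho Hrho] := choice rad.
have [] : finite_subset_cover K (fun x => ball x (rho x)) K.
- rewrite compact_cover in cK; apply: cK; first by move=> x Kx; exact: ball_open.
  by move=> x Kx; exists x => //; apply: ballxx; have [] := Hrho x Kx.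
move=> D0 DK; pose D : seq _ := finmap.enum_fset D0; rewrite -/D => KD.
pose B x := \sum_(c <- D) bump c (rho c) x.
have DK' c : c \in D -> 0 < rho c /\ closed_ball c (rho c) `<=` U.
  by move=> /DK; rewrite inE; exact: Hrho.
have sB : smooth B by apply: smooth_sum => c; exact: smooth_bump.
have B0 x : 0 <= B x by apply: sumr_ge0 => c _; exact: bump_ge0.
have B1 x : K x -> 0 < B x.
  move=> /KD [c /= Dc xc]; have [r0 _] := DK' c Dc.
  rewrite /B (big_rem c)//= ltr_pwDl//; first by rewrite bump_gt0// inE.
  by apply: sumr_ge0 => ? _; exact: bump_ge0.
have [|m /set_mem Km Hm] := @EVT_min_rV R n B K K0 cK.
  by apply: continuous_subspaceT => x; exact: smooth_continuous.
have m0 : 0 < B m / 2 by rewrite divr_gt0// B1.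
pose eta x := smooth_step (B x / (B m / 2)).
exists eta.
have seta : smooth eta.
  apply: (@smooth_comp (fun t => smooth_step (t / (B m / 2)))) => //.
  apply: (@real_smooth_comp _ smooth_step); first exact: real_smooth_step.
  rewrite (_ : (fun t => _) = fun t => (B m / 2)^-1 * t + 0); first exact: real_smooth_affine.
  by apply/funext => t; ring.
have suppe : supp eta `<=` \bigcup_(c in [set` D]) closed_ball c (rho c).
  have clD : closed (\bigcup_(c in [set` D]) closed_ball c (rho c)).
    by apply: closed_bigcup => [|c _]; [exact: finite_seq|exact: closed_closure].
  rewrite [X in _ `<=` X](closure_id _).1//; apply: closureS => x /= ex.
  apply: contrapT => nx; move/negP: ex; apply; apply/eqP.
  rewrite /eta /B big_seq big1 ?mul0r ?smooth_step_le0// => c Dc.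
  apply/eqP; rewrite eq_le bump_ge0 andbT leNgt; have [r0 _] := DK' c Dc.
  rewrite bump_gt0//; apply/negP; rewrite inE => xc; apply: nx; exists c => //.
  exact: subset_closure.
split.
- split=> //.
    apply: subclosed_compact suppe; first exact: closed_closure.
    rewrite bigcup_seq big_seq; apply: bigsetU_compact => c Dc.
     have [r0 _] := DK' c Dc; exact: closed_ball_rV_compact.
  by move=> x /suppe [c Dc]; have [_ ] := DK' c Dc; apply.
- by move=> x; rewrite smooth_step_ge0 smooth_step_le1.
- move=> x Kx; have cB : B y @[y --> x] --> B x by exact: smooth_continuous.
  have : \forall y \near x, B m / 2 < B y.
    have mx : B m <= B x by apply: Hm; rewrite inE.
    apply: (cvgr_gt _ cB); apply: lt_le_trans mx.
    by rewrite ltr_pdivrMr// ltr_pMr ?B1// ltr1n.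
  apply: filterS => y my; rewrite /eta smooth_step_ge1// ler_pdivlMr// mul1r.
  exact: ltW.
Qed.

End test_functions.

(** * Lebesgue measure on row vectors *)

Section measurable_row_vectors.
Context {R : realType}.

Lemma rV_cons_ord0 n (z : measurableTypeR R * 'rV[R]_n) :
  rV_cons z ord0 ord0 = z.1.
Proof. by have := rV_consK z; rewrite /rV_uncons; case: z => a v [-> _]. Qed.

Lemma rV_cons_lift n (z : measurableTypeR R * 'rV[R]_n) j :
  rV_cons z ord0 (lift ord0 j) = z.2 ord0 j.
Proof.
case: z => a v; have := rV_consK (a, v); rewrite /rV_uncons => -[_ /rowP H].
by rewrite /= -(H j) [RHS]mxE.
Qed.

Context {n : nat}.
Implicit Types (x c : 'rV[R]_n) (U : set 'rV[R]_n).

Lemma measurable_ball_rV c (e : R) : measurable (ball c e : set 'rV[R]_n).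
Proof.
have [e0|e0] := ltP 0 e; last first.
  rewrite (_ : ball c e = set0); first exact: measurable0.
  apply/seteqP; split=> // x; rewrite mx_norm_ball /ball_/= => H.
  by have := le_lt_trans (normr_ge0 _) (lt_le_trans H e0); rewrite ltxx.
rewrite (_ : ball c e = \bigcap_(i in [set: 'I_n]) (@rV_coord R n i @^-1` ball (c ord0 i) e)).
  apply: fin_bigcap_measurable; first exact: finite_finset.
  move=> i _; rewrite -[X in measurable X]setTI; apply: measurable_rV_coord => //.
  exact: measurable_ball.
apply/seteqP; split=> x.
  by move=> /rV_ballP -/(_ e0) H i _; exact: H.
by move=> H; apply/rV_ballP => // i; exact: (H i).
Qed.

Lemma rat_approx_rV c (e : R) : 0 < e ->
  exists q : 'rV[rat]_n, ball c e (map_mx ratr q : 'rV[R]_n).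
Proof.
move=> e0; have H (i : 'I_n) : exists q : rat, ratr q \in `](c ord0 i - e), (c ord0 i + e)[.
  by apply: rat_in_itvoo; rewrite ltrD2l gtrN.
have [f Hf] := choice H; exists (\row_i f i); apply/rV_ballP => // i.
rewrite !mxE; have := Hf i; rewrite in_itv/= => /andP[h1 h2].
by rewrite ltr_norml; apply/andP; split; lra.
Qed.

(** The sigma-algebra is generated by the coordinates, so open sets are written as countable unions
    of balls with rational centres and radii 1/(k+1). *)
Lemma open_measurable_rV U : open U -> measurable U.
Proof.
move=> oU.
pose Q (q : 'rV[rat]_n) : 'rV[R]_n := map_mx ratr q.
pose F (qk : 'rV[rat]_n * nat) : set 'rV[R]_n :=
  if `[< ball (Q qk.1) (qk.2.+1%:R^-1 : R) `<=` U >]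
  then ball (Q qk.1) (qk.2.+1%:R^-1 : R) else set0.
rewrite (_ : U = \bigcup_qk F qk).
  apply: countable_bigcupT_measurable => // qk.
  by rewrite /F; case: ifP => _; [exact: measurable_ball_rV|exact: measurable0].
apply/seteqP; split=> x; last first.
  by move=> [qk _]; rewrite /F; case: ifPn => // /asboolP H /H.
move=> Ux; have /nbhs_ballP[r/= r0 rU] : nbhs x U by exact: open_nbhs_nbhs.
have [k _ /(_ _ (leqnn k)) Hk] := near_infty_natSinv_lt (PosNum (divr_gt0 r0 (ltr0n R 2))).
have k0 : (0 : R) < k.+1%:R^-1 by rewrite invr_gt0.
have [q Hq] := rat_approx_rV x k0.
exists (q, k) => //; rewrite /F /= ifT; first exact: ball_sym.
apply/asboolP => y qy; apply: rU; rewrite [r]splitr.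
apply: (@ball_triangle _ _ (Q q)); first exact: le_ball (ltW Hk) _ Hq.
exact: le_ball (ltW Hk) _ qy.
Qed.

Lemma closed_measurable_rV U : closed U -> measurable U.
Proof.
by move=> cU; rewrite -[U]setCK; apply: measurableC; apply: open_measurable_rV; exact: closed_openC.
Qed.

Lemma continuous_measurable_rV (f : 'rV[R]_n -> R) :
  continuous f -> measurable_fun setT f.
Proof.
move=> /continuousP cf; apply: (measurability _ (@RGenOpens.measurableE R)).
move=> _ [_ [a [b ->] <-]]; rewrite setTI; apply: open_measurable_rV; apply: cf.
exact: interval_open.
Qed.

Lemma bounded_set_ball U : bounded_set U -> exists2 M : R, 0 < M & U `<=` ball 0 M.
Proof.
move=> [M [_ HM]]; exists (`|M| + 2) => [|x Ux]; first by rewrite ltr_wpDl.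
rewrite mx_norm_ball /ball_/= sub0r normrN.
have /HM H : M < `|M| + 1 by rewrite (le_lt_trans (ler_norm M))// ltrDl.
by rewrite (le_lt_trans (H _ Ux))// ltrD2l ltr1n.
Qed.

End measurable_row_vectors.

Section lebesgue_row_vectors.
Context {R : realType}.

(** A sup-norm ball is the product of an interval and a ball one dimension lower; in dimension 0 it
    is the single point, of mass 1. *)
Lemma lebesgue_rV_ball n (c : 'rV[R]_n) (e : R) : 0 < e ->
  (0 < lebesgue_rV R n (ball c e) < +oo)%E.
Proof.
move=> e0; elim: n c => [|n IH] c.
  rewrite /= diracE mem_set ?lte01 ?ltry//.
  by apply/rV_ballP => // -[].
have -> : lebesgue_rV R n.+1 (ball c e) =
    ((lebesgue_measure : measure (measurableTypeR R) R) \x lebesgue_rV R n)%E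
      (ball (c ord0 ord0) e `*` ball (col' ord0 c) e).
  rewrite /= /lebesgue_rV_succ /pushforward; congr (_ _).
  apply/seteqP; split=> -[a v] /=.
    move=> /rV_ballP -/(_ e0) H; split.
      by have := H ord0; rewrite rV_cons_ord0.
    by apply/rV_ballP => // j; have := H (lift ord0 j); rewrite rV_cons_lift mxE.
  move=> [Ha /rV_ballP -/(_ e0) Hv]; apply/rV_ballP => // i.
  case: (unliftP ord0 i) => [j ->|->]; last by rewrite rV_cons_ord0.
  by have := Hv j; rewrite rV_cons_lift mxE.
rewrite product_measure1E; [|exact: measurable_ball|exact: measurable_ball_rV].
have /andP[h1 h2] := IH (col' ord0 c).
have E : lebesgue_measure (ball (c ord0 ord0) e) = (e *+ 2)%:E.
  by rewrite lebesgue_measure_ball// ltW.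
rewrite [X in (X * _)%E]E; apply/andP; split.
  by rewrite mule_gt0// lte_fin mulrn_wgt0.
by rewrite lte_mul_pinfty// ltW// lte_fin mulrn_wgt0.
Qed.

Context {n : nat}.
Local Notation mu := (lebesgue_rV R n).
Implicit Types (U A : set 'rV[R]_n).

Lemma lebesgue_rV_bounded A : measurable A -> bounded_set A -> (mu A < +oo)%E.
Proof.
move=> mA /bounded_set_ball[M M0 AM].
have /andP[_ H] := @lebesgue_rV_ball n 0 M M0.
apply: le_lt_trans H; apply: le_measure => //; rewrite inE //.
exact: measurable_ball_rV.
Qed.

Lemma lebesgue_rV_open U : open U -> U !=set0 -> (0 < mu U)%E.
Proof.
move=> oU [x Ux]; have /nbhs_ballP[r/= r0 rU] : nbhs x U by exact: open_nbhs_nbhs.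
have /andP[H _] := lebesgue_rV_ball x r0.
apply: lt_le_trans H _; apply: le_measure => //; rewrite inE.
  exact: measurable_ball_rV.
exact: open_measurable_rV.
Qed.

Lemma lebesgue_rV_compact A : compact A -> (mu A < +oo)%E.
Proof.
move=> cA; apply: lebesgue_rV_bounded; last exact: compact_bounded.
apply: closed_measurable_rV; apply: compact_closed cA.
exact: norm_hausdorff.
Qed.

Lemma measurable_rV_sub : measurable_fun setT
  (fun z : 'rV[R]_n * 'rV[R]_n => z.1 - z.2).
Proof.
apply: measurable_fun_rV => i.
rewrite (_ : _ \o _ = fun z : 'rV[R]_n * 'rV[R]_n => rV_coord i z.1 - rV_coord i z.2).
  apply: measurable_funB.
    by apply: measurableT_comp; [exact: measurable_rV_coord|exact: measurable_fst].
  by apply: measurableT_comp; [exact: measurable_rV_coord|exact: measurable_snd].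
by apply/funext => z; rewrite /rV_coord /= !mxE.
Qed.

Lemma measurable_fun_rVP d (T : measurableType d) (D : set T) (f : T -> 'rV[R]_n) :
  measurable D ->
  measurable_fun D f <-> forall i, measurable_fun D (fun x => f x ord0 i).
Proof.
move=> mD; split=> [mf i|mf].
  by apply: (measurable_comp measurableT _ (@measurable_rV_coord R n i) mf).
have H : measurable_fun setT (fun x => if x \in D then f x else 0).
  apply: measurable_fun_rV => i.
  rewrite (_ : _ \o _ = (fun x => f x ord0 i) \_ D).
    by apply/(measurable_restrict _ _ _).1 => //; rewrite setTI; exact: mf.
  by apply/funext => x; rewrite /patch /rV_coord /=; case: ifP => //; rewrite mxE.
apply: (eq_measurable_fun (fun x => if x \in D then f x else 0)).
  by move=> x ->.
exact: measurable_funS H.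
Qed.

End lebesgue_row_vectors.

(** * Integration by parts *)

Section integration_by_parts.
Context {R : realType}.

Lemma integral_derive_real0 (F : R -> R) (M : R) :
  (forall t, derivable F t 1) -> continuous ('D_1 F) ->
  (forall t, M < `|t| -> F t = 0) ->
  (\int[lebesgue_measure]_t ('D_1 F t)%:E = 0)%E.
Proof.
move=> dF cDF F0; pose K : R := `|M| + 1.
have MK : M < K by rewrite (le_lt_trans (ler_norm M))// ltrDl.
have K0 : 0 < K by rewrite ltr_wpDl.
have cF t : {for t, continuous F}.
  exact/differentiable_continuous/derivable1_diffP.
have D0 (t : R) : t \notin `[- K, K] -> 'D_1 F t = 0.
  rewrite in_itv/= -ler_norml -ltNge => Kt.
  rewrite (@near_eq_derive R R R _ (cst 0)) ?derive_cst//.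
  have : \forall s \near t, M < `|s|.
    by apply: (cvgr_gt _ (@norm_continuous _ R t)); exact: lt_trans Kt.
  by apply: filterS => s /F0.
transitivity (\int[lebesgue_measure]_(t in `[(- K)%R, K%R]) ('D_1 F t)%:E)%E.
  rewrite [RHS]integral_mkcond; apply: eq_integral => t _.
  by rewrite patchE; case: ifPn => // tK; rewrite D0//; apply: contra tK => tK; rewrite inE.
rewrite (@continuous_FTC2 _ _ F).
- have FK s : `|s| = K -> F s = 0 by move=> sK; rewrite F0// sK.
  by rewrite !FK ?subee// ?normrN gtr0_norm.
- by rewrite gtrN.
- by apply: continuous_subspaceT.
- split; first by move=> x _; exact: dF.
    exact/cvg_at_right_filter/cF.
  exact/cvg_at_left_filter/cF.
- by move=> x _; rewrite derive1E.
Qed.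

(** Bounding the support coordinate by coordinate is a condition inherited by the slices of f, which
    the induction on the dimension requires. *)
Definition box_supported n (M : R) (f : 'rV[R]_n -> R) :=
  forall (x : 'rV[R]_n) (i : 'I_n), M < `|x ord0 i| -> f x = 0.

Lemma box_supported_compact n M (f : 'rV[R]_n -> R) :
  box_supported M f -> compact (supp f).
Proof.
move=> f0; apply: (@subclosed_compact _ _ (closed_ball 0 (`|M| + 1))).
- exact: closed_closure.
- by apply: closed_ball_rV_compact; rewrite ltr_wpDl.
- rewrite [X in _ `<=` X](closure_id _).1; last exact: closed_closure.
  apply: closureS => x /= fx; apply: subset_closure.
  apply/rV_ballP; first by rewrite ltr_wpDl.
  move=> i; rewrite mxE sub0r normrN ltNge; apply: contra fx => H.
  apply/eqP/(f0 _ i); apply: lt_le_trans H.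
  by rewrite (le_lt_trans (ler_norm M))// ltrDl.
Qed.

Lemma compact_box_supported n (f : 'rV[R]_n -> R) :
  compact (supp f) -> exists M, box_supported M f.
Proof.
move=> /compact_bounded/bounded_set_ball[M M0 fM]; exists M => x i Mx.
apply: supp_eq0 => /fM/rV_ballP -/(_ M0 i).
by rewrite mxE sub0r normrN => /(lt_trans Mx); rewrite ltxx.
Qed.

Lemma integrable_compact_supp n (f : 'rV[R]_n -> R) :
  continuous f -> compact (supp f) ->
  (lebesgue_rV R n).-integrable setT (EFin \o f).
Proof.
move=> cf sf; have mf := continuous_measurable_rV cf.
have cs : closed (supp f) by exact: closed_closure.
have ms := closed_measurable_rV cs.
have [C C0 HC] := supp_bounded cf sf.
rewrite (_ : EFin \o f = (EFin \o f) \_ (supp f)).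
  apply/(integrable_mkcond _ ms); apply: measurable_bounded_integrable => //.
  - exact: lebesgue_rV_compact.
  - exact: measurable_funTS.
  - exists C; split=> [|D CD x _]; first exact: num_real.
    by rewrite /= (le_trans (HC x))// ltW.
apply/funext => x; rewrite patchE; case: ifPn => //= /negP.
by rewrite inE => /supp_eq0 ->.
Qed.

Lemma box_supported_partial n M (f : 'rV[R]_n -> R) i :
  box_supported M f -> box_supported M (partial i f).
Proof.
move=> f0 x j Mx; rewrite (@near_eq_partial _ _ i f (cst 0)) ?partial_cst//.
have : \forall y \near x, M < `|(y : 'rV[R]_n) ord0 j|.
  by apply: (cvgr_gt _ (cvg_norm (@coord_continuous _ _ _ ord0 j x))).
by apply: filterS => y; exact: f0.
Qed.

Lemma continuous_rV_cons n (t : R) : continuous (fun v : 'rV[R]_n => rV_cons (t, v)).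
Proof.
move=> v; apply/(@cvgrPdist_lt _ _ _ (nbhs v)) => e e0; near=> w.
suff : ball (rV_cons (t, v)) e (rV_cons (t, w)) by rewrite mx_norm_ball.
have : ball v e w by near: w; apply/nbhs_ballP; exists e.
move=> /rV_ballP -/(_ e0) H; apply/rV_ballP => // i.
case: (unliftP ord0 i) => [j ->|->]; first by rewrite !rV_cons_lift.
by rewrite !rV_cons_ord0 subrr normr0.
Unshelve. all: by end_near. Qed.

Lemma continuous_rV_cons1 n (v : 'rV[R]_n) : continuous (fun t : R => rV_cons (t, v)).
Proof.
move=> t; apply/cvgrPdist_lt => e e0; near=> w.
suff : ball (rV_cons (t, v)) e (rV_cons (w, v)) by rewrite mx_norm_ball.
have : ball t e w by near: w; apply/nbhs_ballP; exists e.
move=> H; apply/rV_ballP => // i.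
case: (unliftP ord0 i) => [j ->|->]; last by rewrite !rV_cons_ord0.
by rewrite !rV_cons_lift subrr normr0.
Unshelve. all: by end_near. Qed.

Lemma rV_cons_shift n (h t : R) (v : 'rV[R]_n) j :
  h *: (delta_mx ord0 (lift ord0 j) : 'rV[R]_n.+1) + rV_cons (t, v) =
  rV_cons (t, h *: delta_mx ord0 j + v).
Proof.
apply/rowP => i; case: (unliftP ord0 i) => [k ->|->].
  by rewrite [LHS]mxE !rV_cons_lift/= !mxE (inj_eq lift_inj).
by rewrite [LHS]mxE !rV_cons_ord0/= !mxE/= mulr0 add0r.
Qed.

Lemma rV_cons_shift0 n (h t : R) (v : 'rV[R]_n) :
  h *: (delta_mx ord0 ord0 : 'rV[R]_n.+1) + rV_cons (t, v) = rV_cons (h + t, v).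
Proof.
apply/rowP => i; case: (unliftP ord0 i) => [k ->|->].
  by rewrite [LHS]mxE !rV_cons_lift/= !mxE/= mulr0 add0r.
by rewrite [LHS]mxE !rV_cons_ord0/= !mxE/= mulr1.
Qed.

(** Fubini on R x R^n. For a direction other than the first, the inner integral over R^n vanishes by
    induction; for the first, the inner integral over R vanishes by the fundamental theorem of
    calculus. *)
Lemma integral_partial0 n (M : R) (f : 'rV[R]_n -> R) i : class_C 1 f ->
  box_supported M f -> (\int[lebesgue_rV R n]_x (partial i f x)%:E = 0)%E.
Proof.
elim: n f i => [|n IH] f i; first by case: i.
move=> [cf df] f0; have [dfi cdf] := df i.
pose m1 : {sigma_finite_measure set (measurableTypeR R) -> \bar R} := lebesgue_measure.
have pf0 := box_supported_partial i f0.
have mpf := continuous_measurable_rV cdf.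
have mcons := @measurable_rV_cons R n.
have ipf : (m1 \x lebesgue_rV R n)%E.-integrable setT
    (EFin \o partial i f \o @rV_cons R n).
  apply/integrableP; split.
    by apply/measurable_EFinP; exact: measurableT_comp.
  have /integrableP[_] := integrable_compact_supp cdf (box_supported_compact pf0).
  rewrite /= /lebesgue_rV_succ ge0_integral_pushforward//.
  by apply/measurable_EFinP; apply: measurableT_comp.
transitivity (\int[m1 \x lebesgue_rV R n]_z ((EFin \o partial i f \o @rV_cons R n) z))%E.
  rewrite /= integral_pushforward//.
  exact/measurable_EFinP.
case: (unliftP ord0 i) => [j ij|i0].
- rewrite -integral12_prod_meas1// integral0_eq// => t _ /=.
  pose ft v := f (rV_cons (t, v)).
  have dft k x : (fun h : R => h^-1 *: ((f \o shift (rV_cons (t, x))) (h *: delta_mx ord0 (lift ord0 k)) - f (rV_cons (t, x)))) =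
      (fun h : R => h^-1 *: ((ft \o shift x) (h *: delta_mx ord0 k) - ft x)).
    by apply/funext => h /=; rewrite rV_cons_shift.
  have pE k x : partial k ft x = partial (lift ord0 k) f (rV_cons (t, x)).
    by rewrite /partial /derive dft.
  transitivity (\int[lebesgue_rV R n]_x (partial j ft x)%:E)%E.
    by apply: eq_integral => x _ /=; rewrite pE ij.
  apply: IH.
    split; first by move=> v; apply: continuous_comp; [exact: continuous_rV_cons|exact: cf].
    move=> k; have [dk ck] := df (lift ord0 k); split.
      by move=> v; have := dk (rV_cons (t, v)); rewrite /derivable dft.
    rewrite (_ : partial k ft = partial (lift ord0 k) f \o (fun v => rV_cons (t, v))).
      by move=> v; apply: continuous_comp; [exact: continuous_rV_cons|exact: ck].
    by apply/funext => x; exact: pE.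
  by move=> x k Mx; apply: (f0 _ (lift ord0 k)); rewrite rV_cons_lift.
- rewrite -integral21_prod_meas1// integral0_eq// => v _ /=.
  pose ft t := f (rV_cons (t, v)).
  have dft x : (fun h : R => h^-1 *: ((f \o shift (rV_cons (x, v))) (h *: delta_mx ord0 ord0) - f (rV_cons (x, v)))) =
      (fun h : R => h^-1 *: ((ft \o shift x) (h *: 1) - ft x)).
    by apply/funext => h /=; rewrite rV_cons_shift0 [_%:A]mulr1.
  have pE x : 'D_1 ft x = partial ord0 f (rV_cons (x, v)).
    by rewrite /partial /derive dft.
  transitivity (\int[m1]_x ('D_1 ft x)%:E)%E.
    by apply: eq_integral => x _ /=; rewrite pE i0.
  have [d0 c0] := df ord0.
  apply: (@integral_derive_real0 ft M).
  + by move=> t; have := d0 (rV_cons (t, v)); rewrite /derivable dft.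
  + rewrite (_ : 'D_1 ft = partial ord0 f \o (fun x => rV_cons (x, v))).
      by move=> t; apply: continuous_comp; [exact: continuous_rV_cons1|exact: c0].
    by apply/funext => x; exact: pE.
  + by move=> t Mt; apply: (f0 _ ord0); rewrite rV_cons_ord0.
Qed.

Lemma smooth_integration_by_parts n (f g : 'rV[R]_n -> R) i :
  smooth f -> smooth g -> compact (supp f) ->
  \int[lebesgue_rV R n]_x (f x * partial i g x) =
  - \int[lebesgue_rV R n]_x (partial i f x * g x).
Proof.
move=> sf sg cf.
have cM (h k : 'rV[R]_n -> R) : smooth h -> smooth k -> supp h `<=` supp f ->
    (lebesgue_rV R n).-integrable setT (EFin \o (fun x => h x * k x)).
  move=> sh sk hf; apply: integrable_compact_supp.
    exact/smooth_continuous/smoothM.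
  apply: compact_supp_sub cf; apply: subset_trans hf; apply: suppS => x ->.
  by rewrite mul0r.
have i1 := cM f (partial i g) sf (smooth_partial i sg) (@subset_refl _ _).
have i2 := cM (partial i f) g (smooth_partial i sf) sg (@supp_partial _ _ i f).
apply/eqP; rewrite -subr_eq0 opprK -RintegralD//; apply/eqP.
have [M fM] := compact_box_supported cf.
rewrite /Rintegral.
under eq_integral do rewrite [partial i f _ * _]mulrC -partialM//.
rewrite (integral_partial0 i (smoothM sf sg 1%N) (M := M))//.
by move=> x j Mx; rewrite (fM x j)// mul0r.
Qed.

End integration_by_parts.

(** * Power inequalities and Picone's inequality *)

Section power_inequalities.
Context {R : realType}.
Implicit Types (p a b c e u v s t x y : R).

(** The left side is the perspective of the convex function u^p, which explains why Picone's weights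
    c^(1-p) obey a convexity inequality. *)
Lemma powR_perspective p u c : 0 <= u -> 0 < c ->
  (u / c) `^ p * c = u `^ p * c `^ (1 - p).
Proof.
move=> u0 c0; rewrite powRM// ?invr_ge0 ?ltW//.
rewrite -(powR_inv1 (ltW c0)) -powRrM mulN1r.
rewrite -mulrA -[X in _ * (_ * X)](powRr1 (ltW c0)) -powRD 1?addrC//.
by rewrite (gt_eqF c0) implybT.
Qed.

(* Joint convexity of (u, c) |-> u^p / c^(p-1), in its subadditive form. *)
Lemma powR_subadditive p a b u v : 1 <= p -> 0 < a -> 0 < b -> 0 <= u -> 0 <= v ->
  (u + v) `^ p * (a + b) `^ (1 - p) <= u `^ p * a `^ (1 - p) + v `^ p * b `^ (1 - p).
Proof.
move=> p1 a0 b0 u0 v0; have ab0 : 0 < a + b by rewrite addr_gt0.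
rewrite -!powR_perspective// ?addr_ge0//.
have ua : 0 <= u / a by rewrite divr_ge0// ltW.
have vb : 0 <= v / b by rewrite divr_ge0// ltW.
have t0 : 0 <= a / (a + b) by rewrite divr_ge0// ltW.
have t1 : a / (a + b) <= 1 by rewrite ler_pdivrMr// mul1r lerDl ltW.
have := convex_powR p1 (Itv01 t0 t1) (x := u / a) (y := v / b).
rewrite !inE/= !in_itv/= !andbT => /(_ ua vb).
rewrite convRE [X in X `^ _ <= _ -> _]convRE /= /unstable.onem.
have -> : 1 - a / (a + b) = b / (a + b).
  by field; rewrite gt_eqF.
have -> : a / (a + b) * (u / a) + b / (a + b) * (v / b) = (u + v) / (a + b).
  by field; rewrite !gt_eqF.
move=> H; rewrite -ler_pdivlMr//; apply: le_trans H _.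
by rewrite le_eqVlt; apply/orP; left; apply/eqP; field; rewrite gt_eqF.
Qed.

Lemma powRD_le p u v : 1 <= p -> 0 <= u -> 0 <= v ->
  (u + v) `^ p <= 2 `^ (p - 1) * (u `^ p + v `^ p).
Proof.
move=> p1 u0 v0; have := powR_subadditive p1 (@ltr01 R) (@ltr01 R) u0 v0.
rewrite powR1 !mulr1 -opprB powRN ler_pdivrMr ?powR_gt0// ?addr_gt0//.
by rewrite mulrC -[1 + 1]/(2 : R).
Qed.

(** In contrast with [powRD_le], the factor of u^p tends to 1 as t tends to 0. This keeps the
    constant sharp when Rayleigh quotients are compared with those of test functions. *)
Lemma powRD_eps p t u v : 1 <= p -> 0 < t < 1 -> 0 <= u -> 0 <= v ->
  (u + v) `^ p <= (1 - t) `^ (1 - p) * u `^ p + t `^ (1 - p) * v `^ p.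
Proof.
move=> p1 /andP[t0 t1] u0 v0.
have t1' : 0 < 1 - t by rewrite subr_gt0.
have := powR_subadditive p1 t1' t0 u0 v0.
by rewrite subrK powR1 mulr1 ![_ * _ `^ (1 - p)]mulrC.
Qed.

Lemma ler_powR_base p a b : 0 <= p -> 0 <= a -> a <= b -> a `^ p <= b `^ p.
Proof.
by move=> p0 a0 ab; apply: ge0_ler_powR => //; rewrite nnegrE ?(le_trans a0).
Qed.

Lemma powR_young p a b : 1 < p -> 0 <= a -> 0 <= b ->
  p * (a `^ (p - 1) * b) <= (p - 1) * a `^ p + b `^ p.
Proof.
move=> p1 a0 b0; have p0 : 0 < p by exact: lt_trans p1.
have pm : 0 < p - 1 by rewrite subr_gt0.
have q0 : 0 < p / (p - 1) by rewrite divr_gt0.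
have pq : (p / (p - 1))^-1 + p^-1 = 1.
  by field; rewrite !gt_eqF.
have := conjugate_powR (powR_ge0 a (p - 1)) b0 q0 p0 pq.
rewrite -powRrM (_ : (p - 1) * (p / (p - 1)) = p); last by field; rewrite gt_eqF.
move=> H; rewrite -ler_pdivlMl//; apply: le_trans H _.
by rewrite le_eqVlt; apply/orP; left; apply/eqP; field; rewrite !gt_eqF.
Qed.

Definition signed_pow p t : R := `|t| `^ (p - 2) * t.

Lemma signed_powN p t : signed_pow p (- t) = - signed_pow p t.
Proof. by rewrite /signed_pow normrN mulrN. Qed.

Lemma normr_powB2 p t : 1 < p -> `|t| `^ (p - 2) * `|t| = `|t| `^ (p - 1).
Proof.
move=> p1; have -> : p - 2 = (p - 1) - 1 by ring.
by rewrite mulrC mulr_powRB1// subr_gt0.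
Qed.

Lemma signed_pow_ge0E p t : 1 < p -> 0 <= t -> signed_pow p t = t `^ (p - 1).
Proof. by move=> p1 t0; rewrite /signed_pow -{2}(ger0_norm t0) normr_powB2// ger0_norm. Qed.

Lemma normr_signed_pow p t : 1 < p -> `|signed_pow p t| = `|t| `^ (p - 1).
Proof. by move=> p1; rewrite normrM (ger0_norm (powR_ge0 _ _)) normr_powB2. Qed.

Lemma signed_powM p t : 1 < p -> signed_pow p t * t = `|t| `^ p.
Proof.
move=> p1; rewrite /signed_pow -mulrA -expr2 -[t ^+ 2]real_normK ?num_real// expr2.
by rewrite mulrA normr_powB2// mulrC mulr_powRB1// (lt_trans _ p1).
Qed.

Lemma signed_pow0 p : signed_pow p 0 = 0.
Proof. by rewrite /signed_pow mulr0. Qed.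

Lemma signed_pow_gt0 p t : 0 < t -> 0 < signed_pow p t.
Proof. by move=> t0; rewrite mulr_gt0// powR_gt0// normr_gt0 gt_eqF. Qed.

Lemma signed_pow_ge0 p t : 0 <= t -> 0 <= signed_pow p t.
Proof. by move=> t0; rewrite mulr_ge0// powR_ge0. Qed.

(** If u <= v the left side is nonpositive. Otherwise apply [powR_subadditive] to u = (u - v) + v
    and a + e = (a - b) + (b + e), and multiply by (a - b)^(p-1). *)
Let picone_wlog p a b u v e : 1 < p -> 0 <= b -> b < a -> 0 < e -> 0 <= u -> 0 <= v ->
  signed_pow p (a - b) * (u `^ p * (a + e) `^ (1 - p) - v `^ p * (b + e) `^ (1 - p))
  <= `|u - v| `^ p.
Proof.
move=> p1 b0 ba e0 u0 v0; have d0 : 0 < a - b by rewrite subr_gt0.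
have be0 : 0 < b + e by rewrite ltr_wpDl.
rewrite (signed_pow_ge0E p1 (ltW d0)).
have [uv|vu] := leP u v.
  apply: (@le_trans _ _ 0); last exact: powR_ge0.
  apply: mulr_ge0_le0; first exact: powR_ge0.
  rewrite subr_le0 ler_pM ?powR_ge0//; first by rewrite ler_powR_base// (le_trans _ (ltW p1)).
  rewrite -opprB !powRN lef_pV2 ?posrE ?powR_gt0//; last by rewrite ltr_wpDl// (le_trans b0)// ltW.
  by rewrite ler_powR_base ?subr_ge0 ?lerD2r// ltW.
have uv0 : 0 <= u - v by rewrite subr_ge0 ltW.
have := powR_subadditive (ltW p1) d0 be0 uv0 v0.
rewrite addrA !subrK => H; rewrite -lerBlDr in H.
rewrite (ger0_norm uv0).
have E : (a - b) `^ (p - 1) * ((u - v) `^ p * (a - b) `^ (1 - p)) = (u - v) `^ p.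
  rewrite mulrCA -powRD; last by rewrite (gt_eqF d0) implybT.
  by rewrite (_ : p - 1 + (1 - p) = 0) ?powRr0 ?mulr1//; ring.
by rewrite -[leRHS]E ler_wpM2l ?powR_ge0.
Qed.

Lemma discrete_picone p a b u v e : 1 < p -> 0 <= a -> 0 <= b -> 0 < e ->
  0 <= u -> 0 <= v ->
  signed_pow p (a - b) * (u `^ p * (a + e) `^ (1 - p) - v `^ p * (b + e) `^ (1 - p))
  <= `|u - v| `^ p.
Proof.
move=> p1 a0 b0 e0 u0 v0; have [ab|ab|->] := ltgtP a b.
- rewrite -opprB signed_powN mulNr -mulrN opprB distrC; exact: picone_wlog.
- exact: picone_wlog.
- by rewrite subrr signed_pow0 mul0r powR_ge0.
Qed.

Lemma continuous_norm_powR a : 0 <= a -> continuous (fun t : R => `|t| `^ a).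
Proof.
move=> a0 x; have [->|a_neq0] := eqVneq a 0.
  rewrite (_ : (fun _ => _) = cst 1); first exact: cvg_cst.
  by apply/funext => t; rewrite powRr0.
have {a0 a_neq0} a0 : 0 < a by rewrite lt_neqAle eq_sym a_neq0.
have [->|x0] := eqVneq x 0; last first.
  apply: (@continuous_comp R R R (fun t : R => `|t|) (fun t : R => t `^ a)).
    exact: (@norm_continuous _ R).
  apply/differentiable_continuous/derivable1_diffP/derivable_powR.
  by rewrite in_itv/= andbT normr_gt0.
rewrite /continuous_at normr0 powR0 ?gt_eqF//.
apply/cvgrPdist_le => /= e e0; near=> t.
rewrite sub0r normrN ger0_norm ?powR_ge0//.
have an0 : a != 0 by rewrite gt_eqF.
rewrite -[e](powRr1 (ltW e0)) -(mulVf an0) powRrM (ler_powR_base (ltW a0))//.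
near: t; have d0 : 0 < e `^ a^-1 by rewrite powR_gt0.
by exists (e `^ a^-1) => //= y /=; rewrite sub0r normrN => /ltW.
Unshelve. all: by end_near. Qed.

Lemma continuous_signed_pow p : 2 <= p -> continuous (signed_pow p).
Proof.
move=> p2 x; apply: cvgM; last exact: cvg_id.
by apply: continuous_norm_powR; rewrite subr_ge0.
Qed.

Lemma mul_powB1_le p a b : 1 < p -> 0 <= a -> 0 <= b ->
  a `^ (p - 1) * b <= a `^ p + b `^ p.
Proof.
move=> p1 a0 b0; have p0 : 0 < p by exact: lt_trans p1.
have [ab|ba] := leP a b.
  rewrite (@le_trans _ _ (b `^ p))// ?lerDr ?powR_ge0//.
  rewrite -(mulr_powRB1 b0 p0) mulrC ler_wpM2l//.
  by rewrite ler_powR_base// subr_ge0 ltW.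
rewrite (@le_trans _ _ (a `^ p))// ?lerDl ?powR_ge0//.
by rewrite -(mulr_powRB1 a0 p0) mulrC ler_wpM2r ?powR_ge0// ltW.
Qed.

End power_inequalities.

(** * The Euclidean norm and the local Picone inequality *)

Section euclidean.
Context {R : realType} {n : nat}.
Implicit Types (x y : 'rV[R]_n) (a : R).

Lemma dotvC x y : dotv x y = dotv y x.
Proof. by apply: eq_bigr => i _; rewrite mulrC. Qed.

Lemma dotvDl x y z : dotv (x + y) z = dotv x z + dotv y z.
Proof. by rewrite -big_split; apply: eq_bigr => i _; rewrite mxE mulrDl. Qed.

Lemma dotvZl a x y : dotv (a *: x) y = a * dotv x y.
Proof. by rewrite mulr_sumr; apply: eq_bigr => i _; rewrite mxE mulrA. Qed.

Lemma dotvDr x y z : dotv z (x + y) = dotv z x + dotv z y.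
Proof. by rewrite dotvC dotvDl !(dotvC z). Qed.

Lemma dotvZr a x y : dotv x (a *: y) = a * dotv x y.
Proof. by rewrite dotvC dotvZl dotvC. Qed.

Lemma dotv_ge0 x : 0 <= dotv x x.
Proof. by apply: sumr_ge0 => i _; rewrite -expr2 sqr_ge0. Qed.

Lemma dotv_eq0 x : dotv x x = 0 -> x = 0.
Proof.
move=> /eqP; rewrite psumr_eq0 => [/allP H|i _]; last by rewrite -expr2 sqr_ge0.
apply/rowP => i; have := H i (mem_index_enum i).
by rewrite mulf_eq0 orbb mxE => /eqP.
Qed.

Lemma enorm_ge0 x : 0 <= enorm x.
Proof. exact: sqrtr_ge0. Qed.

Lemma enorm_sq x : enorm x ^+ 2 = dotv x x.
Proof. by rewrite sqr_sqrtr// dotv_ge0. Qed.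

Lemma enorm0 : enorm (0 : 'rV[R]_n) = 0.
Proof. by rewrite /enorm /dotv big1 ?sqrtr0// => i _; rewrite mxE mul0r. Qed.

Lemma enormZ a x : enorm (a *: x) = `|a| * enorm x.
Proof. by rewrite /enorm dotvZl dotvZr mulrA -expr2 sqrtrM ?sqr_ge0// sqrtr_sqr. Qed.

Lemma enormN x : enorm (- x) = enorm x.
Proof. by rewrite -scaleN1r enormZ normrN normr1 mul1r. Qed.

Lemma cauchy_schwarz x y : `|dotv x y| <= enorm x * enorm y.
Proof.
have [->|y0] := eqVneq y 0.
  by rewrite enorm0 mulr0 (_ : dotv _ _ = 0) ?normr0// /dotv big1// => i _; rewrite mxE mulr0.
have yy : 0 < dotv y y.
  rewrite lt0r dotv_ge0 andbT; apply: contra y0 => /eqP /dotv_eq0 ->; exact: eqxx.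
rewrite -sqrtrM ?dotv_ge0// -sqrtr_sqr ler_sqrt ?mulr_ge0 ?dotv_ge0//.
have := dotv_ge0 (dotv y y *: x + (- dotv x y) *: y).
rewrite !(dotvDl, dotvDr, dotvZl, dotvZr) (dotvC y x).
set a := dotv x x; set b := dotv y y; set c := dotv x y => H.
have : 0 <= b * (a * b - c ^+ 2) by move: H; congr (_ <= _); ring.
by rewrite pmulr_rge0// subr_ge0.
Qed.

Lemma ler_enormD x y : enorm (x + y) <= enorm x + enorm y.
Proof.
have xy0 : 0 <= enorm x + enorm y by rewrite addr_ge0 ?enorm_ge0.
rewrite -(ger0_norm xy0) -sqrtr_sqr ler_sqrt ?sqr_ge0//.
rewrite dotvDl !dotvDr (dotvC y x) sqrrD !enorm_sq.
have := le_trans (ler_norm _) (cauchy_schwarz x y).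
set a := dotv x x; set b := dotv y y; set c := dotv x y; set d := enorm x * enorm y.
by rewrite mulr2n => H; lra.
Qed.

Lemma ler_coord_enorm x i : `|x ord0 i| <= enorm x.
Proof.
rewrite -sqrtr_sqr ler_sqrt ?dotv_ge0// /dotv (bigD1 i)//= -expr2 lerDl.
by apply: sumr_ge0 => j _; rewrite -expr2 sqr_ge0.
Qed.

Lemma enorm_le_sum x : enorm x <= \sum_i `|x ord0 i|.
Proof.
have s0 : 0 <= \sum_i `|x ord0 i| by apply: sumr_ge0.
rewrite -(ger0_norm s0) -sqrtr_sqr ler_sqrt ?sqr_ge0// expr2 mulr_sumr.
apply: ler_sum => i _; rewrite -expr2 -[leLHS]real_normK ?num_real// expr2.
by rewrite ler_wpM2r// (bigD1 i)//= lerDl; apply: sumr_ge0.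
Qed.

Lemma grad_test_bounded (U : set 'rV[R]_n) f : test_function U f ->
  exists2 C : R, 0 < C & forall x, enorm (grad f x) <= C.
Proof.
move=> tf.
have H i : exists c : R, 0 < c /\ forall x, `|partial i f x| <= c.
  by have [c c0 Hc] := test_partial_bounded i tf; exists c.
have [C HC] := choice H.
exists (1 + \sum_i C i).
  by rewrite ltr_wpDr//; apply: sumr_ge0 => i _; rewrite ltW//; case: (HC i).
move=> x; rewrite (le_trans (enorm_le_sum _))// ler_wpDl//.
by apply: ler_sum => i _; rewrite mxE; case: (HC i).
Qed.

(* The local Picone inequality; T stands for the derivative of |u|^p. *)
Lemma gradient_picone (p u m T : R) (g w : 'rV[R]_n) : 1 < p -> 0 <= u -> 0 < m ->
  `|T| = p * u `^ (p - 1) ->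
  enorm g `^ (p - 2) * dotv g (((1 - p) * u `^ p * m `^ (- p)) *: g
     + (T * m `^ (1 - p)) *: w) <= enorm w `^ p.
Proof.
move=> p1 u0 m0 TE; have p0 : 0 < p by exact: lt_trans p1.
have gE : `|enorm g| = enorm g by rewrite ger0_norm// enorm_ge0.
rewrite dotvDr !dotvZr -enorm_sq mulrDr.
set G := enorm g; set a := u / m * G; rewrite -/G in gE.
have m0' : 0 <= m^-1 by rewrite invr_ge0 ltW.
have a0 : 0 <= a by rewrite !mulr_ge0// enorm_ge0.
have -> : G `^ (p - 2) * ((1 - p) * u `^ p * m `^ (- p) * G ^+ 2) = (1 - p) * a `^ p.
  rewrite /a !powRM ?mulr_ge0 ?enorm_ge0//.
  rewrite -(powR_inv1 (ltW m0)) -powRrM mulN1r.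
  have -> : G `^ p = G `^ (p - 2) * G ^+ 2.
    by rewrite -[in LHS]gE -(signed_powM _ p1) /signed_pow gE expr2 mulrA.
  by ring.
apply: (@le_trans _ _ ((1 - p) * a `^ p + p * (a `^ (p - 1) * enorm w))); last first.
  by have := powR_young p1 a0 (enorm_ge0 w); lra.
rewrite lerD2l; apply: le_trans (ler_norm _) _.
rewrite normrM (ger0_norm (powR_ge0 _ _)) normrM normrM TE (ger0_norm (powR_ge0 _ _)).
apply: (@le_trans _ _ (G `^ (p - 2) * (p * u `^ (p - 1) * m `^ (1 - p) * (G * enorm w)))).
  rewrite ler_wpM2l ?powR_ge0// ler_wpM2l ?cauchy_schwarz//.
  by rewrite !mulr_ge0 ?powR_ge0// ltW.
rewrite /a !powRM ?mulr_ge0 ?enorm_ge0//.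
rewrite -(powR_inv1 (ltW m0)) -powRrM mulN1r opprB.
have -> : G `^ (p - 1) = G `^ (p - 2) * G by rewrite -[in LHS]gE -normr_powB2// gE.
by rewrite le_eqVlt; apply/orP; left; apply/eqP; ring.
Qed.

End euclidean.

(** * Integrals of nonnegative functions *)

Section nonnegative_integrals.
Context {R : realType} d (T : measurableType d) (mu : {measure set T -> \bar R}).
Variables (D : set T) (mD : measurable D).
Implicit Types (f g h F : T -> R).

Local Notation I f := (\int[mu]_(x in D) (f x)%:E)%E.

Lemma nint_ge0 f : (forall x, D x -> 0 <= f x) -> (0 <= I f)%E.
Proof. by move=> f0; apply: integral_ge0 => x Dx; rewrite lee_fin f0. Qed.

Lemma nint_le f g : measurable_fun D f -> measurable_fun D g ->
  (forall x, D x -> 0 <= f x <= g x) -> (I f <= I g)%E.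
Proof.
move=> mf mg fg; apply: ge0_le_integral => //.
- by move=> x /fg /andP[f0 _]; rewrite lee_fin.
- exact/measurable_EFinP.
- exact/measurable_EFinP.
- by move=> x /fg /andP[_ h]; rewrite lee_fin.
Qed.

Lemma nintD f g : measurable_fun D f -> measurable_fun D g ->
  (forall x, D x -> 0 <= f x) -> (forall x, D x -> 0 <= g x) ->
  (I (fun x => f x + g x)%R = I f + I g)%E.
Proof.
move=> mf mg f0 g0; under eq_integral do rewrite EFinD.
apply: ge0_integralD => //; exact/measurable_EFinP.
Qed.

Lemma nintZ (c : R) f : measurable_fun D f -> (forall x, D x -> 0 <= f x) -> 0 <= c ->
  (I (fun x => c * f x)%R = c%:E * I f)%E.
Proof.
move=> mf f0 c0; under eq_integral do rewrite EFinM.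
by apply: ge0_integralZl_EFin => //; exact/measurable_EFinP.
Qed.

Lemma nint_lin_le (a b : R) h f g : measurable_fun D h -> measurable_fun D f ->
  measurable_fun D g -> (forall x, D x -> 0 <= f x) -> (forall x, D x -> 0 <= g x) ->
  0 <= a -> 0 <= b -> (forall x, D x -> 0 <= h x <= a * f x + b * g x) ->
  (I h <= a%:E * I f + b%:E * I g)%E.
Proof.
move=> mh mf mg f0 g0 a0 b0 H.
rewrite -!nintZ// -nintD//.
- apply: nint_le => //; apply: measurable_funD; exact: measurable_funM.
- exact: measurable_funM.
- exact: measurable_funM.
- by move=> x Dx; rewrite mulr_ge0// f0.
- by move=> x Dx; rewrite mulr_ge0// g0.
Qed.

Lemma nint_integrable f : measurable_fun D f -> (forall x, D x -> 0 <= f x) ->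
  (I f < +oo)%E -> mu.-integrable D (EFin \o f).
Proof.
move=> mf f0 fi; apply/integrableP; split; first exact/measurable_EFinP.
apply: le_lt_trans fi; rewrite le_eqVlt; apply/orP; left; apply/eqP.
by apply: eq_integral => x /set_mem Dx /=; rewrite ger0_norm// f0.
Qed.

Lemma integrable_bound f F : measurable_fun D f -> measurable_fun D F ->
  (forall x, D x -> `|f x| <= F x) -> (I F < +oo)%E ->
  mu.-integrable D (EFin \o f).
Proof.
move=> mf mF fF iF; apply/integrableP; split; first exact/measurable_EFinP.
apply: le_lt_trans iF; apply: nint_le => //; first exact: measurableT_comp.
by move=> x Dx; rewrite normr_ge0 fF.
Qed.

Lemma nint_dominated (f : nat -> T -> R) F :
  (forall k, measurable_fun D (f k)) -> measurable_fun D F ->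
  (forall k x, D x -> 0 <= f k x <= F x) -> (I F < +oo)%E ->
  {ae mu, forall x, D x -> f k x @[k --> \oo] --> 0} ->
  I (f k) @[k --> \oo] --> 0%E.
Proof.
move=> mf mF fF iF aef.
have [| | | | |_ _] := @dominated_convergence _ _ _ mu D mD (fun k => EFin \o f k)
  (cst 0%E) (EFin \o F).
- by move=> k; exact/measurable_EFinP.
- exact: measurable_cst.
- apply: filterS aef => x H Dx; apply/fine_cvgP; split; first by near=> k.
  exact: H.
- apply: nint_integrable => // x Dx; have /andP[h1 h2] := fF 0%N x Dx.
  exact: le_trans h1 h2.
- apply: aeW => x k Dx; have /andP[h1 h2] := fF k x Dx.
  by rewrite /= lee_fin ger0_norm.
by rewrite integral0.
Unshelve. all: by end_near. Qed.

(** The sum of the f k has integral at most 1, hence is finite almost everywhere, and its terms tend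
    to 0. Asking for this speed replaces the extraction of an almost everywhere convergent
    subsequence. *)
Lemma nint_fast_ae (f : nat -> T -> R) :
  (forall k, measurable_fun D (f k)) -> (forall k x, D x -> 0 <= f k x) ->
  (forall k, (I (f k) <= (1 / (2 ^ k.+1)%:R)%:E)%E) ->
  {ae mu, forall x, D x -> f k x @[k --> \oo] --> 0}.
Proof.
move=> mf f0 fI.
have S : (\int[mu]_(x in D) (\sum_(0 <= k <oo) (f k x)%:E) < +oo)%E.
  rewrite integral_nneseries//; last by move=> k; exact/measurable_EFinP.
  apply: (@le_lt_trans _ _ 1%E); last exact: ltry.
  apply: le_trans (epsilon_trick0 xpredT (@ler01 R)).
  by apply: lee_nneseries => // k _ _; apply: nint_ge0 => x; exact: f0.
have sge0 x : D x -> (0 <= \sum_(0 <= k <oo) (f k x)%:E)%E.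
  by move=> Dx; apply: nneseries_ge0 => k _ _; rewrite lee_fin f0.
have : mu.-integrable D (fun x => \sum_(0 <= k <oo) (f k x)%:E)%E.
  apply/integrableP; split.
    apply: ge0_emeasurable_sum; first by move=> k x Dx _; rewrite lee_fin f0.
    by move=> k _; exact/measurable_EFinP.
  apply: le_lt_trans S; rewrite le_eqVlt; apply/orP; left; apply/eqP.
  by apply: eq_integral => x /set_mem Dx; rewrite gee0_abs// sge0.
move=> /(integrable_ae mD); apply: filterS => x H Dx.
apply: cvg_series_cvg_0; apply: nnseries_is_cvg; first by move=> k; exact: f0.
by rewrite -ge0_fin_numE ?sge0//; exact: H.
Qed.

End nonnegative_integrals.

Section measurable_vector_fields.
Context {R : realType} {n : nat} d (T : measurableType d) (D : set T).
Hypothesis mD : measurable D.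
Implicit Types (g h : T -> 'rV[R]_n) (a : T -> R).

Lemma measurable_enorm g : measurable_fun D g -> measurable_fun D (fun x => enorm (g x)).
Proof.
move=> mg; apply: (@measurableT_comp _ _ _ _ _ _ (@enorm R n)) => //.
apply: continuous_measurable_rV => x; apply: continuous_comp; last exact: sqrt_continuous.
have : smooth (fun x : 'rV[R]_n => dotv x x).
  by apply: smooth_sum => i; apply: smoothM; exact: smooth_coord.
by move/smooth_continuous; apply.
Qed.

Lemma measurable_dotv g h : measurable_fun D g -> measurable_fun D h ->
  measurable_fun D (fun x => dotv (g x) (h x)).
Proof.
move=> /measurable_fun_rVP -/(_ mD) mg /measurable_fun_rVP -/(_ mD) mh.
by apply: measurable_sum => i; apply: measurable_funM.
Qed.

Lemma measurable_rVD g h : measurable_fun D g -> measurable_fun D h ->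
  measurable_fun D (fun x => g x + h x).
Proof.
move=> /measurable_fun_rVP -/(_ mD) mg /measurable_fun_rVP -/(_ mD) mh.
apply/measurable_fun_rVP => // i; under eq_fun do rewrite mxE.
exact: measurable_funD.
Qed.

Lemma measurable_rVZ a g : measurable_fun D a -> measurable_fun D g ->
  measurable_fun D (fun x => a x *: g x).
Proof.
move=> ma /measurable_fun_rVP -/(_ mD) mg.
apply/measurable_fun_rVP => // i; under eq_fun do rewrite mxE.
exact: measurable_funM.
Qed.

Lemma measurable_rVB g h : measurable_fun D g -> measurable_fun D h ->
  measurable_fun D (fun x => g x - h x).
Proof.
move=> mg mh; under eq_fun do rewrite -scaleN1r.
by apply: measurable_rVD => //; apply: measurable_rVZ.
Qed.

Lemma measurable_norm_powR p a : measurable_fun D a ->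
  measurable_fun D (fun x => `|a x| `^ p).
Proof.
move=> ma; apply: (@measurableT_comp _ _ _ _ _ _ (@powR R ^~ p)) => //.
exact: measurableT_comp.
Qed.

Lemma measurable_enorm_powR p g : measurable_fun D g ->
  measurable_fun D (fun x => enorm (g x) `^ p).
Proof.
move=> mg; apply: (@measurableT_comp _ _ _ _ _ _ (@powR R ^~ p)) => //.
exact: measurable_enorm.
Qed.

End measurable_vector_fields.

(** * The space of limits of test functions *)

Section sobolev_closure.
Context {R : realType} {n : nat}.
Local Notation mu := (lebesgue_rV R n).
Implicit Types (p : R) (U : set 'rV[R]_n) (u v w psi : 'rV[R]_n -> R)
  (g h : 'rV[R]_n -> 'rV[R]_n).

Lemma RintegralK (D : set 'rV[R]_n) (f : 'rV[R]_n -> R) : measurable D ->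
  mu.-integrable D (EFin \o f) ->
  (\int[mu]_(x in D) f x)%R%:E = (\int[mu]_(x in D) (f x)%:E)%E.
Proof. by move=> mD fi; rewrite fineK//; exact: integrable_fin_num. Qed.

Lemma Rintegral_support U (f : 'rV[R]_n -> R) : (forall x, ~ U x -> f x = 0) ->
  \int[mu]_(x in U) f x = \int[mu]_x f x.
Proof.
move=> f0; rewrite Rintegral_mkcond; congr Rintegral; apply/funext => x.
by rewrite patchE; case: ifPn => // /negP; rewrite inE => /f0 ->.
Qed.

Lemma measurable_test D U psi : test_function U psi -> measurable_fun D psi.
Proof.
by move=> [sp _ _]; apply: measurable_funTS; apply: continuous_measurable_rV; exact: smooth_continuous.
Qed.

Lemma measurable_test_partial D U psi i : test_function U psi ->
  measurable_fun D (partial i psi).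
Proof.
move=> [sp _ _]; apply: measurable_funTS; apply: continuous_measurable_rV.
exact/smooth_continuous/smooth_partial.
Qed.

Lemma measurable_test_grad D U psi : measurable D -> test_function U psi ->
  measurable_fun D (grad psi).
Proof.
move=> mD tp; apply/measurable_fun_rVP => // i.
under eq_fun do rewrite mxE.
exact: measurable_test_partial tp.
Qed.

Lemma test_integrable p U psi (D : set 'rV[R]_n) : 0 <= p -> measurable D ->
  (mu D < +oo)%E -> test_function U psi ->
  (\int[mu]_(x in D) (`|psi x| `^ p)%:E < +oo)%E /\
  (\int[mu]_(x in D) (enorm (grad psi x) `^ p)%:E < +oo)%E.
Proof.
move=> p0 mD Dfin tp.
have bd (f : 'rV[R]_n -> R) C : measurable_fun D f -> (forall x, 0 <= f x <= C) ->
    (\int[mu]_(x in D) (f x)%:E < +oo)%E.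
  move=> mf fC; apply: (@le_lt_trans _ _ (C%:E * mu D)%E).
    rewrite -integral_cst//; apply: nint_le => //; exact: measurable_cst.
  have C0 : 0 <= C by have /andP[h1 h2] := fC 0; exact: le_trans h2.
  by rewrite lte_mul_pinfty.
have [C C0 HC] := test_bounded tp; have [C' C0' HC'] := grad_test_bounded tp.
split.
  apply: (bd _ (C `^ p)).
    by apply: measurable_norm_powR; exact: measurable_test tp.
  by move=> x; rewrite powR_ge0 ler_powR_base.
apply: (bd _ (C' `^ p)).
  by apply: measurable_enorm_powR => //; exact: measurable_test_grad tp.
by move=> x; rewrite powR_ge0 ler_powR_base ?enorm_ge0.
Qed.

Definition approximable p U u g := forall eps : R, 0 < eps ->
  exists2 psi, test_function U psi &
    (\int[mu]_(x in U) (`|u x - psi x| `^ p)%:E +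
     \int[mu]_(x in U) (enorm (g x - grad psi x) `^ p)%:E < eps%:E)%E.

Lemma approximable_seq p U u g (e : nat -> R) : (forall k, 0 < e k) ->
  approximable p U u g ->
  exists psi : nat -> 'rV[R]_n -> R, forall k, [/\ test_function U (psi k),
    (\int[mu]_(x in U) (`|u x - psi k x| `^ p)%:E <= (e k)%:E)%E &
    (\int[mu]_(x in U) (enorm (g x - grad (psi k) x) `^ p)%:E <= (e k)%:E)%E].
Proof.
move=> e0 ap.
have H k : exists psi, [/\ test_function U psi,
    (\int[mu]_(x in U) (`|u x - psi x| `^ p)%:E <= (e k)%:E)%E &
    (\int[mu]_(x in U) (enorm (g x - grad psi x) `^ p)%:E <= (e k)%:E)%E].
  have [psi tp /ltW H] := ap _ (e0 k); exists psi; split=> //.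
    by apply: le_trans H; rewrite leeDl// nint_ge0// => x _; exact: powR_ge0.
  by apply: le_trans H; rewrite leeDr// nint_ge0// => x _; exact: powR_ge0.
have [psi Hpsi] := choice H; by exists psi.
Qed.

(** If a > t then a <= t (a / t)^p. Integrated over a set of finite measure, this controls an L^1
    norm by an L^p norm with t at choice, in place of Hoelder's inequality. *)
Lemma le_add_powR p (t a : R) : 1 <= p -> 0 < t -> 0 <= a ->
  a <= t + t `^ (1 - p) * a `^ p.
Proof.
move=> p1 t0 a0; have [at_|ta] := leP a t.
  by rewrite (le_trans at_)// lerDl mulr_ge0 ?powR_ge0.
rewrite ler_wpDl ?(ltW t0)// mulrC -powR_perspective//.
rewrite -ler_pdivrMr// le1r_powR// ler_pdivlMr// mul1r; exact: ltW.
Qed.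

Lemma measurable_sub_norm_powR p D u v : measurable_fun D u -> measurable_fun D v ->
  measurable_fun D (fun x => `|u x - v x| `^ p).
Proof. by move=> mu_ mv; apply: measurable_norm_powR; exact: measurable_funB. Qed.

Lemma measurable_sub_enorm_powR p D g h : measurable D ->
  measurable_fun D g -> measurable_fun D h ->
  measurable_fun D (fun x => enorm (g x - h x) `^ p).
Proof. by move=> mD mg mh; apply: measurable_enorm_powR => //; exact: measurable_rVB. Qed.

Lemma le_normB_powR p (a b c : R) : 1 <= p ->
  `|a - c| `^ p <= 2 `^ (p - 1) * `|a - b| `^ p + 2 `^ (p - 1) * `|b - c| `^ p.
Proof.
move=> p1; have p0 : 0 <= p by exact: le_trans p1.
rewrite -mulrDr; apply: le_trans (powRD_le p1 (normr_ge0 _) (normr_ge0 _)).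
by rewrite ler_powR_base// (_ : a - c = (a - b) + (b - c)) ?ler_normD//; ring.
Qed.

Lemma le_enormB_powR p (a b c : 'rV[R]_n) : 1 <= p ->
  enorm (a - c) `^ p <=
  2 `^ (p - 1) * enorm (a - b) `^ p + 2 `^ (p - 1) * enorm (b - c) `^ p.
Proof.
move=> p1; have p0 : 0 <= p by exact: le_trans p1.
rewrite -mulrDr; apply: le_trans (powRD_le p1 (enorm_ge0 _) (enorm_ge0 _)).
rewrite ler_powR_base ?enorm_ge0// (_ : a - c = (a - b) + (b - c)) ?ler_enormD//.
by rewrite addrA subrK.
Qed.

(** * Limits of test functions on a set of finite measure *)

Section approximation.
Variables (p : R) (U : set 'rV[R]_n).
Hypotheses (p1 : 1 <= p) (mU : measurable U) (Ufin : (mu U < +oo)%E).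

Let p0 : 0 <= p. Proof. exact: le_trans p1. Qed.

Lemma nint_triangle u v w : measurable_fun U u -> measurable_fun U v ->
  measurable_fun U w ->
  (\int[mu]_(x in U) (`|u x - w x| `^ p)%:E <=
   (2 `^ (p - 1))%:E * \int[mu]_(x in U) (`|u x - v x| `^ p)%:E +
   (2 `^ (p - 1))%:E * \int[mu]_(x in U) (`|v x - w x| `^ p)%:E)%E.
Proof.
move=> mu_ mv mw; apply: nint_lin_le => //; try exact: measurable_sub_norm_powR.
by move=> x _; rewrite powR_ge0 le_normB_powR.
Qed.

Lemma nint_triangle_rV (f g h : 'rV[R]_n -> 'rV[R]_n) : measurable_fun U f ->
  measurable_fun U g -> measurable_fun U h ->
  (\int[mu]_(x in U) (enorm (f x - h x) `^ p)%:E <=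
   (2 `^ (p - 1))%:E * \int[mu]_(x in U) (enorm (f x - g x) `^ p)%:E +
   (2 `^ (p - 1))%:E * \int[mu]_(x in U) (enorm (g x - h x) `^ p)%:E)%E.
Proof.
move=> mf mg mh; apply: nint_lin_le => //; try exact: measurable_sub_enorm_powR.
- by move=> x _; exact: powR_ge0.
- by move=> x _; exact: powR_ge0.
- by move=> x _; rewrite powR_ge0 le_enormB_powR.
Qed.

Lemma approximable_finite u g : measurable_fun U u -> measurable_fun U g ->
  approximable p U u g ->
  (\int[mu]_(x in U) (`|u x| `^ p)%:E < +oo)%E /\
  (\int[mu]_(x in U) (enorm (g x) `^ p)%:E < +oo)%E.
Proof.
move=> mu_ mg ap.
have [psi /(_ 0%N) [tp Hu Hg]] := @approximable_seq p U u g (cst 1) (fun _ => ltr01) ap.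
have [f1 f2] := test_integrable p0 mU Ufin tp.
have fin (A B : \bar R) : (A <= 1%:E)%E -> (B < +oo)%E -> (0 <= B)%E -> (0 <= A)%E ->
    ((2 `^ (p - 1))%:E * A + (2 `^ (p - 1))%:E * B < +oo)%E.
  move=> A1 Boo B0 A0; rewrite lte_add_pinfty// lte_mul_pinfty//.
  exact: le_lt_trans A1 (ltry _).
have mz : measurable_fun U (fun _ : 'rV[R]_n => 0 : R) by exact: measurable_cst.
have [z0 z0E] : exists z0 : 'rV[R]_n, forall x, x - z0 = x by exists 0 => x; exact: subr0.
have mz' : measurable_fun U (fun _ : 'rV[R]_n => z0) by exact: measurable_cst.
have mp := @measurable_test U _ _ tp; have mgp := measurable_test_grad mU tp.
have nn0 (f : 'rV[R]_n -> R) : (forall x, 0 <= f x) -> (0 <= \int[mu]_(x in U) (f x)%:E)%E.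
  by move=> f0; apply: nint_ge0 => x _; exact: f0.
split.
  have Eu : (\int[mu]_(x in U) (`|u x - 0| `^ p)%:E = \int[mu]_(x in U) (`|u x| `^ p)%:E)%E.
    by apply: eq_integral => x _; rewrite subr0.
  have Ep : (\int[mu]_(x in U) (`|psi 0%N x - 0| `^ p)%:E = \int[mu]_(x in U) (`|psi 0%N x| `^ p)%:E)%E.
    by apply: eq_integral => x _; rewrite subr0.
  have HT := nint_triangle mu_ mp mz; rewrite Eu Ep in HT.
  apply: le_lt_trans HT (fin _ _ Hu f1 _ _); apply: nn0 => x; exact: powR_ge0.
have Eg : (\int[mu]_(x in U) (enorm (g x - z0) `^ p)%:E = \int[mu]_(x in U) (enorm (g x) `^ p)%:E)%E.
  by apply: eq_integral => x _; rewrite z0E.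
have Ep : (\int[mu]_(x in U) (enorm (grad (psi 0%N) x - z0) `^ p)%:E = \int[mu]_(x in U) (enorm (grad (psi 0%N) x) `^ p)%:E)%E.
  by apply: eq_integral => x _; rewrite z0E.
rewrite -Eg; apply: (le_lt_trans (nint_triangle_rV mg mgp mz')).
apply: (fin _ _ Hg).
- by rewrite Ep.
- by apply: nn0 => x; exact: powR_ge0.
- by apply: nn0 => x; exact: powR_ge0.
Qed.

(** The defect A in the integration by parts formula is zero for a test function psi and depends
    continuously on the pair (u, g) in L^p; approximating (u, g) by psi makes it smaller than any
    e. *)
Lemma approximable_weak_gradient u g : measurable_fun U u -> measurable_fun U g ->
  approximable p U u g -> weak_gradient U u g.
Proof.
move=> mu_ mg ap eta teta i.
have [fu fg] := approximable_finite mu_ mg ap.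
have [C1 C10 HC1] := test_bounded teta.
have [C2 C20 HC2] := test_partial_bounded i teta.
pose C := C1 + C2; have C0 : 0 < C by rewrite addr_gt0.
have HC1' x : `|eta x| <= C by rewrite (le_trans (HC1 x))// lerDl ltW.
have HC2' x : `|partial i eta x| <= C by rewrite (le_trans (HC2 x))// lerDr ltW.
have me := @measurable_test U _ _ teta; have mpe := @measurable_test_partial U _ _ i teta.
have mgi : measurable_fun U (fun x => g x ord0 i) by have := (measurable_fun_rVP _ mU).1 mg i.
have le1 (a : R) : 0 <= a -> a <= 1 + a `^ p.
  by move=> a0; have := le_add_powR p1 (@ltr01 R) a0; rewrite powR1 mul1r.
have mcst (c : R) : measurable_fun U (fun _ : 'rV[R]_n => c) by exact: measurable_cst.
have finF (f : 'rV[R]_n -> R) : measurable_fun U f -> (forall x, 0 <= f x) ->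
    (\int[mu]_(x in U) (f x `^ p)%:E < +oo)%E ->
    (\int[mu]_(x in U) (C * (1 + f x `^ p))%:E < +oo)%E.
  move=> mf f0 ff; have mfp : measurable_fun U (fun x => f x `^ p).
    exact: (@measurableT_comp _ _ _ _ _ _ (@powR R ^~ p)).
  rewrite nintZ ?(ltW C0)//; last 2 first.
  - exact: measurable_funD.
  - by move=> x _; rewrite addr_ge0 ?powR_ge0.
  rewrite nintD//; last by move=> x _; exact: powR_ge0.
  rewrite integral_cst// mul1e lte_mul_pinfty ?lee_fin ?(ltW C0)//.
  by rewrite lte_add_pinfty.
have int1 (f e : 'rV[R]_n -> R) : measurable_fun U f -> measurable_fun U e ->
    (forall x, `|e x| <= C) -> (\int[mu]_(x in U) (`|f x| `^ p)%:E < +oo)%E ->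
    mu.-integrable U (EFin \o (fun x => f x * e x)).
  move=> mf me' eC ff; apply: (integrable_bound mU _ _ _ (finF (fun x => `|f x|) _ _ ff)) => //.
  - exact: measurable_funM.
  - apply: measurable_funM => //; apply: measurable_funD => //; exact: measurable_norm_powR.
  - by move=> x _; rewrite normrM mulrC ler_pM// le1.
  - exact: measurableT_comp.
have fgi : (\int[mu]_(x in U) (`|g x ord0 i| `^ p)%:E < +oo)%E.
  apply: le_lt_trans fg; apply: nint_le => //.
  - exact: measurable_norm_powR.
  - exact: measurable_enorm_powR.
  - by move=> x _; rewrite powR_ge0 ler_powR_base ?ler_coord_enorm.
have iu := int1 u _ mu_ mpe HC2' fu.
have ig := int1 _ _ mgi me HC1' fgi.
apply/eqP; rewrite -subr_eq0 opprK -RintegralD//; set A := Rintegral _ _ _.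
suff HA : forall e : R, 0 < e -> `|A| <= e.
  by rewrite -normr_le0; apply/ler_addgt0Pl => e e0; rewrite addr0 HA.
move=> e e0.
pose m := fine (mu U); have mE : (m%:E = mu U)%E by rewrite fineK// ge0_fin_numE.
have m0 : 0 <= m by rewrite fine_ge0.
(* The bound [ZF] below has a constant part, with integral 2 C t m, and a power part, with integral
   at most 2 C t^(1-p) eps. The choices of t and eps make each at most e / 2; m + 1 allows for m =
   0. *)
pose t := e / (4 * C * (m + 1)); have t0 : 0 < t.
  by rewrite divr_gt0// !mulr_gt0// ltr_wpDl.
pose eps := e / (4 * C * t `^ (1 - p)).
have tp0 : 0 < t `^ (1 - p) by rewrite powR_gt0.
have eps0 : 0 < eps by rewrite divr_gt0// !mulr_gt0.
have [psis /(_ 0%N)] := @approximable_seq p U u g (cst eps) (fun _ => eps0) ap.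
move: (psis 0%N) => psi [tpsi Hu Hg].
have mp := @measurable_test U _ _ tpsi; have mgp := measurable_test_grad mU tpsi.
have mpi := @measurable_test_partial U _ _ i tpsi.
have [fp fgp] := test_integrable p0 mU Ufin tpsi.
have fpi : (\int[mu]_(x in U) (`|partial i psi x| `^ p)%:E < +oo)%E.
  apply: le_lt_trans fgp; apply: nint_le => //.
  - exact: measurable_norm_powR.
  - exact: measurable_enorm_powR.
  - move=> x _; rewrite powR_ge0 ler_powR_base//.
    by have := ler_coord_enorm (grad psi x) i; rewrite mxE.
have ip := int1 psi _ mp mpe HC2' fp.
have ipi := int1 _ _ mpi me HC1' fpi.
have ibp : \int[mu]_(x in U) (psi x * partial i eta x + partial i psi x * eta x) = 0.
  rewrite RintegralD//.
  rewrite (@Rintegral_support U (fun x => psi x * partial i eta x)); last first.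
    by move=> x /(test_eq0 tpsi) ->; rewrite mul0r.
  rewrite (@Rintegral_support U (fun x => partial i psi x * eta x)); last first.
    by move=> x /(test_eq0 teta) ->; rewrite mulr0.
  case: tpsi teta => [s1 c1 _] [s2 _ _].
  by rewrite smooth_integration_by_parts// addNr.
pose Z x := (u x - psi x) * partial i eta x + (g x ord0 i - partial i psi x) * eta x.
have AE : A = \int[mu]_(x in U) Z x.
  rewrite -[A]subr0 -ibp -RintegralB//; last 2 first.
  - exact: (integrableD mU iu ig).
  - exact: (integrableD mU ip ipi).
  by apply: eq_Rintegral => x _; rewrite /Z; ring.
have mZ : measurable_fun U Z.
  by apply: measurable_funD; apply: measurable_funM => //; exact: measurable_funB.
pose F1 x := `|u x - psi x| `^ p; pose F2 x := enorm (g x - grad psi x) `^ p.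
have mF1 : measurable_fun U F1 by exact: measurable_sub_norm_powR.
have mF2 : measurable_fun U F2 by exact: measurable_sub_enorm_powR.
have F10 x : 0 <= F1 x by exact: powR_ge0.
have F20 x : 0 <= F2 x by exact: powR_ge0.
have C0' : 0 <= C by exact: ltW.
have t0' : 0 <= t by exact: ltW.
have tp0' : 0 <= t `^ (1 - p) by exact: powR_ge0.
have ZF x : `|Z x| <= C * (2 * t) + C * t `^ (1 - p) * (F1 x + F2 x).
  rewrite (le_trans (ler_normD _ _))// !normrM.
  have h1 := le_add_powR p1 t0 (normr_ge0 (u x - psi x)).
  have h2 := le_add_powR p1 t0 (enorm_ge0 (g x - grad psi x)).
  have h3 : `|g x ord0 i - partial i psi x| <= enorm (g x - grad psi x).
    by have := ler_coord_enorm (g x - grad psi x) i; rewrite !mxE.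
  have k1 : `|u x - psi x| * `|partial i eta x| <= (t + t `^ (1 - p) * F1 x) * C.
    by rewrite ler_pM.
  have k2 : `|g x ord0 i - partial i psi x| * `|eta x| <= (t + t `^ (1 - p) * F2 x) * C.
    by rewrite ler_pM// (le_trans h3).
  by apply: le_trans (lerD k1 k2) _; rewrite le_eqVlt; apply/orP; left; apply/eqP; ring.
have bnd : (\int[mu]_(x in U) (`|Z x|)%:E <= e%:E)%E.
  apply: (@le_trans _ _ (\int[mu]_(x in U) (C * (2 * t) + C * t `^ (1 - p) * (F1 x + F2 x))%:E)%E).
    apply: nint_le => //; first exact: measurableT_comp.
    - apply: measurable_funD => //; apply: measurable_funM => //; exact: measurable_funD.
    - by move=> x _; rewrite normr_ge0 ZF.
  have mF12 : measurable_fun U (fun x => F1 x + F2 x) by exact: measurable_funD.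
  rewrite nintD//; last 3 first.
  - exact: measurable_funM.
  - by move=> x _; rewrite mulr_ge0// mulr_ge0.
  - by move=> x _; rewrite mulr_ge0 ?addr_ge0// mulr_ge0.
  rewrite integral_cst// nintZ//; last 2 first.
  - by move=> x _; rewrite addr_ge0.
  - by rewrite mulr_ge0.
  rewrite nintD// [X in (X + _ <= _)%E](_ : _ = (C * (2 * t) * m)%:E); last first.
    by rewrite [RHS]EFinM mE.
  have HH : (\int[mu]_(x in U) (F1 x)%:E + \int[mu]_(x in U) (F2 x)%:E <= (eps + eps)%:E)%E.
    by rewrite EFinD; apply: leeD; [exact: Hu|exact: Hg].
  apply: (@le_trans _ _ ((C * (2 * t) * m)%:E + (C * t `^ (1 - p))%:E * (eps + eps)%:E)%E).
    by rewrite leeD2l// lee_wpmul2l// lee_fin mulr_ge0.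
  rewrite -EFinM -EFinD lee_fin.
  have -> : C * t `^ (1 - p) * (eps + eps) = e / 2.
    by rewrite /eps; field; rewrite !gt_eqF.
  have -> : C * (2 * t) * m = e / 2 * (m / (m + 1)).
    by rewrite /t; field; rewrite !gt_eqF// ltr_wpDl.
  have : m / (m + 1) <= 1 by rewrite ler_pdivrMr ?ltr_wpDl// mul1r lerDl.
  have e20 : 0 < e / 2 by rewrite divr_gt0.
  by move=> hm; have := ler_wpM2l (ltW e20) hm; lra.
have iZ : mu.-integrable U (EFin \o Z).
  apply/integrableP; split; first exact/measurable_EFinP.
  exact: le_lt_trans bnd (ltry _).
rewrite AE; apply: le_trans (le_normr_Rintegral mU iZ) _.
rewrite -lee_fin RintegralK//.
exact: (integrable_norm iZ).
Qed.

(** Approximation by test functions already entails integrability and the weak gradient identity, so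
    those clauses of [W1p0] need not be established separately afterwards. *)
Lemma W1p0_intro u g : measurable_fun U u -> measurable_fun U g ->
  (forall x, ~ U x -> u x = 0) -> approximable p U u g -> W1p0 p U u g.
Proof.
move=> mu_ mg u0 ap; have [fu fg] := approximable_finite mu_ mg ap.
by split=> //; split=> //; exact: approximable_weak_gradient.
Qed.

Lemma test_W1p0 psi : test_function U psi -> W1p0 p U psi (grad psi).
Proof.
move=> tp; apply: W1p0_intro.
- exact: measurable_test tp.
- exact: measurable_test_grad tp.
- by move=> x; exact: test_eq0 tp.
- move=> eps e0; exists psi => //.
  under eq_integral do rewrite subrr normr0.
  under [X in (_ + X)%E]eq_integral do rewrite subrr enorm0.
  have pn0 : p != 0 by rewrite gt_eqF// (lt_le_trans ltr01 p1).
  by rewrite powR0// integral0 adde0 lte_fin.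
Qed.

Lemma W1p0_lim (v : nat -> 'rV[R]_n -> R) (h : nat -> 'rV[R]_n -> 'rV[R]_n) u g :
  (forall k, W1p0 p U (v k) (h k)) -> (forall x, ~ U x -> u x = 0) ->
  measurable_fun U u -> measurable_fun U g ->
  (\int[mu]_(x in U) (`|u x - v k x| `^ p)%:E @[k --> \oo] --> 0)%E ->
  (\int[mu]_(x in U) (enorm (g x - h k x) `^ p)%:E @[k --> \oo] --> 0)%E ->
  W1p0 p U u g.
Proof.
move=> Wv u0 mu_ mg cu cg; apply: W1p0_intro => // eps e0.
pose c := (2 : R) `^ (p - 1); have c0 : 0 < c by rewrite powR_gt0.
(* Each of the two integrals will be at most c (d + d), and 4 c d = eps / 2. *)
pose d := eps / (8 * c); have d0 : 0 < d by rewrite divr_gt0// mulr_gt0.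
have near_lt (a : nat -> \bar R) : (a k @[k --> \oo] --> 0)%E ->
    \forall k \near \oo, (a k < d%:E)%E.
  move=> /fine_cvgP[afin /cvgr_lt /(_ d d0)]; apply: filterS2 afin => k fk.
  by rewrite -lte_fin fineK.
have [k [Hu Hg]] : exists k,
    (\int[mu]_(x in U) (`|u x - v k x| `^ p)%:E < d%:E)%E /\
    (\int[mu]_(x in U) (enorm (g x - h k x) `^ p)%:E < d%:E)%E.
  have [k _ /(_ _ (leqnn k))] := filterI (near_lt _ cu) (near_lt _ cg).
  by exists k.
have [[mv mh _ _ _] _ apk] := Wv k.
have [psis /(_ 0%N)] := @approximable_seq p U _ _ (cst d) (fun _ => d0) apk.
move: (psis 0%N) => psi [tp Hvu Hvg].
exists psi => //.
have mp := @measurable_test U _ _ tp; have mgp := measurable_test_grad mU tp.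
apply: (@le_lt_trans _ _ ((c * (d + d))%:E + (c * (d + d))%:E)%E); last first.
  rewrite -EFinD lte_fin.
  have -> : c * (d + d) + c * (d + d) = eps / 2 by rewrite /d; field; rewrite gt_eqF.
  by rewrite ltr_pdivrMr// ltr_pMr// ltr1n.
have comb (A B : \bar R) : (A <= d%:E)%E -> (B <= d%:E)%E ->
    (c%:E * A + c%:E * B <= (c * (d + d))%:E)%E.
  move=> Ad Bd; rewrite mulrDr EFinD !EFinM leeD// lee_wpmul2l// lee_fin; exact: ltW.
apply: leeD.
  exact: le_trans (nint_triangle mu_ mv mp) (comb _ _ (ltW Hu) Hvu).
exact: le_trans (nint_triangle_rV mg mh mgp) (comb _ _ (ltW Hg) Hvg).
Qed.

End approximation.

End sobolev_closure.

(** * Chain rule *)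

Section sobolev_chain_rule.
Context {R : realType} {n : nat}.
Local Notation mu := (lebesgue_rV R n).
Implicit Types (p : R) (U Omega : set 'rV[R]_n) (u v w psi : 'rV[R]_n -> R)
  (g h : 'rV[R]_n -> 'rV[R]_n).

Lemma nint_cvg0_le U (a b : R) (h f g : nat -> 'rV[R]_n -> R) : measurable U ->
  (forall k, measurable_fun U (h k)) -> (forall k, measurable_fun U (f k)) ->
  (forall k, measurable_fun U (g k)) -> (forall k x, U x -> 0 <= f k x) ->
  (forall k x, U x -> 0 <= g k x) -> 0 <= a -> 0 <= b ->
  (forall k x, U x -> 0 <= h k x <= a * f k x + b * g k x) ->
  (\int[mu]_(x in U) (f k x)%:E @[k --> \oo] --> 0)%E ->
  (\int[mu]_(x in U) (g k x)%:E @[k --> \oo] --> 0)%E ->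
  (\int[mu]_(x in U) (h k x)%:E @[k --> \oo] --> 0)%E.
Proof.
move=> mU mh mf mg f0 g0 a0 b0 H cf cg.
apply: (@squeeze_cvge _ _ _ _ (cst 0%E) _
  (fun k => a%:E * \int[mu]_(x in U) (f k x)%:E + b%:E * \int[mu]_(x in U) (g k x)%:E)%E).
- apply: nearW => k; apply/andP; split.
    by apply: nint_ge0 => x Ux; have /andP[] := H k x Ux.
  exact: (nint_lin_le mu mU (mh k) (mf k) (mg k) (f0 k) (g0 k) a0 b0 (H k)).
- exact: cvg_cst.
- rewrite -[X in _ --> X](_ : (a%:E * 0 + b%:E * 0)%E = 0%E); last by rewrite !mule0 adde0.
  by apply: cvgeD; [rewrite !mule0|exact: cvgeZl|exact: cvgeZl].
Qed.

Lemma norm_powR_cvg0 p (f : nat -> R) (l : R) : 0 < p ->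
  `|l - f k| `^ p @[k --> \oo] --> (0 : R) -> f k @[k --> \oo] --> l.
Proof.
move=> p0 H; apply/cvgrPdist_lt => /= e e0.
have ep : 0 < e `^ p by rewrite powR_gt0.
have : \forall k \near \oo, `|l - f k| `^ p < e `^ p by exact: (cvgr_lt _ H).
apply: filterS => k Hk.
rewrite ltNge; apply/negP => ek; move: Hk; rewrite ltNge => /negP; apply.
by rewrite ler_powR_base// ltW.
Qed.

Lemma cvg_norm_powR0 p (f : nat -> R) (l : R) : 0 < p ->
  f k @[k --> \oo] --> l -> `|l - f k| `^ p @[k --> \oo] --> (0 : R).
Proof.
move=> p0 H.
have c : {for (0 : R), continuous (fun t : R => `|t| `^ p)}.
  exact: continuous_norm_powR (ltW p0) _.
have z : (fun t : R => `|t| `^ p) 0 = 0 by rewrite normr0 powR0// gt_eqF.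
have H0 : l - f k @[k --> \oo] --> (0 : R).
  by rewrite -[X in _ --> X](subrr l); apply: cvgB => //; exact: cvg_cst.
rewrite -[X in _ --> X]z.
exact: (@cvg_comp _ _ _ (fun k => l - f k) (fun t : R => `|t| `^ p) _ _ _ H0 c).
Qed.

Lemma measurable_real_smooth U (F : R -> R) u : real_smooth F ->
  measurable_fun U u -> measurable_fun U (fun x => F (u x)).
Proof.
move=> sF; apply: measurableT_comp; apply: continuous_measurable_fun.
exact: real_smooth_continuous.
Qed.

(** * Convergence in L^p of products *)

Section limits.
Variables (p : R) (U : set 'rV[R]_n).
Hypotheses (p1 : 1 <= p) (mU : measurable U) (Ufin : (mu U < +oo)%E).

Let p0 : 0 < p. Proof. exact: lt_le_trans ltr01 p1. Qed.

Lemma nint_bounded_lty (f : 'rV[R]_n -> R) (C : R) : measurable_fun U f ->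
  (forall x, U x -> 0 <= f x <= C) -> (\int[mu]_(x in U) (f x)%:E < +oo)%E.
Proof.
move=> mf fC; have C0 : 0 <= `|C| by [].
apply: (@le_lt_trans _ _ (`|C|%:E * mu U)%E); last by rewrite lte_mul_pinfty.
rewrite -integral_cst//; apply: nint_le => //.
by move=> x /fC /andP[-> h]; rewrite (le_trans h)// ler_norm.
Qed.

Lemma Lp_cvg_bounded (alpha : nat -> 'rV[R]_n -> R) (beta : 'rV[R]_n -> R) (L : R) :
  (forall k, measurable_fun U (alpha k)) -> measurable_fun U beta ->
  (forall k x, U x -> `|alpha k x| <= L) -> (forall x, U x -> `|beta x| <= L) ->
  {ae mu, forall x, U x -> alpha k x @[k --> \oo] --> beta x} ->
  (\int[mu]_(x in U) (`|beta x - alpha k x| `^ p)%:E @[k --> \oo] --> 0)%E.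
Proof.
move=> ma mb aL bL ae.
apply: (nint_dominated mU (F := fun=> (L + L) `^ p)).
- by move=> k; apply: measurable_sub_norm_powR.
- exact: measurable_cst.
- move=> k x Ux; rewrite powR_ge0 ler_powR_base// ?(ltW p0)//.
  by rewrite (le_trans (ler_normB _ _))// lerD ?aL ?bL.
- by apply: (@nint_bounded_lty _ ((L + L) `^ p)) => [|x _]; [exact: measurable_cst|rewrite powR_ge0 lexx].
- apply: filterS ae => x H Ux; exact: (cvg_norm_powR0 p0 (H Ux)).
Qed.

(** Split the difference as (beta - alpha k) g + alpha k (g - h k). The first part tends to 0 by
    domination by (2 L)^p |g|^p, the second because alpha k is bounded by L. *)
Lemma Lp_cvg_scale (alpha : nat -> 'rV[R]_n -> R) (beta : 'rV[R]_n -> R) (L : R)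
    (h : nat -> 'rV[R]_n -> 'rV[R]_n) (g : 'rV[R]_n -> 'rV[R]_n) :
  (forall k, measurable_fun U (alpha k)) -> measurable_fun U beta ->
  (forall k x, U x -> `|alpha k x| <= L) -> (forall x, U x -> `|beta x| <= L) ->
  {ae mu, forall x, U x -> alpha k x @[k --> \oo] --> beta x} ->
  (forall k, measurable_fun U (h k)) -> measurable_fun U g ->
  (\int[mu]_(x in U) (enorm (g x) `^ p)%:E < +oo)%E ->
  (\int[mu]_(x in U) (enorm (g x - h k x) `^ p)%:E @[k --> \oo] --> 0)%E ->
  (\int[mu]_(x in U) (enorm (beta x *: g x - alpha k x *: h k x) `^ p)%:E @[k --> \oo] --> 0)%E.
Proof.
move=> ma mb aL bL ae mh mg gfin cg.
pose c := (2 : R) `^ (p - 1).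
have mgp : measurable_fun U (fun x => enorm (g x) `^ p) by exact: measurable_enorm_powR.
have mbap k : measurable_fun U (fun x => `|beta x - alpha k x| `^ p) by exact: measurable_sub_norm_powR.
apply: (nint_cvg0_le (a := c) (b := c * L `^ p) mU
  (f := fun k x => `|beta x - alpha k x| `^ p * enorm (g x) `^ p) _ _ _ _ _ _ _ _ _ cg).
- by move=> k; apply: measurable_sub_enorm_powR => //; exact: measurable_rVZ.
- by move=> k; exact: measurable_funM.
- by move=> k; exact: measurable_sub_enorm_powR.
- by move=> k x _; rewrite mulr_ge0 ?powR_ge0.
- by move=> k x _; exact: powR_ge0.
- exact: powR_ge0.
- by rewrite mulr_ge0 ?powR_ge0.
- move=> k x Ux; rewrite powR_ge0/=.
  have L0 : 0 <= L by apply: le_trans (bL x Ux).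
  rewrite -powRM ?enorm_ge0// -mulrA -powRM ?enorm_ge0//.
  rewrite -mulrDr; apply: le_trans (powRD_le p1 _ _); last 2 first.
  + by rewrite mulr_ge0 ?enorm_ge0.
  + by rewrite mulr_ge0 ?enorm_ge0.
  rewrite ler_powR_base ?enorm_ge0 ?(ltW p0)//.
  have -> : beta x *: g x - alpha k x *: h k x =
      (beta x - alpha k x) *: g x + alpha k x *: (g x - h k x).
    by rewrite scalerBl scalerBr addrA subrK.
  rewrite (le_trans (ler_enormD _ _))// !enormZ lerD// ler_wpM2r ?enorm_ge0//.
  exact: aL.
- apply: (nint_dominated mU (F := fun x => (L + L) `^ p * enorm (g x) `^ p)).
  + by move=> k; exact: measurable_funM.
  + by apply: measurable_funM => //; exact: measurable_cst.
  + move=> k x Ux; rewrite mulr_ge0 ?powR_ge0//= ler_wpM2r ?powR_ge0//.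
    rewrite ler_powR_base ?(ltW p0)//.
    by rewrite (le_trans (ler_normB _ _))// lerD ?aL ?bL.
  + rewrite nintZ ?powR_ge0//; last by move=> x _; exact: powR_ge0.
    rewrite lte_mul_pinfty// ?lee_fin ?powR_ge0//.
  + apply: filterS ae => x H Ux; rewrite -[X in _ --> X](mul0r (enorm (g x) `^ p)).
    by apply: cvgM; [exact: (cvg_norm_powR0 p0 (H Ux))|exact: cvg_cst].
Qed.

Lemma Lp_cvg_scale_cst (alpha : nat -> 'rV[R]_n -> R) (beta : 'rV[R]_n -> R) (L : R)
    (g : 'rV[R]_n -> 'rV[R]_n) :
  (forall k, measurable_fun U (alpha k)) -> measurable_fun U beta ->
  (forall k x, U x -> `|alpha k x| <= L) -> (forall x, U x -> `|beta x| <= L) ->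
  {ae mu, forall x, U x -> alpha k x @[k --> \oo] --> beta x} ->
  measurable_fun U g -> (\int[mu]_(x in U) (enorm (g x) `^ p)%:E < +oo)%E ->
  (\int[mu]_(x in U) (enorm (beta x *: g x - alpha k x *: g x) `^ p)%:E @[k --> \oo] --> 0)%E.
Proof.
move=> ma mb aL bL ae mg gfin.
apply: (@Lp_cvg_scale alpha beta L (fun=> g) g ma mb aL bL ae (fun=> mg) mg gfin).
rewrite (_ : (fun k => _) = cst 0%E); first exact: cvg_cst.
apply/funext => k; under eq_integral do rewrite subrr enorm0 powR0 ?gt_eqF//.
by rewrite integral0.
Qed.

Lemma Lp_cvgD (h1 h2 : nat -> 'rV[R]_n -> 'rV[R]_n) (g1 g2 : 'rV[R]_n -> 'rV[R]_n) :
  (forall k, measurable_fun U (h1 k)) -> (forall k, measurable_fun U (h2 k)) ->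
  measurable_fun U g1 -> measurable_fun U g2 ->
  (\int[mu]_(x in U) (enorm (g1 x - h1 k x) `^ p)%:E @[k --> \oo] --> 0)%E ->
  (\int[mu]_(x in U) (enorm (g2 x - h2 k x) `^ p)%:E @[k --> \oo] --> 0)%E ->
  (\int[mu]_(x in U) (enorm ((g1 x + g2 x) - (h1 k x + h2 k x)) `^ p)%:E @[k --> \oo] --> 0)%E.
Proof.
move=> mh1 mh2 mg1 mg2 c1 c2; pose c := (2 : R) `^ (p - 1).
apply: (nint_cvg0_le (a := c) (b := c) mU _ _ _ _ _ _ _ _ c1 c2).
- by move=> k; apply: measurable_sub_enorm_powR => //; exact: measurable_rVD.
- by move=> k; exact: measurable_sub_enorm_powR.
- by move=> k; exact: measurable_sub_enorm_powR.
- by move=> k x _; exact: powR_ge0.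
- by move=> k x _; exact: powR_ge0.
- exact: powR_ge0.
- exact: powR_ge0.
- move=> k x Ux; rewrite powR_ge0/= -mulrDr.
  apply: le_trans (powRD_le p1 (enorm_ge0 _) (enorm_ge0 _)).
  rewrite ler_powR_base ?enorm_ge0 ?(ltW p0)//.
  by rewrite opprD addrACA ler_enormD.
Qed.

End limits.

(** Approximations with errors 2^-(k+1) also converge almost everywhere, which is what passing to
    the limit in F (chi k) requires. *)
Lemma W1p0_fast p U u g : 1 <= p -> measurable U -> W1p0 p U u g ->
  exists chi : nat -> 'rV[R]_n -> R, [/\ forall k, test_function U (chi k),
    (\int[mu]_(x in U) (`|u x - chi k x| `^ p)%:E @[k --> \oo] --> 0)%E,
    (\int[mu]_(x in U) (enorm (g x - grad (chi k) x) `^ p)%:E @[k --> \oo] --> 0)%E &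
    {ae mu, forall x, U x -> chi k x @[k --> \oo] --> u x}].
Proof.
move=> p1 mU [[mu_ mg _ _ _] _ ap].
have p0 : 0 < p by exact: lt_le_trans ltr01 p1.
pose e k : R := 1 / (2 ^ k.+1)%:R.
have e0 k : 0 < e k by rewrite divr_gt0// ltr0n expn_gt0.
have [chi Hchi] := approximable_seq e0 ap.
have ce : ((e k)%:E @[k --> \oo] --> 0)%E.
  apply/fine_cvgP; split; first by near=> k.
  rewrite (_ : fine \o _ = fun k => 2^-1 * (2^-1) ^+ k).
    rewrite -[X in _ --> X](mulr0 2^-1); apply: cvgMl_tmp.
    by apply: cvg_expr; rewrite ger0_norm ?invr_ge0//; lra.
  by apply/funext => k; rewrite /= /e natrX exprS div1r invfM exprVn.
have sq (I : nat -> \bar R) : (forall k, (0 <= I k <= (e k)%:E)%E) ->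
    (I k @[k --> \oo] --> 0)%E.
  by move=> HI; apply: (squeeze_cvge _ (cvg_cst 0%E) ce); apply: nearW.
exists chi; split.
- by move=> k; have [] := Hchi k.
- apply: sq => k; have [_ h _] := Hchi k; rewrite h andbT.
  by apply: nint_ge0 => x _; exact: powR_ge0.
- apply: sq => k; have [_ _ h] := Hchi k; rewrite h andbT.
  by apply: nint_ge0 => x _; exact: powR_ge0.
have : {ae mu, forall x, U x -> `|u x - chi k x| `^ p @[k --> \oo] --> (0 : R)}.
  apply: nint_fast_ae => //.
  - move=> k; apply: measurable_sub_norm_powR => //.
    by have [tk _ _] := Hchi k; exact: measurable_test tk.
  - by move=> k; have [_ h _] := Hchi k.
by apply: filterS => x H /H; exact: norm_powR_cvg0.
Unshelve. all: by end_near. Qed.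

Lemma grad_mul_comp (F : R -> R) (theta chi : 'rV[R]_n -> R) x :
  real_smooth F -> smooth theta -> smooth chi ->
  grad (fun x => theta x * F (chi x)) x =
  (theta x * 'D_1 F (chi x)) *: grad chi x + F (chi x) *: grad theta x.
Proof.
move=> sF st sc; apply/rowP => i; rewrite !mxE.
have sFc : smooth (fun x => F (chi x)) by exact: smooth_comp.
by rewrite partialM// partial_comp// mulrA.
Qed.

Lemma nintS U Omega (f : 'rV[R]_n -> R) : measurable U -> measurable Omega ->
  U `<=` Omega -> measurable_fun Omega f -> (forall x, 0 <= f x) ->
  (\int[mu]_(x in U) (f x)%:E <= \int[mu]_(x in Omega) (f x)%:E)%E.
Proof.
move=> mU mO UO mf f0; apply: ge0_subset_integral => //; first exact/measurable_EFinP.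
by move=> x _; rewrite lee_fin.
Qed.

Lemma nintS_cvg0 U Omega (f : nat -> 'rV[R]_n -> R) : measurable U -> measurable Omega ->
  U `<=` Omega -> (forall k, measurable_fun Omega (f k)) -> (forall k x, 0 <= f k x) ->
  (\int[mu]_(x in Omega) (f k x)%:E @[k --> \oo] --> 0)%E ->
  (\int[mu]_(x in U) (f k x)%:E @[k --> \oo] --> 0)%E.
Proof.
move=> mU mO UO mf f0 cf; apply: (squeeze_cvge _ (cvg_cst 0%E) cf).
by apply: nearW => k; rewrite nint_ge0 ?nintS.
Qed.

Section chain_rule.
Variables (p : R) (Omega U : set 'rV[R]_n).
Hypotheses (p1 : 1 <= p) (mO : measurable Omega) (Ofin : (mu Omega < +oo)%E).
Hypotheses (mU : measurable U) (UO : U `<=` Omega).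

Let p0 : 0 < p. Proof. exact: lt_le_trans ltr01 p1. Qed.

Let Ufin : (mu U < +oo)%E.
Proof. by apply: le_lt_trans Ofin; apply: le_measure => //; rewrite inE. Qed.

(** With chi k test functions of Omega tending to u, theta * F (chi k) is a test function of the
    smaller set U, because theta has compact support there; this holds whatever the value of F at 0.
    Boundedness of F and of its derivative gives the limits in L^p. *)
Lemma W1p0_mul_comp u g (F : R -> R) (theta : 'rV[R]_n -> R) (L : R) :
  W1p0 p Omega u g -> real_smooth F -> (forall t, `|F t| <= L) ->
  (forall t, `|'D_1 F t| <= L) -> test_function U theta ->
  W1p0 p U (fun x => theta x * F (u x))
    (fun x => (theta x * 'D_1 F (u x)) *: g x + F (u x) *: grad theta x).
Proof.
move=> W sF FL DFL tt; have [st _ _] := tt.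
have L0 : 0 <= L by exact: le_trans (FL 0).
have [C C0 HC] := test_bounded tt.
have [chi [tchi c1 c2 ae]] := W1p0_fast p1 mO W.
have [[mu_ mg _ ufin gfin] _ _] := W.
have schi k : smooth (chi k) by have [] := tchi k.
have muU : measurable_fun U u by exact: measurable_funS mu_.
have mgU : measurable_fun U g by exact: measurable_funS mg.
have mt := measurable_test (D := U) tt; have mgt := measurable_test_grad mU tt.
have mchi k := measurable_test (D := U) (tchi k).
have mgchi k := measurable_test_grad mU (tchi k).
have mFu := measurable_real_smooth sF muU.
have mFchi k := measurable_real_smooth sF (mchi k).
have mDFu := measurable_real_smooth (real_smoothS sF) muU.
have mDFchi k := measurable_real_smooth (real_smoothS sF) (mchi k).
have cF (G : R -> R) : continuous G ->
    {ae mu, forall x, U x -> G (chi k x) @[k --> \oo] --> G (u x)}.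
  move=> cG; apply: filterS ae => x H /UO /H Hx.
  exact: (@cvg_comp _ _ _ (fun k => chi k x) G _ _ _ Hx (cG _)).
have cM (G : R -> R) : continuous G ->
    {ae mu, forall x, U x -> theta x * G (chi k x) @[k --> \oo] --> theta x * G (u x)}.
  by move=> /cF; apply: filterS => x H /H Hx; apply: cvgM => //; exact: cvg_cst.
have contF := real_smooth_continuous sF.
have contDF := real_smooth_continuous (real_smoothS sF).
apply: (W1p0_lim p1 mU Ufin (v := fun k x => theta x * F (chi k x))
   (h := fun k x => (theta x * 'D_1 F (chi k x)) *: grad (chi k) x + F (chi k x) *: grad theta x)).
- move=> k; have tk : test_function U (fun x => theta x * F (chi k x)).
    by apply: test_functionM => //; exact: smooth_comp.
  have := test_W1p0 p1 mU Ufin tk.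
  by congr W1p0; apply/funext => x; rewrite grad_mul_comp.
- by move=> x /(test_eq0 tt) ->; rewrite mul0r.
- exact: measurable_funM.
- apply: measurable_rVD => //; apply: measurable_rVZ => //; exact: measurable_funM.
- apply: (Lp_cvg_bounded p1 mU Ufin (L := C * L)).
  + by move=> k; exact: measurable_funM.
  + exact: measurable_funM.
  + by move=> k x _; rewrite normrM ler_pM.
  + by move=> x _; rewrite normrM ler_pM.
  + exact: (cM _ contF).
- apply: (Lp_cvgD p1 mU).
  + by move=> k; apply: measurable_rVZ => //; exact: measurable_funM.
  + by move=> k; exact: measurable_rVZ.
  + by apply: measurable_rVZ => //; exact: measurable_funM.
  + exact: measurable_rVZ.
  + apply: (Lp_cvg_scale p1 mU (L := C * L)).
    * by move=> k; exact: measurable_funM.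
    * exact: measurable_funM.
    * by move=> k x _; rewrite normrM ler_pM.
    * by move=> x _; rewrite normrM ler_pM.
    * exact: (cM _ contDF).
    * exact: mgchi.
    * exact: mgU.
    * apply: le_lt_trans gfin; apply: nintS => //; first exact: measurable_enorm_powR.
      by move=> x; exact: powR_ge0.
    * apply: nintS_cvg0 c2 => //.
        move=> k; apply: measurable_sub_enorm_powR => //; exact: measurable_test_grad (tchi k).
      by move=> k x; exact: powR_ge0.
  + apply: (@Lp_cvg_scale_cst p U p1 mU (fun k x => F (chi k x)) (fun x => F (u x)) L
      (grad theta)).
    * exact: mFchi.
    * exact: mFu.
    * by move=> k x _; exact: FL.
    * by move=> x _; exact: FL.
    * exact: (cF _ contF).
    * exact: mgt.
    * by have [_] := test_integrable (ltW p0) mU Ufin tt.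
Qed.

End chain_rule.

End sobolev_chain_rule.

(** * Truncations *)

Section truncations.
Context {R : realType}.
Implicit Types (t a b e p : R).

#[local] Opaque smooth_step.

Let step_norm_le1 (u : R) : `|smooth_step u| <= 1.
Proof. by rewrite ger0_norm ?smooth_step_ge0 ?smooth_step_le1. Qed.

(* A smooth bounded function agreeing with the positive part between 2/a and 1/b. *)
Definition truncation a b t : R := t * smooth_step (a * t - 1) * smooth_step (2 - b * t).

Let step_affine a b : real_smooth (fun t => smooth_step (a * t + b)).
Proof. by apply: (@real_smooth_comp _ smooth_step); [exact: real_smooth_step|exact: real_smooth_affine]. Qed.

Let truncationE a b : truncation a b =
  fun t => t * smooth_step (a * t + (- 1)) * smooth_step (- b * t + 2).
Proof. by apply/funext => t; rewrite /truncation mulNr [_ + 2]addrC. Qed.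

Lemma real_smooth_truncation a b : real_smooth (truncation a b).
Proof.
rewrite truncationE; apply: real_smoothM; last exact: step_affine.
apply: real_smoothM; [exact: real_smooth_id|exact: step_affine].
Qed.

Let is_derive_step a b t : is_derive t 1 (fun t => smooth_step (a * t + b))
  (a * 'D_1 smooth_step (a * t + b)).
Proof.
rewrite mulrC; apply: (@is_derive_comp_dir R R smooth_step (fun t => a * t + b)).
  by apply: derivableP; apply: real_smooth_derivable; exact: real_smooth_step.
have h1 : is_derive t 1 (fun t => a * t) a.
  have := @is_deriveZ _ _ _ id a t 1 1 (is_derive_id _ _).
  by move/is_derive_eq; apply; rewrite /GRing.scale/= mulr1.
have := is_deriveD h1 (is_derive_cst b t 1).
by move/is_derive_eq; apply; rewrite addr0.
Qed.

Lemma derive_truncation a b t : 'D_1 (truncation a b) t =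
  smooth_step (a * t - 1) * smooth_step (2 - b * t)
  + a * t * 'D_1 smooth_step (a * t - 1) * smooth_step (2 - b * t)
  - b * t * smooth_step (a * t - 1) * 'D_1 smooth_step (2 - b * t).
Proof.
have h1 := is_deriveM (is_derive_id t 1) (is_derive_step a (- 1) t).
have h2 := is_deriveM h1 (is_derive_step (- b) 2 t).
rewrite truncationE (_ : 2 - b * t = - b * t + 2); last by ring.
case: h2 => _ h2; apply: (etrans h2); rewrite /GRing.scale/=.
rewrite (_ : (id * _) t = t * smooth_step (a * t - 1))//.
move: (smooth_step (a * t - 1)) (smooth_step (- b * t + 2)) => A B.
by move: ('D_1 _ (a * t - 1)) ('D_1 _ (- b * t + 2)) => A' B'; ring.
Qed.

Lemma truncation_le a b t : `|truncation a b t| <= `|t|.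
Proof.
have H (x y z : R) : `|y| <= 1 -> `|z| <= 1 -> `|x * y * z| <= `|x|.
  by move=> y1 z1; rewrite !normrM -mulrA ler_piMr// mulr_ile1.
by apply: H; exact: step_norm_le1.
Qed.

Lemma truncation_le0 a b t : 0 < a -> t <= a^-1 -> truncation a b t = 0.
Proof.
move=> a0 t0; rewrite /truncation (@smooth_step_le0 _ (a * t - 1)) ?mulr0 ?mul0r//.
by rewrite subr_le0 mulrC -ler_pdivlMr// mul1r.
Qed.

Lemma truncation_bounded a b t : 0 < a -> 0 < b -> `|truncation a b t| <= 2 / b.
Proof.
move=> a0 b0; have [ta|at_] := leP t a^-1.
  by rewrite truncation_le0// normr0 divr_ge0// ltW.
have t0 : 0 < t by apply: lt_trans at_; rewrite invr_gt0.
have [tb|bt] := leP t (2 / b).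
  by rewrite (le_trans (truncation_le _ _ _))// gtr0_norm.
rewrite /truncation (@smooth_step_le0 _ (2 - b * t)) ?mulr0 ?normr0 ?divr_ge0 ?(ltW b0)//.
by rewrite subr_le0 mulrC -ler_pdivrMr// ltW.
Qed.

(** Uniformity in a and b holds because the derivative of the step vanishes unless its argument lies
    in [0, 1]; there a t, respectively b t, lies in [1, 2]. The limit in [W1p0_pos_part] relies on
    this uniformity. *)
Lemma derive_truncation_bounded : exists2 C : R, 0 < C &
  forall a b t, 0 < a -> 0 < b -> `|'D_1 (truncation a b) t| <= C.
Proof.
have [C C0 HC] := @derive_smooth_step_bounded R.
exists (1 + 2 * C + 2 * C); first by rewrite !addr_gt0// mulr_gt0.
move=> a b t a0 b0; rewrite derive_truncation.
have sd u v : 0 <= v -> v <= 2 -> `|v * 'D_1 smooth_step u| <= 2 * C :> R.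
  by move=> v0 v2; rewrite normrM ler_pM// ger0_norm.
rewrite (le_trans (ler_normB _ _))// lerD//.
  rewrite (le_trans (ler_normD _ _))// lerD//; first by rewrite normrM mulr_ile1.
  rewrite normrM -[leRHS]mulr1 ler_pM//.
  have [u0|u0] := ltP (a * t - 1) 0.
    by rewrite derive_smooth_step_lt0// mulr0 normr0 mulr_ge0// ltW.
  have [u1|u1] := ltP 1 (a * t - 1).
    by rewrite derive_smooth_step_gt1// mulr0 normr0 mulr_ge0// ltW.
  by apply: sd; lra.
rewrite [X in `|X|](_ : _ = smooth_step (a * t - 1) * (b * t * 'D_1 smooth_step (2 - b * t))); last by ring.
rewrite normrM -[leRHS]mul1r ler_pM//.
have [u0|u0] := ltP (2 - b * t) 0.
  by rewrite derive_smooth_step_lt0// mulr0 normr0 mulr_ge0// ltW.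
have [u1|u1] := ltP 1 (2 - b * t).
  by rewrite derive_smooth_step_gt1// mulr0 normr0 mulr_ge0// ltW.
by apply: sd; lra.
Qed.

Lemma truncation_id a b t : 2 < a * t -> b * t < 1 -> truncation a b t = t.
Proof.
by move=> h1 h2; rewrite /truncation !smooth_step_ge1 ?mulr1//; lra.
Qed.

Lemma derive_truncation_id a b t : 2 < a * t -> b * t < 1 ->
  'D_1 (truncation a b) t = 1.
Proof.
move=> h1 h2; rewrite derive_truncation !smooth_step_ge1 ?mulr1; [|lra|lra].
by rewrite !derive_smooth_step_gt1 ?mulr0 ?addr0 ?subr0//; lra.
Qed.

Lemma near_truncation_id t : 0 < t ->
  \forall k \near \oo, 2 < k.+1%:R * t /\ k.+1%:R^-1 * t < 1.
Proof.
move=> t0; have h := fun e : R => fun e0 : 0 < e => near_infty_natSinv_lt (PosNum e0).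
have t20 : 0 < t / 2 by rewrite divr_gt0.
have ti0 : 0 < t^-1 by rewrite invr_gt0.
have H1 := h _ t20; have H2 := h _ ti0.
near=> k; split.
  have : k.+1%:R^-1 < t / 2 by near: k.
  rewrite invf_plt ?posrE// ?ltr0n// invfM invrK => H.
  by rewrite -ltr_pdivrMr// mulrC.
have : k.+1%:R^-1 < t^-1 by near: k.
by rewrite -ltr_pdivlMr// mul1r.
Unshelve. all: by end_near. Qed.

(* A smooth extension of t + e from t >= 0 that stays away from 0, so that its
   negative powers are smooth and bounded. *)
Definition positive_shift e t : R := e / 2 + (t + e / 2) * smooth_step (4 / e * t + 2).

Lemma real_smooth_positive_shift e : real_smooth (positive_shift e).
Proof.
apply: real_smoothD; first exact: real_smooth_cst.
apply: real_smoothM; last exact: step_affine.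
by apply: real_smoothD; [exact: real_smooth_id|exact: real_smooth_cst].
Qed.

Lemma positive_shiftE e t : 0 < e -> - (e / 4) <= t -> positive_shift e t = t + e.
Proof.
move=> e0 te; rewrite /positive_shift smooth_step_ge1; first by rewrite mulr1; lra.
have : -1 <= 4 / e * t.
  by rewrite mulrAC ler_pdivlMr// mulN1r; lra.
by lra.
Qed.

Lemma positive_shift_ge e t : 0 < e -> e / 2 <= positive_shift e t.
Proof.
move=> e0; rewrite /positive_shift lerDl.
have [h|h] := leP 0 (t + e / 2); first by rewrite mulr_ge0 ?smooth_step_ge0.
rewrite smooth_step_le0 ?mulr0//.
have : 4 / e * t <= - 2 by rewrite mulrAC ler_pdivrMr//; lra.
by lra.
Qed.

Lemma positive_shift_gt0 e t : 0 < e -> 0 < positive_shift e t.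
Proof. by move=> e0; apply: lt_le_trans (positive_shift_ge t e0); rewrite divr_gt0. Qed.

(** The weight of Picone's test function, equal to (t + e)^(1-p) for t >= 0. It stays smooth and
    bounded on the whole line because the eigenfunction may be negative elsewhere. *)
Definition inverse_shift p e t : R := positive_shift e t `^ (1 - p).

Lemma real_smooth_inverse_shift p e : 0 < e -> real_smooth (inverse_shift p e).
Proof.
move=> e0; apply: real_smooth_powR; last exact: real_smooth_positive_shift.
by move=> x; exact: positive_shift_gt0.
Qed.

Lemma inverse_shiftE p e t : 0 < e -> 0 <= t -> inverse_shift p e t = (t + e) `^ (1 - p).
Proof.
move=> e0 t0; rewrite /inverse_shift positive_shiftE//.
by rewrite (le_trans _ t0)// oppr_le0 divr_ge0// ltW.
Qed.

Lemma derive_positive_shift e t : 0 < e -> - (e / 4) < t ->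
  'D_1 (positive_shift e) t = 1.
Proof.
move=> e0 te; rewrite (@near_eq_derive R R R _ (fun t => t + e)).
  have := is_deriveD (is_derive_id t 1) (is_derive_cst e t 1).
  by case=> _ ->; rewrite addr0.
near=> s; rewrite positive_shiftE// ltW//; near: s; exact: lt_nbhsr.
Unshelve. all: by end_near. Qed.

Lemma derive_inverse_shift p e t : 0 < e -> 'D_1 (inverse_shift p e) t =
  (1 - p) * (positive_shift e t `^ (- p) * 'D_1 (positive_shift e) t).
Proof.
move=> e0; have d := is_derive_powR_comp (1 - p)
  (fun s => positive_shift_gt0 s e0) (@real_smooth_derivable R _ t (@real_smooth_positive_shift e)).
by case: d => _ ->; rewrite (_ : 1 - p - 1 = - p)//; ring.
Qed.

Lemma derive_inverse_shiftE p e t : 0 < e -> 0 <= t ->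
  'D_1 (inverse_shift p e) t = (1 - p) * (t + e) `^ (- p).
Proof.
move=> e0 t0; have te : - (e / 4) < t by rewrite (lt_le_trans _ t0)// oppr_lt0 divr_gt0.
by rewrite derive_inverse_shift// derive_positive_shift// mulr1 positive_shiftE// ltW.
Qed.

Lemma le_powR_antitone p a b : p <= 0 -> 0 < a -> a <= b -> b `^ p <= a `^ p.
Proof.
move=> p0 a0 ab; have b0 := lt_le_trans a0 ab.
rewrite -[p]opprK (powRN a (- p)) (powRN b (- p)) lef_pV2 ?posrE ?powR_gt0//.
by rewrite ler_powR_base ?oppr_ge0// (ltW a0).
Qed.

Lemma inverse_shift_bounded p e : 1 <= p -> 0 < e ->
  exists L : R, (forall t, `|inverse_shift p e t| <= L) /\
    (forall t, `|'D_1 (inverse_shift p e) t| <= L).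
Proof.
move=> p1 e0; have e20 : 0 < e / 2 by rewrite divr_gt0.
have [C C0 HC] := @derive_smooth_step_bounded R.
have HD t : `|'D_1 (positive_shift e) t| <= 1 + C.
  have h1 : is_derive t 1 (fun t => t + e / 2) 1.
    have := is_deriveD (is_derive_id t 1) (is_derive_cst (e / 2) t 1).
    by move/is_derive_eq; apply; rewrite addr0.
  have h2 := is_deriveM h1 (is_derive_step (4 / e) 2 t).
  have [_ h3] := is_deriveD (is_derive_cst (e / 2) t 1) h2.
  rewrite (h3 : 'D_1 (positive_shift e) t = _); set v := 4 / e * t + 2.
  (* Thus the derivative of the step enters as v times its value at v, which is zero unless 0 <= v
     <= 1; the bound does not depend on e. *)
  have vE : (t + e / 2) * (4 / e) = v by rewrite /v; field; rewrite gt_eqF.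
  rewrite add0r /GRing.scale/= mulrA vE mulr1 addrC.
  rewrite (le_trans (ler_normD _ _))// lerD//.
  have [u0|u0] := ltP v 0; first by rewrite derive_smooth_step_lt0// mulr0 normr0 ltW.
  have [u1|u1] := ltP 1 v; first by rewrite derive_smooth_step_gt1// mulr0 normr0 ltW.
  by rewrite normrM -[leRHS]mul1r ler_pM// ger0_norm.
have pm0 : 0 <= p - 1 by rewrite subr_ge0.
exists ((e / 2) `^ (1 - p) + (p - 1) * ((e / 2) `^ (- p) * (1 + C))); split=> t.
  rewrite ger0_norm ?powR_ge0// (le_trans (le_powR_antitone _ e20 (positive_shift_ge t e0)))//.
    by rewrite subr_le0.
  by rewrite lerDl mulr_ge0// mulr_ge0 ?powR_ge0// addr_ge0// ltW.
rewrite derive_inverse_shift// ler_wpDl ?powR_ge0//.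
rewrite normrM distrC (ger0_norm pm0) ler_wpM2l// normrM ler_pM//.
rewrite ger0_norm ?powR_ge0// le_powR_antitone ?positive_shift_ge//.
by rewrite oppr_le0 (le_trans _ p1).
Qed.

End truncations.

(** * Test functions built from the eigenfunction *)

Section positive_part.
Context {R : realType} {n : nat}.
Local Notation mu := (lebesgue_rV R n).
Variables (p : R) (Omega : set 'rV[R]_n) (phi : 'rV[R]_n -> R)
  (g : 'rV[R]_n -> 'rV[R]_n).
Hypotheses (p1 : 1 <= p) (oO : open Omega) (Ofin : (mu Omega < +oo)%E).
Hypothesis (W : W1p0 p Omega phi g).

Let mO : measurable Omega. Proof. exact: open_measurable_rV. Qed.

Let p0 : 0 < p. Proof. exact: lt_le_trans ltr01 p1. Qed.

Let phi0 x : ~ Omega x -> phi x = 0. Proof. by case: W => _ + _; apply. Qed.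

Definition pos_set : set 'rV[R]_n := [set x | Omega x /\ 0 < phi x].

Hypothesis (cphi : {in Omega, continuous phi}).

Lemma open_pos_set : open pos_set.
Proof.
rewrite openE => x [Ox px]; rewrite /interior.
have nO : nbhs x Omega by exact: open_nbhs_nbhs.
have cx : phi y @[y --> x] --> phi x by apply: cphi; rewrite inE.
have : \forall y \near x, 0 < phi y by exact: (cvgr_gt _ cx).
by apply: filterS2 nO => y Oy py; split.
Qed.

Let mP : measurable pos_set. Proof. apply: open_measurable_rV; exact: open_pos_set. Qed.

Let PO : pos_set `<=` Omega. Proof. by move=> x []. Qed.

Let Pfin : (mu pos_set < +oo)%E.
Proof. by apply: le_lt_trans Ofin; apply: le_measure => //; rewrite inE. Qed.

Lemma derive_eq0_left (F : R -> R) (e t : R) : (forall t, t <= e -> F t = 0) ->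
  t < e -> 'D_1 F t = 0.
Proof.
move=> F0 te; rewrite (@near_eq_derive R R R _ (cst 0)) ?derive_cst//.
near=> s; rewrite F0// ltW//; near: s; exact: lt_nbhsl.
Unshelve. all: by end_near. Qed.

Lemma smooth_unit_step (e : R) : 0 < e -> exists G : R -> R, exists C : R,
  [/\ real_smooth G, G 0 = 0, forall t, `|G t| <= 1, forall t, e <= t -> G t = 1 &
      (forall t, `|'D_1 G t| <= C) /\ forall t, e < t -> 'D_1 G t = 0].
Proof.
move=> e0.
pose G t : R := smooth_step (e^-1 * t + 0).
have sG : real_smooth G by apply: (@real_smooth_comp _ smooth_step); [exact: real_smooth_step|exact: real_smooth_affine].
have G0 : G 0 = 0 by rewrite /G smooth_step_le0// mulr0 addr0.
have Gn t : `|G t| <= 1 by rewrite ger0_norm ?smooth_step_ge0 ?smooth_step_le1.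
have G1 t : e <= t -> G t = 1.
  by move=> et; rewrite /G smooth_step_ge1// addr0 mulrC ler_pdivlMr// mul1r.
have [C C0 HC] := @derive_smooth_step_bounded R.
have dG t : 'D_1 G t = 'D_1 smooth_step (e^-1 * t + 0) * e^-1.
  have d1 : is_derive (e^-1 * t + 0) 1 smooth_step ('D_1 smooth_step (e^-1 * t + 0)).
    by apply: derivableP; apply: real_smooth_derivable; exact: real_smooth_step.
  have d2 : is_derive t 1 (fun t : R => e^-1 * t + 0) e^-1.
    have h1 := @is_deriveZ _ _ _ id e^-1 t 1 1 (is_derive_id _ _).
    have := is_deriveD h1 (is_derive_cst (0 : R) t 1).
    by move/is_derive_eq; apply; rewrite addr0 /GRing.scale/= mulr1.
  by have [_] := @is_derive_comp_dir R R smooth_step (fun t => e^-1 * t + 0) t 1 _ _ d1 d2.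
have DGL t : `|'D_1 G t| <= C / e.
  by rewrite dG normrM (ger0_norm (x := e^-1)) ?invr_ge0 ?(ltW e0)// ler_wpM2r// invr_ge0 ltW.
exists G, (C / e); split=> //; split=> // t et.
rewrite dG derive_smooth_step_gt1 ?mul0r//.
by rewrite addr0 mulrC ltr_pdivlMr// mul1r.
Qed.

(* The cut-off G(chi) makes the support of F(phi) compact inside the positive set. *)
Lemma W1p0_comp_cut (F G : R -> R) (e L : R) (chi : 'rV[R]_n -> R) : 0 < e ->
  real_smooth F -> (forall t, `|F t| <= L) -> (forall t, `|'D_1 F t| <= L) ->
  (forall t, t <= e -> F t = 0) -> real_smooth G -> G 0 = 0 ->
  test_function Omega chi ->
  W1p0 p pos_set (fun x => G (chi x) * F (phi x))
    (fun x => (G (chi x) * 'D_1 F (phi x)) *: g x +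
              F (phi x) *: grad (fun x => G (chi x)) x).
Proof.
move=> e0 sF FL DFL F0 sG G0 tchi; have [schi cchi sO] := tchi.
(* Intersecting with [supp chi], which lies in [Omega], keeps limit points where phi is continuous;
   hence K is closed, and compact in the positive set. *)
pose K := [set x | supp chi x /\ e <= phi x].
have clK : closed K.
  move=> x Kx; have sx : supp chi x.
    have : closure (supp chi) x by apply: closureS Kx => y [].
    by rewrite -(closure_id _).1//; exact: closed_closure.
  split=> //; rewrite leNgt; apply/negP => pe.
  have cx : phi y @[y --> x] --> phi x by apply: cphi; rewrite inE; exact: sO.
  have N : \forall y \near x, phi y < e by exact: (cvgr_lt _ cx).
  by have [y [[_ ye]]] := Kx _ N; rewrite /= ltNge ye.
have cK : compact K by apply: (subclosed_compact clK cchi) => x [].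
have KP : K `<=` pos_set.
  by move=> x [/sO Ox ex]; split=> //; exact: lt_le_trans ex.
have [eta [teta eta01 eta1]] := cutoff cK open_pos_set KP.
have sGchi : smooth (fun x => G (chi x)) by exact: smooth_comp.
have tt := test_functionM teta sGchi.
have := W1p0_mul_comp p1 mO Ofin mP PO W sF FL DFL tt.
have notK x : ~ supp chi x -> \near x, chi x = 0 by exact: suppN.
(* The auxiliary cut-off eta can be erased: it is 1 near K, while outside K either phi < e, where F
   (phi) and its derivative vanish, or chi vanishes in a neighbourhood and so does G (chi). *)
congr W1p0; apply/funext => x.
- have [->|Fx] := eqVneq (F (phi x)) 0; first by rewrite !mulr0.
  have ex : e <= phi x.
    by rewrite leNgt; apply/negP => /ltW /F0 /eqP; exact/negP.
  have [sx|/supp_eq0 ->] := pselect (supp chi x); last by rewrite G0 mulr0 mul0r.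
  have /nbhs_singleton -> : \near x, eta x = 1 by exact: eta1.
  by rewrite mul1r.
- congr (_ *: _ + _).
    have [->|Fx] := eqVneq ('D_1 F (phi x)) 0; first by rewrite !mulr0.
    have ex : e <= phi x.
      by rewrite leNgt; apply/negP => /(derive_eq0_left F0) /eqP; exact/negP.
    have [sx|/supp_eq0 ->] := pselect (supp chi x); last by rewrite G0 mulr0 mul0r.
    have /nbhs_singleton -> : \near x, eta x = 1 by exact: eta1.
    by rewrite mul1r.
  have [->|Fx] := eqVneq (F (phi x)) 0; first by rewrite !scale0r.
  have ex : e <= phi x.
    by rewrite leNgt; apply/negP => /ltW /F0 /eqP; exact/negP.
  congr (_ *: _); apply/rowP => i; rewrite !mxE; apply: near_eq_partial.
  have [sx|nsx] := pselect (supp chi x).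
    have := eta1 x (conj sx ex); apply: filterS => y ->; exact: mul1r.
  by have := notK x nsx; apply: filterS => y ->; rewrite G0 mulr0.
Qed.

(** Take G equal to 1 above e and let chi k tend to phi, so that G (chi k) F (phi) tends to G (phi)
    F (phi) = F (phi). The extra gradient term tends to F (phi) G' (phi) g = 0, as F vanishes up to
    e and G' vanishes above e. *)
Lemma W1p0_comp_pos (F : R -> R) (e L : R) : 0 < e ->
  real_smooth F -> (forall t, `|F t| <= L) -> (forall t, `|'D_1 F t| <= L) ->
  (forall t, t <= e -> F t = 0) ->
  W1p0 p pos_set (fun x => F (phi x)) (fun x => 'D_1 F (phi x) *: g x).
Proof.
move=> e0 sF FL DFL F0.
have L0 : 0 <= L by exact: le_trans (FL 0).
have [chi [tchi c1 c2 ae]] := W1p0_fast p1 mO W.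
have [[mu_ mg _ ufin gfin] _ _] := W.
have [G [C [sG G0 Gn G1 [DGL DG0]]]] := smooth_unit_step e0.
have FDG t : F t * 'D_1 G t = 0.
  have [te|et] := leP t e; first by rewrite F0// mul0r.
  by rewrite DG0// mulr0.
have FG t : G t * F t = F t.
  have [te|et] := leP t e; first by rewrite F0// mulr0.
  by rewrite G1 ?mul1r// ltW.
have DFG t : G t * 'D_1 F t = 'D_1 F t.
  have [te|et] := ltP t e; first by rewrite (derive_eq0_left F0 te) mulr0.
  by rewrite G1 ?mul1r.
have schi k : smooth (chi k) by have [] := tchi k.
have sDF := real_smoothS sF; have sDG := real_smoothS sG.
have mphi : measurable_fun pos_set phi by exact: measurable_funS mu_.
have mgU : measurable_fun pos_set g by exact: measurable_funS mg.
have gUfin : (\int[mu]_(x in pos_set) (enorm (g x) `^ p)%:E < +oo)%E.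
  apply: le_lt_trans gfin; apply: nintS => //; first exact: measurable_enorm_powR.
  by move=> x; exact: powR_ge0.
have mchi k := measurable_test (D := pos_set) (tchi k).
have mgchi k := measurable_test_grad mP (tchi k).
have mFphi := measurable_real_smooth sF mphi.
have mDFphi := measurable_real_smooth sDF mphi.
have mGchi k := measurable_real_smooth sG (mchi k).
have mDGchi k := measurable_real_smooth sDG (mchi k).
have mGphi := measurable_real_smooth sG mphi.
have mDGphi := measurable_real_smooth sDG mphi.
have cH (H : R -> R) (a : 'rV[R]_n -> R) : continuous H ->
    {ae mu, forall x, pos_set x -> a x * H (chi k x) @[k --> \oo] --> a x * H (phi x)}.
  move=> cH; apply: filterS ae => x Hx /PO /Hx {}Hx; apply: cvgM; first exact: cvg_cst.
  exact: (@cvg_comp _ _ _ (fun k => chi k x) H _ _ _ Hx (cH _)).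
have cG := real_smooth_continuous sG.
have cDG := real_smooth_continuous (real_smoothS sG).
have bd2 (a b c d : R) : `|a| <= c -> `|b| <= d -> `|a * b| <= c * d.
  by move=> ac bd; rewrite normrM ler_pM.
have gGchi k x : grad (fun x => G (chi k x)) x = 'D_1 G (chi k x) *: grad (chi k) x.
  by apply/rowP => i; rewrite !mxE partial_comp.
apply: (W1p0_lim p1 mP Pfin (v := fun k x => G (chi k x) * F (phi x))
  (h := fun k x => ('D_1 F (phi x) * G (chi k x)) *: g x +
     (F (phi x) * 'D_1 G (chi k x)) *: grad (chi k) x)).
- move=> k; have := W1p0_comp_cut e0 sF FL DFL F0 sG G0 (tchi k).
  by congr W1p0; apply/funext => x; rewrite gGchi scalerA mulrC.
- move=> x nx; apply: F0; rewrite leNgt; apply/negP => ex; apply: nx; split.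
    apply: contrapT => /phi0 p0'; move: ex; rewrite p0' ltNge => /negP; apply.
    exact: ltW.
  exact: lt_trans ex.
- exact: mFphi.
- exact: measurable_rVZ.
- rewrite (_ : (fun k => _) = fun k => (\int[mu]_(x in pos_set)
      (`|F (phi x) * G (phi x) - F (phi x) * G (chi k x)| `^ p)%:E)%E); last first.
    apply/funext => k; apply: eq_integral => x _.
    by rewrite (mulrC (F (phi x)) (G (phi x))) FG (mulrC (F (phi x))).
  apply: (@Lp_cvg_bounded _ _ p pos_set p1 mP Pfin (fun k x => F (phi x) * G (chi k x))
    (fun x => F (phi x) * G (phi x)) (L * 1)).
  + by move=> k; exact: (measurable_funM mFphi (mGchi k)).
  + exact: (measurable_funM mFphi mGphi).
  + by move=> k x _; exact: bd2.
  + by move=> x _; exact: bd2.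
  + exact: (cH G _ cG).
- rewrite (_ : (fun k => _) = fun k => (\int[mu]_(x in pos_set)
      (enorm ((('D_1 F (phi x) * G (phi x)) *: g x + (F (phi x) * 'D_1 G (phi x)) *: g x) -
        (('D_1 F (phi x) * G (chi k x)) *: g x +
         (F (phi x) * 'D_1 G (chi k x)) *: grad (chi k) x)) `^ p)%:E)%E); last first.
    apply/funext => k; apply: eq_integral => x _.
    by rewrite FDG scale0r addr0 (mulrC ('D_1 F (phi x)) (G (phi x))) DFG.
  apply: (@Lp_cvgD _ _ p pos_set p1 mP
    (fun k x => ('D_1 F (phi x) * G (chi k x)) *: g x)
    (fun k x => (F (phi x) * 'D_1 G (chi k x)) *: grad (chi k) x)
    (fun x => ('D_1 F (phi x) * G (phi x)) *: g x)
    (fun x => (F (phi x) * 'D_1 G (phi x)) *: g x)).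
  + by move=> k; exact: (measurable_rVZ mP (measurable_funM mDFphi (mGchi k)) mgU).
  + by move=> k; exact: (measurable_rVZ mP (measurable_funM mFphi (mDGchi k)) (mgchi k)).
  + exact: (measurable_rVZ mP (measurable_funM mDFphi mGphi) mgU).
  + exact: (measurable_rVZ mP (measurable_funM mFphi mDGphi) mgU).
  + apply: (@Lp_cvg_scale_cst _ _ p pos_set p1 mP (fun k x => 'D_1 F (phi x) * G (chi k x))
      (fun x => 'D_1 F (phi x) * G (phi x)) (L * 1) g).
    * by move=> k; exact: (measurable_funM mDFphi (mGchi k)).
    * exact: (measurable_funM mDFphi mGphi).
    * by move=> k x _; exact: bd2.
    * by move=> x _; exact: bd2.
    * exact: (cH G _ cG).
    * exact: mgU.
    * exact: gUfin.
  + apply: (@Lp_cvg_scale _ _ p pos_set p1 mP (fun k x => F (phi x) * 'D_1 G (chi k x))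
      (fun x => F (phi x) * 'D_1 G (phi x)) (L * C) (fun k => grad (chi k)) g).
    * by move=> k; exact: (measurable_funM mFphi (mDGchi k)).
    * exact: (measurable_funM mFphi mDGphi).
    * by move=> k x _; exact: bd2.
    * by move=> x _; exact: bd2.
    * exact: (cH _ _ cDG).
    * exact: mgchi.
    * exact: mgU.
    * exact: gUfin.
    * apply: nintS_cvg0 c2 => //.
        move=> k; apply: measurable_sub_enorm_powR => //; exact: measurable_test_grad (tchi k).
      by move=> k x; exact: powR_ge0.
Qed.

(** The truncation with a = k + 1 and b = 1/(k+1) vanishes up to 1/(k+1) and is the identity between
    2/(k+1) and k + 1. It is dominated by |t| and its derivative is bounded independently of k, so
    functions and gradients converge in L^p. *)
Lemma W1p0_pos_part : W1p0 p pos_set (fun x => Num.max (phi x) 0) g.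
Proof.
have [[mu_ mg _ ufin gfin] _ _] := W.
have mphi : measurable_fun pos_set phi by exact: measurable_funS mu_.
have mgU : measurable_fun pos_set g by exact: measurable_funS mg.
pose F k := @truncation R k.+1%:R k.+1%:R^-1.
have k0 k : (0 : R) < k.+1%:R by [].
have ki0 k : (0 : R) < k.+1%:R^-1 by rewrite invr_gt0.
have [C C0 HC] := @derive_truncation_bounded R.
have sF k : real_smooth (F k) by exact: real_smooth_truncation.
have mF k := measurable_real_smooth (sF k) mphi.
have mDF k := measurable_real_smooth (real_smoothS (sF k)) mphi.
have mmax : measurable_fun pos_set (fun x => Num.max (phi x) 0).
  by apply: measurable_maxr => //; exact: measurable_cst.
have maxE x : pos_set x -> Num.max (phi x) 0 = phi x.
  by move=> [_ px]; apply: max_idPl; exact: ltW.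
apply: (W1p0_lim p1 mP Pfin (v := fun k x => F k (phi x))
  (h := fun k x => 'D_1 (F k) (phi x) *: g x)).
- move=> k; apply: (@W1p0_comp_pos (F k) k.+1%:R^-1 (2 / k.+1%:R^-1 + C)) => //.
  + by move=> t; rewrite (le_trans (truncation_bounded t (k0 k) (ki0 k)))// lerDl ltW.
  + move=> t; rewrite (le_trans (HC _ _ _ (k0 k) (ki0 k)))// lerDr divr_ge0//.
  + by move=> t tk; exact: truncation_le0.
- move=> x nx; apply: max_idPr; rewrite leNgt; apply/negP => px; apply: nx; split=> //.
  by apply: contrapT => /phi0 p0'; move: px; rewrite p0' ltxx.
- exact: mmax.
- exact: mgU.
- apply: (nint_dominated mP (F := fun x => 2 `^ p * `|phi x| `^ p)).
  + by move=> k; exact: measurable_sub_norm_powR.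
  + by apply: measurable_funM; [exact: measurable_cst|exact: measurable_norm_powR].
  + move=> k x /maxE ->; rewrite powR_ge0/= -powRM// ler_powR_base ?(ltW p0)//.
    rewrite (le_trans (ler_normB _ _))// mulr_natl mulr2n lerD2l.
    exact: truncation_le.
  + rewrite nintZ ?powR_ge0//; last exact: measurable_norm_powR.
    apply: lte_mul_pinfty; [by rewrite lee_fin powR_ge0|by []|].
    apply: le_lt_trans ufin; apply: nintS => //; exact: measurable_norm_powR.
  + apply: aeW => x Px; apply: (@cvg_trans _ (cst (0 : R) @ \oo)); last exact: cvg_cst.
    apply: near_eq_cvg; have [_ px] := Px; have := near_truncation_id px.
    apply: filterS => k [h1 h2]; rewrite /F truncation_id// maxE// subrr normr0.
    by rewrite powR0// gt_eqF.
- rewrite (_ : (fun k => _) = fun k => (\int[mu]_(x in pos_set)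
      (enorm (1 *: g x - 'D_1 (F k) (phi x) *: g x) `^ p)%:E)%E); last first.
    by apply/funext => k; apply: eq_integral => x _; rewrite scale1r.
  apply: (@Lp_cvg_scale_cst _ _ p pos_set p1 mP (fun k x => 'D_1 (F k) (phi x)) (fun=> 1)
    (1 + C) g).
  + exact: mDF.
  + exact: measurable_cst.
  + by move=> k x _; rewrite (le_trans (HC _ _ _ (k0 k) (ki0 k)))// lerDr.
  + by move=> x _; rewrite normr1 lerDl ltW.
  + apply: aeW => x [_ px]; apply: (@cvg_trans _ (cst (1 : R) @ \oo)); last exact: cvg_cst.
    apply: near_eq_cvg; have := near_truncation_id px.
    by apply: filterS => k [h1 h2]; rewrite /F derive_truncation_id.
  + exact: mgU.
  + apply: le_lt_trans gfin; apply: nintS => //; first exact: measurable_enorm_powR.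
    by move=> x; exact: powR_ge0.
Qed.

End positive_part.

(** * Picone's test functions *)

Section power_test_functions.
Context {R : realType} {n : nat}.
Local Notation mu := (lebesgue_rV R n).

(** A smooth approximation of |t|^p as d tends to 0. Subtracting the constant makes it vanish at 0,
    so that composing it with a test function gives a test function. *)
Definition smooth_pow (p d t : R) : R := (t * t + d) `^ (p / 2) - d `^ (p / 2).

Let sq_shift_gt0 (d t : R) : 0 < d -> 0 < t * t + d.
Proof. by move=> d0; rewrite ltr_wpDl// -expr2 sqr_ge0. Qed.

Let real_smooth_sq_shift (d : R) : real_smooth (fun t : R => t * t + d).
Proof.
apply: real_smoothD; last exact: real_smooth_cst.
by apply: real_smoothM; exact: real_smooth_id.
Qed.

Lemma real_smooth_pow (p d : R) : 0 < d -> real_smooth (smooth_pow p d).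
Proof.
move=> d0; apply: real_smoothD; last exact: real_smooth_cst.
by apply: real_smooth_powR => // t; exact: sq_shift_gt0.
Qed.

Lemma smooth_pow0 (p d : R) : smooth_pow p d 0 = 0.
Proof. by rewrite /smooth_pow mul0r add0r subrr. Qed.

Lemma derive_smooth_pow (p d t : R) : 0 < d ->
  'D_1 (smooth_pow p d) t = p * ((t * t + d) `^ (p / 2 - 1) * t).
Proof.
move=> d0.
have dsq : is_derive t 1 (fun t : R => t * t + d) (t + t).
  have := is_deriveD (is_deriveM (is_derive_id t 1) (is_derive_id t 1)) (is_derive_cst d t 1).
  by move/is_derive_eq; apply; rewrite addr0 /GRing.scale/= mulr1.
have h := is_derive_powR_comp (p / 2) (fun t => sq_shift_gt0 t d0) (@ex_derive _ _ _ _ _ _ _ dsq).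
have [_ h2] := is_deriveD h (is_derive_cst (- d `^ (p / 2)) t 1).
rewrite (h2 : 'D_1 (smooth_pow p d) t = _) addr0.
by have [_ ->] := dsq; field.
Qed.

Lemma sq_powR (p t : R) : (t * t) `^ (p / 2) = `|t| `^ p.
Proof.
have -> : t * t = `|t| `^ 2%:R by rewrite powR_mulrn// real_normK ?num_real// expr2.
by rewrite -powRrM (_ : 2%:R * (p / 2) = p)//; field.
Qed.

Lemma smooth_pow_cvg (p t : R) : 0 < p ->
  smooth_pow p k.+1%:R^-1 t @[k --> \oo] --> `|t| `^ p.
Proof.
move=> p0; have p20 : 0 <= p / 2 by rewrite divr_ge0// ltW.
have cp := continuous_norm_powR p20.
have h0 : (k.+1%:R^-1 : R) @[k --> \oo] --> (0 : R) by exact: cvg_harmonic.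
have h1 : t * t + k.+1%:R^-1 @[k --> \oo] --> t * t.
  by rewrite -[X in _ --> X]addr0; apply: cvgD => //; exact: cvg_cst.
have E : (fun k => smooth_pow p k.+1%:R^-1 t) =
    fun k => `|t * t + k.+1%:R^-1| `^ (p / 2) - `|k.+1%:R^-1| `^ (p / 2).
  apply/funext => k; rewrite /smooth_pow !ger0_norm//.
  by rewrite addr_ge0// -expr2 sqr_ge0.
rewrite E -[X in _ --> X]subr0; apply: cvgB.
  rewrite -sq_powR -{2}(ger0_norm (x := t * t)); last by rewrite -expr2 sqr_ge0.
  exact: (@cvg_comp _ _ _ _ (fun t : R => `|t| `^ (p / 2)) _ _ _ h1 (cp _)).
have := @cvg_comp _ _ _ _ (fun t : R => `|t| `^ (p / 2)) _ _ _ h0 (cp _).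
by rewrite normr0 powR0// gt_eqF// divr_gt0.
Qed.

Lemma derive_smooth_pow_cvg (p t : R) : 2 <= p ->
  'D_1 (smooth_pow p k.+1%:R^-1) t @[k --> \oo] --> p * signed_pow p t.
Proof.
move=> p2; have p20 : 0 <= p / 2 - 1 by rewrite subr_ge0 ler_pdivlMr// mul1r.
have cp := continuous_norm_powR p20.
have h0 : (k.+1%:R^-1 : R) @[k --> \oo] --> (0 : R) by exact: cvg_harmonic.
have h1 : t * t + k.+1%:R^-1 @[k --> \oo] --> t * t.
  by rewrite -[X in _ --> X]addr0; apply: cvgD => //; exact: cvg_cst.
have E : (fun k => 'D_1 (smooth_pow p k.+1%:R^-1) t) =
    fun k => p * (`|t * t + k.+1%:R^-1| `^ (p / 2 - 1) * t).
  apply/funext => k; rewrite derive_smooth_pow ?invr_gt0// ger0_norm//.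
  by rewrite addr_ge0// -expr2 sqr_ge0.
rewrite E; apply: cvgM; first exact: cvg_cst.
apply: cvgM; last exact: cvg_cst.
rewrite -(sq_powR (p - 2) t) (_ : (p - 2) / 2 = p / 2 - 1); last by field.
rewrite -{2}(ger0_norm (x := t * t)); last by rewrite -expr2 sqr_ge0.
exact: (@cvg_comp _ _ _ _ (fun t : R => `|t| `^ (p / 2 - 1)) _ _ _ h1 (cp _)).
Qed.

Lemma smooth_pow_bounded (p C : R) : 2 <= p -> 0 <= C -> exists L : R,
  forall k t, `|t| <= C -> `|smooth_pow p k.+1%:R^-1 t| <= L /\
    `|'D_1 (smooth_pow p k.+1%:R^-1) t| <= L.
Proof.
move=> p2 C0.
have p0 : 0 < p by exact: lt_le_trans p2.
have p20 : 0 <= p / 2 by rewrite divr_ge0// ltW.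
have p21 : 0 <= p / 2 - 1 by rewrite subr_ge0 ler_pdivlMr// mul1r.
set A := (C * C + 1) `^ (p / 2); set B := (C * C + 1) `^ (p / 2 - 1).
have A0 : 0 <= A by exact: powR_ge0.
have B0 : 0 <= B by exact: powR_ge0.
exists (A + 1 + p * (B * C)) => k t tC.
have k0 : (0 : R) < k.+1%:R^-1 by rewrite invr_gt0.
have k1 : (k.+1%:R^-1 : R) <= 1 by rewrite invf_le1// ler1n.
have s0 : 0 <= t * t + k.+1%:R^-1 by exact/ltW/sq_shift_gt0.
have sC : t * t + k.+1%:R^-1 <= C * C + 1.
  rewrite lerD//; have := ler_pM (normr_ge0 t) (normr_ge0 t) tC tC.
  by rewrite -normrM ger0_norm// -expr2 sqr_ge0.
have pBC : 0 <= p * (B * C) by rewrite mulr_ge0 ?(ltW p0)// mulr_ge0.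
split.
  rewrite (le_trans (ler_normB _ _))// !ger0_norm ?powR_ge0//.
  rewrite -[leLHS]addr0 !lerD// ?ler_powR_base//.
  have := ler_powR_base p20 (ltW k0) k1; by rewrite powR1.
rewrite derive_smooth_pow// normrM (gtr0_norm p0) ler_wpDl ?addr_ge0//.
rewrite ler_wpM2l ?(ltW p0)// normrM ler_pM// ger0_norm ?powR_ge0//.
exact: ler_powR_base.
Qed.

(** Since |chi|^p need not be smooth, it is approximated by [smooth_pow] of chi. As chi is bounded,
    these functions and their derivatives are bounded uniformly in k, and the limits follow from
    dominated convergence. *)
Lemma W1p0_pow_inverse_shift (p : R) (Omega : set 'rV[R]_n) (u chi : 'rV[R]_n -> R)
    (g : 'rV[R]_n -> 'rV[R]_n) (e : R) :
  2 <= p -> measurable Omega -> (mu Omega < +oo)%E -> W1p0 p Omega u g ->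
  0 < e -> test_function Omega chi ->
  W1p0 p Omega (fun x => `|chi x| `^ p * inverse_shift p e (u x))
    (fun x => (`|chi x| `^ p * 'D_1 (inverse_shift p e) (u x)) *: g x +
       (inverse_shift p e (u x) * (p * signed_pow p (chi x))) *: grad chi x).
Proof.
move=> p2 mO Ofin W e0 tchi.
have p1 : 1 <= p by rewrite (le_trans _ p2)// ler1n.
have p0 : 0 < p by exact: lt_le_trans p2.
have [schi _ _] := tchi.
have [L0 [FL DFL]] := inverse_shift_bounded p1 e0.
have sF := @real_smooth_inverse_shift R p e e0.
have [C C0 HC] := test_bounded tchi.
have [L HL] := smooth_pow_bounded p2 (ltW C0).
have Lnn : 0 <= L.
  by have [|h _] := HL 0%N 0; [rewrite normr0 ltW|exact: le_trans h].
have L0nn : 0 <= L0 by exact: le_trans (FL 0).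
have [[mu_ mg _ ufin gfin] u0 _] := W.
move: (inverse_shift p e) sF FL DFL => F sF FL DFL.
pose T k := smooth_pow p k.+1%:R^-1.
have k0 k : (0 : R) < k.+1%:R^-1 by rewrite invr_gt0.
have sT k : real_smooth (T k) by exact: real_smooth_pow.
have T0 k : T k 0 = 0 by exact: smooth_pow0.
have tT k : test_function Omega (fun x => T k (chi x)) by exact: test_function_comp.
have TL k x : `|T k (chi x)| <= L by have [] := HL k (chi x) (HC x).
have DTL k x : `|'D_1 (T k) (chi x)| <= L by have [] := HL k (chi x) (HC x).
have cT x : T k (chi x) @[k --> \oo] --> `|chi x| `^ p by exact: smooth_pow_cvg.
have cDT x : 'D_1 (T k) (chi x) @[k --> \oo] --> p * signed_pow p (chi x).
  exact: derive_smooth_pow_cvg.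
have mchi := measurable_test (D := Omega) tchi.
have mgchi := measurable_test_grad mO tchi.
have mT k : measurable_fun Omega (fun x => T k (chi x)) := measurable_test (tT k).
have mDT k := measurable_real_smooth (real_smoothS (sT k)) mchi.
have mFu := measurable_real_smooth sF mu_.
have mDFu := measurable_real_smooth (real_smoothS sF) mu_.
have mpow : measurable_fun Omega (fun x => `|chi x| `^ p) by exact: measurable_norm_powR.
have msgn : measurable_fun Omega (fun x => p * signed_pow p (chi x)).
  have m : measurable_fun setT (fun t : R => p * signed_pow p t).
    apply: continuous_measurable_fun => t; apply: cvgM; first exact: cvg_cst.
    exact: continuous_signed_pow.
  exact: (measurableT_comp m mchi).
have cle (a : nat -> R) (l M : R) : (forall k, `|a k| <= M) -> a k @[k --> \oo] --> l -> `|l| <= M.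
  move=> aM al; have cn : `|a k| @[k --> \oo] --> `|l| by exact: cvg_norm.
  by apply: (ler_cvg_to cn (cvg_cst M)); exact: nearW.
have powL x : `| `|chi x| `^ p | <= L by exact: (cle _ _ _ (fun k => TL k x) (cT x)).
have sgnL x : `|p * signed_pow p (chi x)| <= L by exact: (cle _ _ _ (fun k => DTL k x) (cDT x)).
have bd2 (a b c d : R) : `|a| <= c -> `|b| <= d -> `|a * b| <= c * d.
  by move=> ac bd; rewrite normrM ler_pM.
have gT k x : grad (fun x => T k (chi x)) x = 'D_1 (T k) (chi x) *: grad chi x.
  by apply/rowP => i; rewrite !mxE partial_comp.
apply: (W1p0_lim p1 mO Ofin (v := fun k x => T k (chi x) * F (u x))
  (h := fun k x => (T k (chi x) * 'D_1 F (u x)) *: g x +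
     (F (u x) * 'D_1 (T k) (chi x)) *: grad chi x)).
- move=> k; have Lm t : `|F t| <= L0 := FL t.
  have := W1p0_mul_comp p1 mO Ofin mO (@subset_refl _ Omega) W sF FL DFL (tT k).
  by congr W1p0; apply/funext => x; rewrite gT scalerA.
- by move=> x /(test_eq0 tchi) ->; rewrite normr0 powR0 ?mul0r// gt_eqF.
- exact: (measurable_funM mpow mFu).
- apply: measurable_rVD => //; first exact: (measurable_rVZ mO (measurable_funM mpow mDFu) mg).
  exact: (measurable_rVZ mO (measurable_funM mFu msgn) mgchi).
- apply: (@Lp_cvg_bounded _ _ p Omega p1 mO Ofin (fun k x => T k (chi x) * F (u x))
    (fun x => `|chi x| `^ p * F (u x)) (L * L0)).
  + by move=> k; exact: (measurable_funM (mT k) mFu).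
  + exact: (measurable_funM mpow mFu).
  + by move=> k x _; exact: bd2.
  + by move=> x _; exact: bd2.
  + by apply: aeW => x _; apply: cvgM; [exact: cT|exact: cvg_cst].
- apply: (@Lp_cvgD _ _ p Omega p1 mO
    (fun k x => (T k (chi x) * 'D_1 F (u x)) *: g x)
    (fun k x => (F (u x) * 'D_1 (T k) (chi x)) *: grad chi x)
    (fun x => (`|chi x| `^ p * 'D_1 F (u x)) *: g x)
    (fun x => (F (u x) * (p * signed_pow p (chi x))) *: grad chi x)).
  + by move=> k; exact: (measurable_rVZ mO (measurable_funM (mT k) mDFu) mg).
  + by move=> k; exact: (measurable_rVZ mO (measurable_funM mFu (mDT k)) mgchi).
  + exact: (measurable_rVZ mO (measurable_funM mpow mDFu) mg).
  + exact: (measurable_rVZ mO (measurable_funM mFu msgn) mgchi).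
  + apply: (@Lp_cvg_scale_cst _ _ p Omega p1 mO (fun k x => T k (chi x) * 'D_1 F (u x))
      (fun x => `|chi x| `^ p * 'D_1 F (u x)) (L * L0) g).
    * by move=> k; exact: (measurable_funM (mT k) mDFu).
    * exact: (measurable_funM mpow mDFu).
    * by move=> k x _; exact: bd2.
    * by move=> x _; exact: bd2.
    * by apply: aeW => x _; apply: cvgM; [exact: cT|exact: cvg_cst].
    * exact: mg.
    * exact: gfin.
  + apply: (@Lp_cvg_scale_cst _ _ p Omega p1 mO (fun k x => F (u x) * 'D_1 (T k) (chi x))
      (fun x => F (u x) * (p * signed_pow p (chi x))) (L0 * L) (grad chi)).
    * by move=> k; exact: (measurable_funM mFu (mDT k)).
    * exact: (measurable_funM mFu msgn).
    * by move=> k x _; exact: bd2.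
    * by move=> x _; exact: bd2.
    * by apply: aeW => x _; apply: cvgM; [exact: cvg_cst|exact: cDT].
    * exact: mgchi.
    * by have [_] := test_integrable (ltW p0) mO Ofin tchi.
Qed.

End power_test_functions.

(** * The kernel and the energy *)

Section kernels.
Context {R : realType} {n : nat}.
Local Notation mu := (lebesgue_rV R n).
Variables (J : 'rV[R]_n -> R) (hJ : is_kernel J).
Local Notation V := 'rV[R]_n.

Lemma kernel_even x : J (- x) = J x.
Proof. by apply/le_anti/andP; split; apply: (kernel_radial_decreasing hJ); rewrite enormN. Qed.

Lemma kernel_le x : J x <= J 0.
Proof. by apply: (kernel_radial_decreasing hJ); rewrite enorm0 enorm_ge0. Qed.

Lemma measurable_kernel : measurable_fun setT J.
Proof. by apply: continuous_measurable_rV; exact: kernel_continuous. Qed.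

Lemma kernel_gt0_near : exists2 d : R, 0 < d & forall x, ball 0 d x -> 0 < J x.
Proof.
have cJ : J x @[x --> (0 : V)] --> J 0 by exact: (kernel_continuous hJ).
have h : \forall x \near (0 : V), 0 < J x.
  by apply: (cvgr_gt _ cJ); exact: kernel_gt0.
have /nbhs_ballP[d/= d0 H] := h.
by exists d => // x /H.
Qed.

Lemma kernel_vanishes : exists2 M : R, 0 < M & forall x, J x != 0 -> ball 0 M x.
Proof.
have [M M0 HM] := bounded_set_ball (compact_bounded (kernel_compact hJ)).
exists M => // x Jx; apply: HM; exact: subset_closure.
Qed.

Lemma measurable_kernel_sub : measurable_fun setT (fun z : V * V => J (z.1 - z.2)).
Proof. exact: (measurableT_comp measurable_kernel measurable_rV_sub). Qed.

Lemma measurable_fst_fun (a : V -> R) : measurable_fun setT a ->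
  measurable_fun setT (fun z : V * V => a z.1).
Proof. by move=> ma; exact: (measurableT_comp ma measurable_fst). Qed.

Lemma measurable_snd_fun (a : V -> R) : measurable_fun setT a ->
  measurable_fun setT (fun z : V * V => a z.2).
Proof. by move=> ma; exact: (measurableT_comp ma measurable_snd). Qed.

Variables (Omega : set V) (bO : bounded_set Omega).

(** If x is in [Omega] and J (x - y) is nonzero, then y lies in a fixed ball B, so the kernel is at
    most J 0 times the indicator of B. Tonelli gives M = mu(B) J 0, with no change of variables. *)
Lemma kernel_integral_le : exists2 M : R, 0 <= M & forall a : V -> R,
  measurable_fun setT a -> (forall x, 0 <= a x) -> (forall x, ~ Omega x -> a x = 0) ->
  (\int[mu \x mu]_z (a z.1 * J (z.1 - z.2))%:E <= M%:E * \int[mu]_x (a x)%:E)%E /\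
  (\int[mu \x mu]_z (a z.2 * J (z.1 - z.2))%:E <= M%:E * \int[mu]_x (a x)%:E)%E.
Proof.
have [M0 M00 HM0] := bounded_set_ball bO; have [M1 M10 HM1] := kernel_vanishes.
pose B : set V := ball 0 (M0 + M1).
have mB : measurable B by exact: measurable_ball_rV.
have /andP[_ muB] := lebesgue_rV_ball (0 : V) (addr_gt0 M00 M10).
have J00 : 0 <= J 0 by exact: (kernel_ge0 hJ).
have key x y : Omega x -> J (x - y) <= J 0 * \1_B y.
  move=> Ox; have [->|Jn0] := eqVneq (J (x - y)) 0.
    by rewrite mulr_ge0// indicE.
  have xy := HM1 _ Jn0; have x0 := HM0 _ Ox.
  rewrite indicE mem_set ?mulr1 ?kernel_le//.
  move: xy x0; rewrite /B !mx_norm_ball /ball_/= !sub0r !normrN => h1 h2.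
  rewrite -(subrK x y) (le_lt_trans (ler_normD _ _))// addrC ltrD//.
  by rewrite distrC.
have [m muE] : exists m, mu B = m%:E.
  by exists (fine (mu B)); rewrite fineK// ge0_fin_numE.
have m0 : 0 <= m by rewrite -lee_fin -muE.
exists (m * J 0) => [|a ma a0 aO]; first by rewrite mulr_ge0.
have mI : measurable_fun setT (\1_B : V -> R) by exact: measurable_indic.
have maJ : measurable_fun setT (fun x => a x * J 0).
  by apply: measurable_funM => //; exact: measurable_cst.
have aJ0 x : 0 <= a x * J 0 by rewrite mulr_ge0.
have I1 : (\int[mu]_y (\1_B y)%:E = m%:E)%E by rewrite integral_indic// setIT.
have Iin x : (\int[mu]_y (a x * J 0 * \1_B y)%:E = (m * J 0 * a x)%:E)%E.
  have i0 (y : V) : setT y -> 0 <= (\1_B y : R) by [].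
  by rewrite (nintZ mu measurableT mI i0 (aJ0 x)) I1 -EFinM; congr EFin; ring.
have Iout : (\int[mu]_x (m * J 0 * a x)%:E = (m * J 0)%:E * \int[mu]_x (a x)%:E)%E.
  by rewrite nintZ// mulr_ge0.
split.
- have mf : measurable_fun setT (fun z : V * V => a z.1 * J (z.1 - z.2)).
    exact: (measurable_funM (measurable_fst_fun ma) measurable_kernel_sub).
  have mF : measurable_fun setT (fun z : V * V => a z.1 * J 0 * \1_B z.2).
    exact: (measurable_funM (measurable_fst_fun maJ) (measurable_snd_fun mI)).
  apply: (@le_trans _ _ (\int[mu \x mu]_z (a z.1 * J 0 * \1_B z.2)%:E)%E).
    apply: (nint_le _ measurableT mf mF) => -[x y] _ /=.
    rewrite mulr_ge0 ?(kernel_ge0 hJ)//= -mulrA.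
    have [Ox|/aO ->] := pselect (Omega x); last by rewrite !mul0r.
    by rewrite ler_wpM2l// key.
  rewrite fubini_tonelli1; last 2 first.
  + exact/measurable_EFinP.
  + by move=> z; rewrite lee_fin mulr_ge0.
  rewrite -Iout le_eqVlt; apply/orP; left; apply/eqP; apply: eq_integral => x _.
  exact: Iin.
- have mf : measurable_fun setT (fun z : V * V => a z.2 * J (z.1 - z.2)).
    exact: (measurable_funM (measurable_snd_fun ma) measurable_kernel_sub).
  have mF : measurable_fun setT (fun z : V * V => a z.2 * J 0 * \1_B z.1).
    exact: (measurable_funM (measurable_snd_fun maJ) (measurable_fst_fun mI)).
  apply: (@le_trans _ _ (\int[mu \x mu]_z (a z.2 * J 0 * \1_B z.1)%:E)%E).
    apply: (nint_le _ measurableT mf mF) => -[x y] _ /=.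
    rewrite mulr_ge0 ?(kernel_ge0 hJ)//= -mulrA.
    have [Oy|/aO ->] := pselect (Omega y); last by rewrite !mul0r.
    by rewrite ler_wpM2l// -kernel_even opprB key.
  rewrite fubini_tonelli2; last 2 first.
  + exact/measurable_EFinP.
  + by move=> z; rewrite lee_fin mulr_ge0.
  rewrite -Iout le_eqVlt; apply/orP; left; apply/eqP; apply: eq_integral => x _.
  exact: Iin.
Qed.

Lemma kernel_integrable (a : V -> R) (F : V * V -> R) :
  measurable_fun setT F ->
  measurable_fun setT a -> (forall x, 0 <= a x) -> (forall x, ~ Omega x -> a x = 0) ->
  (\int[mu]_x (a x)%:E < +oo)%E ->
  (forall z, `|F z| <= (a z.1 + a z.2) * J (z.1 - z.2)) ->
  (mu \x mu)%E.-integrable setT (EFin \o F).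
Proof.
move=> mF ma a0 aO afin HF.
have [M M0 /(_ a ma a0 aO)[I1 I2]] := kernel_integral_le.
have m1 : measurable_fun setT (fun z : V * V => a z.1 * J (z.1 - z.2)).
  exact: (measurable_funM (measurable_fst_fun ma) measurable_kernel_sub).
have m2 : measurable_fun setT (fun z : V * V => a z.2 * J (z.1 - z.2)).
  exact: (measurable_funM (measurable_snd_fun ma) measurable_kernel_sub).
have lty : (M%:E * \int[mu]_x (a x)%:E < +oo)%E by rewrite lte_mul_pinfty.
have m12 := measurable_funD m1 m2.
have J0 z : 0 <= J z := kernel_ge0 hJ z.
apply: (integrable_bound measurableT mF m12).
- by move=> z _; rewrite /= -mulrDl.
- rewrite (nintD _ measurableT m1 m2) => [|z _|z _]; [|exact: mulr_ge0..].
  by rewrite lte_add_pinfty// (le_lt_trans _ lty).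
Qed.

End kernels.

(** * Integrability of the terms of the equation *)

Section weak_solutions.
Context {R : realType} {n : nat}.
Local Notation mu := (lebesgue_rV R n).
Local Notation V := 'rV[R]_n.

Lemma integral_support (U : set V) (f : V -> R) : (forall x, ~ U x -> f x = 0) ->
  (\int[mu]_(x in U) (f x)%:E = \int[mu]_x (f x)%:E)%E.
Proof.
move=> f0; rewrite integral_mkcond; apply: eq_integral => x _.
by rewrite patchE; case: ifPn => // /negP; rewrite inE => /f0 ->.
Qed.

Lemma measurable_support (U : set V) (f : V -> R) : measurable U ->
  (forall x, ~ U x -> f x = 0) -> measurable_fun U f -> measurable_fun setT f.
Proof.
move=> mU f0 mf; rewrite (_ : f = f \_ U).
  by apply/(measurable_restrict _ _ _).1 => //; rewrite setTI.
by apply/funext => x; rewrite patchE; case: ifPn => // /negP; rewrite inE => /f0 ->.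
Qed.

Variables (p : R) (J : V -> R) (Omega : set V).
Hypotheses (p2 : 2 <= p) (hJ : is_kernel J) (oO : open Omega) (bO : bounded_set Omega).

Let p1 : 1 < p. Proof. by apply: lt_le_trans p2; rewrite ltr1n. Qed.
Let p0 : 0 < p. Proof. exact: lt_trans p1. Qed.
Let mO : measurable Omega. Proof. exact: open_measurable_rV. Qed.
Let Ofin : (mu Omega < +oo)%E. Proof. exact: lebesgue_rV_bounded. Qed.
Let mJ := measurable_kernel_sub hJ.
Let J0 x : 0 <= J x. Proof. exact: kernel_ge0 hJ _. Qed.

Definition nonlocal_term (u v : V -> R) (z : V * V) : R :=
  signed_pow p (u z.1 - u z.2) * (v z.1 - v z.2) * J (z.1 - z.2).

Definition nonlocal_energy (u : V -> R) (z : V * V) : R :=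
  `|u z.1 - u z.2| `^ p * J (z.1 - z.2).

Definition local_term (g h : V -> V) (x : V) : R :=
  enorm (g x) `^ (p - 2) * dotv (g x) (h x).

Lemma measurable_diff (u : V -> R) : measurable_fun setT u ->
  measurable_fun setT (fun z : V * V => u z.1 - u z.2).
Proof. by move=> m; exact: (measurable_funB (measurable_fst_fun m) (measurable_snd_fun m)). Qed.

Lemma measurable_signed_pow d (T : measurableType d) (D : set T) (f : T -> R) :
  measurable_fun D f -> measurable_fun D (fun x => signed_pow p (f x)).
Proof.
have m : measurable_fun setT (signed_pow p).
  by apply: continuous_measurable_fun; exact: continuous_signed_pow.
by move=> mf; exact: (measurableT_comp m mf).
Qed.

Lemma measurable_nonlocal_energy u : measurable_fun setT u ->
  measurable_fun setT (nonlocal_energy u).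
Proof.
by move=> m; exact: (measurable_funM (measurable_norm_powR p (measurable_diff m)) mJ).
Qed.

Lemma measurable_nonlocal_term u v : measurable_fun setT u -> measurable_fun setT v ->
  measurable_fun setT (nonlocal_term u v).
Proof.
move=> mu_ mv; apply: (measurable_funM (measurable_funM _ (measurable_diff mv)) mJ).
exact: (measurable_signed_pow (measurable_diff mu_)).
Qed.

Let c : R := 2 `^ (p - 1).
Let c0 : 0 <= c. Proof. exact: powR_ge0. Qed.

Lemma norm_diff_powR_le (a b : R) : `|a - b| `^ p <= c * `|a| `^ p + c * `|b| `^ p.
Proof. by have := @le_normB_powR R p a 0 b (ltW p1); rewrite subr0 sub0r normrN. Qed.

Lemma nonlocal_energy_ge0 u z : 0 <= nonlocal_energy u z.
Proof. by rewrite mulr_ge0 ?powR_ge0. Qed.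

Lemma nonlocal_term_norm u v z : `|nonlocal_term u v z| <=
  nonlocal_energy u z + nonlocal_energy v z.
Proof.
rewrite /nonlocal_term /nonlocal_energy 2!normrM normr_signed_pow// (ger0_norm (J0 _)) -mulrDl ler_wpM2r//.
exact: mul_powB1_le.
Qed.

(** What the nonlocal terms use of an element of W^{1,p}_0: no gradient is involved, and the
    integrals extend over the whole space. *)
Definition Lp_off (u : V -> R) := [/\ measurable_fun setT u,
  forall x, ~ Omega x -> u x = 0 & (\int[mu]_x (`|u x| `^ p)%:E < +oo)%E].

Lemma W1p0_Lp_off u g : W1p0 p Omega u g -> Lp_off u.
Proof.
move=> [[mu_ _ _ ufin _] u0 _]; split => //; first exact: measurable_support mu_.
by rewrite -(@integral_support Omega) => [|x]; [exact: ufin|move=> /u0 ->; rewrite normr0 powR0// gt_eqF].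
Qed.

(** Controlling the nonlocal energy by the L^p norm makes it follow any approximation in W^{1,p};
    the constant is independent of u. *)
Lemma nonlocal_energy_le : exists2 C : R, 0 <= C & forall u, Lp_off u ->
  (\int[mu \x mu]_z (nonlocal_energy u z)%:E <= C%:E * \int[mu]_x (`|u x| `^ p)%:E)%E.
Proof.
have [M M0 HM] := kernel_integral_le hJ bO.
exists (c * M + c * M) => [|u [mu_ u0 ufin]]; first by rewrite addr_ge0// mulr_ge0.
pose a x := `|u x| `^ p.
have ma : measurable_fun setT a by exact: measurable_norm_powR.
have a0 x : 0 <= a x by exact: powR_ge0.
have aO x : ~ Omega x -> a x = 0 by move=> /u0; rewrite /a => ->; rewrite normr0 powR0// gt_eqF.
have [I1 I2] := HM a ma a0 aO.
have m1 : measurable_fun setT (fun z : V * V => a z.1 * J (z.1 - z.2)).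
  exact: (measurable_funM (measurable_fst_fun ma) mJ).
have m2 : measurable_fun setT (fun z : V * V => a z.2 * J (z.1 - z.2)).
  exact: (measurable_funM (measurable_snd_fun ma) mJ).
have J1 (z : V * V) : setT z -> 0 <= a z.1 * J (z.1 - z.2) by rewrite mulr_ge0.
have J2 (z : V * V) : setT z -> 0 <= a z.2 * J (z.1 - z.2) by rewrite mulr_ge0.
apply: le_trans (nint_lin_le _ measurableT (measurable_nonlocal_energy mu_) m1 m2 J1 J2 c0 c0 _) _.
  move=> z _; rewrite nonlocal_energy_ge0 /nonlocal_energy/= !mulrA -mulrDl ler_wpM2r//.
  exact: norm_diff_powR_le.
rewrite EFinD ge0_muleDl ?lee_fin ?mulr_ge0// !EFinM -!muleA.
have c0' : (0 <= c%:E)%E by rewrite lee_fin.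
exact: (leeD (lee_wpmul2l c0' I1) (lee_wpmul2l c0' I2)).
Qed.

Lemma nonlocal_energy_fin u : Lp_off u ->
  (\int[mu \x mu]_z (nonlocal_energy u z)%:E < +oo)%E.
Proof.
move=> H; have [C C0 /(_ u H)] := nonlocal_energy_le; have [_ _ ufin] := H.
by move/le_lt_trans; apply; rewrite lte_mul_pinfty.
Qed.

Lemma nonlocal_energy_integrable u : Lp_off u ->
  (mu \x mu)%E.-integrable setT (EFin \o nonlocal_energy u).
Proof.
move=> H; have [mu_ _ _] := H.
apply: (nint_integrable (measurable_nonlocal_energy mu_)).
  by move=> z _; exact: nonlocal_energy_ge0.
exact: nonlocal_energy_fin.
Qed.

Lemma nonlocal_term_integrable u v : Lp_off u -> Lp_off v ->
  (mu \x mu)%E.-integrable setT (EFin \o nonlocal_term u v).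
Proof.
move=> Hu Hv; have [mu_ _ _] := Hu; have [mv _ _] := Hv.
have m1 := measurable_nonlocal_energy mu_; have m2 := measurable_nonlocal_energy mv.
apply: (integrable_bound measurableT (measurable_nonlocal_term mu_ mv) (measurable_funD m1 m2)).
  by move=> z _; exact: nonlocal_term_norm.
rewrite (nintD _ measurableT m1 m2) => [|z _|z _]; [|exact: nonlocal_energy_ge0..].
by rewrite lte_add_pinfty// nonlocal_energy_fin.
Qed.

Lemma local_term_norm g h x : `|local_term g h x| <= enorm (g x) `^ p + enorm (h x) `^ p.
Proof.
rewrite normrM (ger0_norm (powR_ge0 _ _)).
apply: le_trans (mul_powB1_le p1 (enorm_ge0 _) (enorm_ge0 _)).
have := normr_powB2 (enorm (g x)) p1; rewrite (ger0_norm (enorm_ge0 _)) => <-.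
by rewrite -mulrA ler_wpM2l ?powR_ge0// cauchy_schwarz.
Qed.

Lemma local_term_integrable u v g h : W1p0 p Omega u g -> W1p0 p Omega v h ->
  mu.-integrable Omega (EFin \o local_term g h).
Proof.
move=> [[_ mg _ _ gfin] _ _] [[_ mh _ _ hfin] _ _].
have m1 := measurable_enorm_powR p mg; have m2 := measurable_enorm_powR p mh.
have m : measurable_fun Omega (local_term g h).
  exact: (measurable_funM (measurable_enorm_powR (p - 2) mg) (measurable_dotv mO mg mh)).
apply: (integrable_bound mO m (measurable_funD m1 m2)).
  by move=> x _; exact: local_term_norm.
rewrite (nintD _ mO m1 m2) => [|x _|x _]; [|exact: powR_ge0..].
exact: (lte_add_pinfty gfin hfin).
Qed.

Lemma mass_term_integrable u v g h : W1p0 p Omega u g -> W1p0 p Omega v h ->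
  mu.-integrable Omega (fun x => (signed_pow p (u x) * v x)%:E).
Proof.
move=> [[mu_ _ _ ufin _] _ _] [[mv _ _ vfin _] _ _].
have m1 := measurable_norm_powR p mu_; have m2 := measurable_norm_powR p mv.
have m : measurable_fun Omega (fun x => signed_pow p (u x) * v x).
  exact: (measurable_funM (measurable_signed_pow mu_) mv).
apply: (integrable_bound mO m (measurable_funD m1 m2)).
  by move=> x _; rewrite normrM normr_signed_pow// mul_powB1_le.
rewrite (nintD _ mO m1 m2) => [|x _|x _]; [|exact: powR_ge0..].
exact: (lte_add_pinfty ufin vfin).
Qed.

(** The eigenvalue equation with extended real integrals, as in [energy] and [lambda1], and with the
    gradient named. Nontriviality is dropped. *)
Definition weak_solution lambda u g := W1p0 p Omega u g /\
  forall v h, W1p0 p Omega v h ->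
    ((\int[mu]_(x in Omega) (local_term g h x)%:E +
      \int[mu \x mu]_z (nonlocal_term u v z)%:E) =
     lambda%:E * \int[mu]_(x in Omega) (signed_pow p (u x) * v x)%:E)%E.

Lemma eigenfunction_weak_solution lambda u : is_eigenfunction p J Omega lambda u ->
  exists g, weak_solution lambda u g.
Proof.
move=> [_ [g Wu Hu]]; exists g; split=> // v h Wv.
have /(congr1 (@EFin R)) := Hu v h Wv; rewrite /H_form EFinD EFinM.
rewrite -(RintegralK mO (local_term_integrable Wu Wv)).
rewrite -(RintegralK mO (mass_term_integrable Wu Wv)) => <-; congr (_ + _)%E.
rewrite /Rintegral fineK//.
apply: integrable_fin_num => //; exact: (nonlocal_term_integrable (W1p0_Lp_off Wu) (W1p0_Lp_off Wv)).
Qed.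

Lemma W1p0Z k u g : W1p0 p Omega u g ->
  W1p0 p Omega (fun x => k * u x) (fun x => k *: g x).
Proof.
move=> [[mu_ mg _ ufin gfin] u0 Au].
apply: (W1p0_intro (ltW p1) mO Ofin).
- by apply: measurable_funM => //; exact: measurable_cst.
- by apply: measurable_rVZ => //; exact: measurable_cst.
- by move=> x /u0 ->; rewrite mulr0.
move=> e e0; have k0 : 0 <= `|k| `^ p by exact: powR_ge0.
(* Adding 1 allows for k = 0 and makes the final inequality strict. *)
have K0 : 0 < `|k| `^ p + 1 by rewrite ltr_wpDl.
have [psi tpsi H] := Au (e / (`|k| `^ p + 1)) (divr_gt0 e0 K0).
exists (fun x => psi x * k); first by apply: test_functionM => //; exact: smooth_cst.
have E1 x : `|k * u x - psi x * k| `^ p = `|k| `^ p * `|u x - psi x| `^ p.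
  by rewrite [psi x * k]mulrC -mulrBr normrM powRM.
have E2 x : enorm (k *: g x - grad (fun x => psi x * k) x) `^ p =
    `|k| `^ p * enorm (g x - grad psi x) `^ p.
  have -> : grad (fun x => psi x * k) x = k *: grad psi x.
    apply/rowP => i; rewrite !mxE; have [spsi _ _] := tpsi.
    by rewrite (@partialM _ _ i psi (cst k) x spsi (smooth_cst k)) /partial derive_cst mulr0 add0r.
  by rewrite -scalerBr enormZ powRM ?enorm_ge0.
under eq_integral do rewrite E1.
under [X in (_ + X)%E]eq_integral do rewrite E2.
have m1 := measurable_sub_norm_powR p mu_ (measurable_test (D := Omega) tpsi).
have m2 := measurable_sub_enorm_powR p mO mg (measurable_test_grad mO tpsi).
rewrite (nintZ _ mO m1 (fun x _ => powR_ge0 _ _) k0) (nintZ _ mO m2 (fun x _ => powR_ge0 _ _) k0).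
rewrite -ge0_muleDr; [|exact: nint_ge0 (fun x _ => powR_ge0 _ _)..].
apply: (@le_lt_trans _ _ ((`|k| `^ p)%:E * (e / (`|k| `^ p + 1))%:E)%E).
  by apply: lee_wpmul2l; rewrite ?lee_fin// ltW.
by rewrite -EFinM lte_fin mulrCA gtr_pMr// ltr_pdivrMr// mul1r ltrDl.
Qed.

End weak_solutions.

(** * The first eigenvalue *)

Section positive_integrals.
Context {R : realType} d (T : measurableType d) (mu : {measure set T -> \bar R}).

Lemma nint_gt0 (D B : set T) (f : T -> R) : measurable D -> measurable_fun D f ->
  (forall x, D x -> 0 <= f x) -> measurable B -> B `<=` D -> (0 < mu B)%E ->
  (forall x, B x -> 0 < f x) -> (0 < \int[mu]_(x in D) (f x)%:E)%E.
Proof.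
move=> mD mf f0 mB BD B0 fB; rewrite lt0e nint_ge0// andbT; apply/eqP => I0.
have mE : measurable_fun D (EFin \o f) by exact/measurable_EFinP.
have : (\int[mu]_(x in D) `|(EFin \o f) x|)%E = 0%E.
  rewrite -[RHS]I0; apply: eq_integral => x /set_mem Dx.
  by rewrite /= ger0_norm ?f0.
move/(ae_eq_integral_abs mu mD mE) => [N [mN N0 HN]].
move: B0; rewrite (@subset_measure0 _ _ _ mu B N) ?ltxx// => x Bx.
apply: HN => /= /(_ (BD _ Bx)) [fx].
by have := fB _ Bx; rewrite fx ltxx.
Qed.

End positive_integrals.

Section rayleigh_quotient.
Context {R : realType} {n : nat}.
Local Notation mu := (lebesgue_rV R n).
Local Notation V := 'rV[R]_n.
Variables (p : R) (J : V -> R).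
Hypotheses (p2 : 2 <= p) (hJ : is_kernel J).

Let p1 : 1 < p. Proof. by apply: lt_le_trans p2; rewrite ltr1n. Qed.
Let p0 : 0 < p. Proof. exact: lt_trans p1. Qed.

(** Test functions of U are test functions of [Omega]. The representative g is arbitrary outside U
    and has to be cut to 0 there. *)
Lemma W1p0_extend (U Omega : set V) u g : open U -> open Omega -> (mu Omega < +oo)%E ->
  U `<=` Omega -> W1p0 p U u g -> W1p0 p Omega u (patch (fun=> 0) U g).
Proof.
move=> oU oO Ofin UO [[mu_ mg _ ufin gfin] u0 Au].
have mU := open_measurable_rV oU; have mO := open_measurable_rV oO.
have mu' : measurable_fun setT u by exact: measurable_support mu_.
have mg' : measurable_fun setT (patch (fun=> 0) U g : V -> V).
  apply/measurable_fun_rVP => // i.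
  rewrite (_ : (fun x => _) = (fun x => g x ord0 i) \_ U).
    apply/(measurable_restrict _ _ _).1; rewrite ?setTI//.
    by move/measurable_fun_rVP : mg => /(_ mU i).
  by apply/funext => x; rewrite /patch; case: ifP => // _; rewrite mxE.
have off (f : V -> R) : (forall x, ~ U x -> f x = 0) ->
    (\int[mu]_(x in Omega) (f x)%:E = \int[mu]_(x in U) (f x)%:E)%E.
  move=> f0; rewrite (integral_support f0); apply: integral_support => x nO.
  by apply: f0 => /UO.
have pz : (0 : R) `^ p = 0 by rewrite powR0// gt_eqF.
apply: (W1p0_intro (ltW p1) mO Ofin).
- exact: measurable_funS mu'.
- exact: measurable_funS mg'.
- by move=> x nO; apply: u0 => /UO.
move=> e /Au[psi tpsi H]; exists psi; first exact: test_functionS tpsi.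
rewrite (off (fun x => `|u x - psi x| `^ p)); last first.
  by move=> x nU; rewrite u0// (test_eq0 tpsi nU) subrr normr0.
rewrite (off (fun x => enorm (patch (fun=> 0) U g x - grad psi x) `^ p)); last first.
  move=> x nU; rewrite /patch memNset// (_ : grad psi x = 0) ?subrr ?enorm0//.
  by apply/rowP => i; rewrite !mxE (test_partial_eq0 i tpsi nU).
have -> : (\int[mu]_(x in U) (enorm (patch (fun=> 0%R) U g x - grad psi x)%R `^ p)%:E =
    \int[mu]_(x in U) (enorm (g x - grad psi x)%R `^ p)%:E)%E.
  by apply: eq_integral => x xU; rewrite /patch xU.
exact: H.
Qed.

Lemma energyZ (U : set V) k u g : open U -> W1p0 p U u g -> bounded_set U ->
  energy p J U (fun x => k * u x) (fun x => k *: g x) =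
  ((`|k| `^ p)%:E * energy p J U u g)%E.
Proof.
move=> oU W bU; have [[mu_ mg _ ufin gfin] u0 _] := W.
have mU := open_measurable_rV oU.
have [mu' _ _] := W1p0_Lp_off p2 oU W.
have k0 : 0 <= `|k| `^ p by exact: powR_ge0.
rewrite /energy.
have -> : (\int[mu]_(x in U) (enorm (k *: g x) `^ p)%:E =
    (`|k| `^ p)%:E * \int[mu]_(x in U) (enorm (g x) `^ p)%:E)%E.
  rewrite -(nintZ mu mU (measurable_enorm_powR p mg) (fun x _ => powR_ge0 _ _) k0).
  by apply: eq_integral => x _; rewrite enormZ powRM ?enorm_ge0.
have -> : (\int[mu \x mu]_z (`|k * u z.1 - k * u z.2| `^ p * J (z.1 - z.2))%:E =
    (`|k| `^ p)%:E * \int[mu \x mu]_z (nonlocal_energy p J u z)%:E)%E.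
  rewrite -(nintZ _ measurableT (measurable_nonlocal_energy p hJ mu')
    (fun z _ => nonlocal_energy_ge0 p hJ u z) k0).
  by apply: eq_integral => z _; rewrite -mulrBr normrM powRM// mulrA.
exact: esym (ge0_muleDr _ (nint_ge0 _ (fun x _ => powR_ge0 _ _))
  (nint_ge0 _ (fun z _ => nonlocal_energy_ge0 p hJ u z))).
Qed.

Lemma lambda1_lt (U : set V) lambda u g : open U -> bounded_set U -> W1p0 p U u g ->
  (0 < \int[mu]_(x in U) (`|u x| `^ p)%:E)%E ->
  (energy p J U u g < lambda%:E * \int[mu]_(x in U) (`|u x| `^ p)%:E)%E ->
  (lambda1 p J U < lambda%:E)%E.
Proof.
move=> oU bU W C0 EC; have [[mu_ mg _ ufin gfin] u0 _] := W.
have mU := open_measurable_rV oU.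
have [C CE] : exists C, (\int[mu]_(x in U) (`|u x| `^ p)%:E)%E = C%:E.
  exists (fine (\int[mu]_(x in U) (`|u x| `^ p)%:E)%E); rewrite fineK//.
  by rewrite (ge0_fin_numE (ltW C0)); exact: ufin.
rewrite CE lte_fin in C0; rewrite CE -EFinM in EC.
(* Chosen so that k u has p-th power integral 1; both sides are homogeneous of degree p. *)
pose k := C `^ (- p^-1); have k0 : 0 <= k by exact: powR_ge0.
have kp : `|k| `^ p = C^-1.
  rewrite (ger0_norm k0) /k -powRrM mulNr mulVf ?gt_eqF// powR_inv1//; exact: ltW.
apply: (@le_lt_trans _ _ (energy p J U (fun x => k * u x) (fun x => k *: g x))).
  apply: ereal_inf_lbound; exists (fun x => k * u x), (fun x => k *: g x).
  split; [exact: (W1p0Z p2 oU bU k W)| |exact: erefl].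
  have -> : (\int[mu]_(x in U) (`|k * u x| `^ p)%:E =
      \int[mu]_(x in U) (C^-1 * `|u x| `^ p)%:E)%E.
    by apply: eq_integral => x _; rewrite normrM powRM// kp.
  have Ci0 : 0 <= C^-1 by rewrite invr_ge0 ltW.
  rewrite (nintZ mu mU (measurable_norm_powR p mu_) (fun x _ => powR_ge0 _ _) Ci0).
  by rewrite CE -EFinM mulVf// gt_eqF.
rewrite energyZ// kp; have Ci : 0 < C^-1 by rewrite invr_gt0.
apply: (@lt_le_trans _ _ ((C^-1)%:E * (lambda * C)%:E)%E).
  by rewrite lte_pmul2l// ?lte_fin.
by rewrite -EFinM lee_fin mulrCA mulVf ?mulr1// gt_eqF.
Qed.

End rayleigh_quotient.

(** * Signs that interact *)

Section interacting_signs.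
Context {R : realType} {n : nat}.
Local Notation mu := (lebesgue_rV R n).
Local Notation V := 'rV[R]_n.
Variables (p : R) (J : V -> R) (Omega : set V).
Hypotheses (p2 : 2 <= p) (hJ : is_kernel J) (oO : open Omega) (bO : bounded_set Omega).

Let p1 : 1 < p. Proof. by apply: lt_le_trans p2; rewrite ltr1n. Qed.
Let p0 : 0 < p. Proof. exact: lt_trans p1. Qed.
Let mO : measurable Omega. Proof. exact: open_measurable_rV. Qed.
Let Ofin : (mu Omega < +oo)%E. Proof. exact: lebesgue_rV_bounded. Qed.

(** The mixed cases reduce to s >= 0 >= t, where (s - t)^(p-1) s >= s^p, strictly if s > 0 > t. The
    equality case recorded by [?= iff] is the source of the strict inequality of the theorem. *)
Lemma signed_pow_pos_part (a b : R) :
  `|Num.max a 0 - Num.max b 0| `^ p <=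
  signed_pow p (a - b) * (Num.max a 0 - Num.max b 0) ?= iff
  ~~ ((0 < a) && (b < 0) || (0 < b) && (a < 0)).
Proof.
have key (s t : R) : 0 <= s -> t <= 0 -> s `^ p <= signed_pow p (s - t) * s ?=
    iff ~~ ((0 < s) && (t < 0)).
  move=> s0 t0; have st : 0 <= s - t by lra.
  rewrite signed_pow_ge0E//; have [s_gt0|s_le0] /= := ltP 0 s; last first.
    have -> : s = 0 by apply/le_anti; rewrite s_le0.
    by rewrite mulr0 powR0 ?gt_eqF//; split; rewrite ?eqxx.
  rewrite -(mulr_powRB1 s0 p0) mulrC; apply/leifP.
  case: (ltP t 0) => [t_lt0|t_ge0] /=.
    by rewrite ltr_pM2r// gt0_ltr_powR ?nnegrE ?subr_gt0//; lra.
  by have -> : t = 0; [lra|rewrite subr0].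
have [a0|a0] := leP a 0; have [b0|b0] := leP b 0.
- rewrite subrr mulr0 normr0 powR0 ?gt_eqF//; by split; rewrite ?eqxx.
- rewrite sub0r normrN gtr0_norm// -opprB signed_powN mulrNN.
  by have := key b a (ltW b0) a0; rewrite b0.
- rewrite subr0 gtr0_norm//.
  by have := key a b (ltW a0) b0; rewrite a0/= orbF.
- by rewrite signed_powM// (lt_gtF a0) (lt_gtF b0); split; rewrite ?eqxx.
Qed.

Variables (lambda : R) (phi : V -> R) (g : V -> V).
Hypotheses (hphi : weak_solution p J Omega lambda phi g).
Hypothesis (cphi : {in Omega, continuous phi}).

Let W : W1p0 p Omega phi g. Proof. by case: hphi. Qed.

Let phi0 x : ~ Omega x -> phi x = 0. Proof. by case: W => _ + _; apply. Qed.

Lemma lambda1_pos_set_lt x0 y0 : 0 < phi x0 -> phi y0 < 0 -> 0 < J (x0 - y0) ->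
  (lambda1 p J (pos_set Omega phi) < lambda%:E)%E.
Proof.
move=> px0 py0 Jxy.
have Ox0 : Omega x0 by apply: contrapT => /phi0 h; move: px0; rewrite h ltxx.
have Oy0 : Omega y0 by apply: contrapT => /phi0 h; move: py0; rewrite h ltxx.
set P := pos_set Omega phi; pose v x := Num.max (phi x) 0.
have oP : open P by exact: open_pos_set.
have mP := open_measurable_rV oP.
have PO : P `<=` Omega by move=> x [].
have WP : W1p0 p P v g by exact: (W1p0_pos_part (ltW p1) oO Ofin W cphi).
have Wv := W1p0_extend p2 oP oO Ofin PO WP.
have [_ /(_ _ _ Wv)] := hphi.
have [[mvP mgP _ vfin gfin] v0 _] := WP.
have vE x : P x -> v x = phi x by move=> [_ h]; apply/max_idPl; exact: ltW.
have pz : (0 : R) `^ p = 0 by rewrite powR0// gt_eqF.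
have off (f h : V -> R) : (forall x, ~ P x -> f x = 0) -> (forall x, P x -> f x = h x) ->
    (\int[mu]_(x in Omega) (f x)%:E = \int[mu]_(x in P) (h x)%:E)%E.
  move=> f0 fh; rewrite (integral_support (U := Omega)); last by move=> x nO; apply: f0 => /PO.
  by rewrite -(integral_support f0); apply: eq_integral => x /set_mem /fh ->.
rewrite (off (local_term p g (patch (fun=> 0) P g)) (fun x => enorm (g x) `^ p)); last 2 first.
- move=> x nP; rewrite /local_term /patch memNset//.
  by rewrite -(scale0r (0 : V)) dotvZr mul0r mulr0.
- move=> x Px; rewrite /local_term /patch mem_set// -enorm_sq expr2 mulrA.
  have := signed_powM (enorm (g x)) p1; rewrite /signed_pow !ger0_norm ?enorm_ge0//.
rewrite (off (fun x => signed_pow p (phi x) * v x) (fun x => `|v x| `^ p)); last 2 first.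
- by move=> x /v0 ->; rewrite mulr0.
- by move=> x Px; rewrite vE// signed_powM.
move=> E; apply: (lambda1_lt p2 hJ oP _ WP).
- by move: bO => [M [Mr HM]]; exists M; split=> // x Mx y /PO; exact: HM.
- apply: (nint_gt0 mP (measurable_norm_powR p mvP) (fun x _ => powR_ge0 _ _) mP) => //.
    by apply: lebesgue_rV_open => //; exists x0.
  by move=> x Px; rewrite powR_gt0// vE// normr_gt0 gt_eqF//; case: Px.
rewrite -E.
have Lphi := W1p0_Lp_off p2 oO W; have Lv := W1p0_Lp_off p2 oO Wv.
have [mphi _ _] := Lphi; have [mv _ _] := Lv.
have mN := measurable_nonlocal_energy p hJ mv.
have Nfin := nonlocal_energy_fin p2 hJ bO Lv.
have Tint := nonlocal_term_integrable p2 hJ bO Lphi Lv.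
have mT : measurable_fun setT (nonlocal_term p J phi v).
  exact: (measurable_nonlocal_term p2 hJ mphi mv).
have Nint := nonlocal_energy_integrable p2 hJ bO Lv.
(* The pointwise gap between the tested nonlocal term and the nonlocal energy of phi^+. It is
   nonnegative; once its integral is positive, finiteness of the other integrals allows them to be
   cancelled. *)
pose D z := nonlocal_term p J phi v z - nonlocal_energy p J v z.
have mD : measurable_fun setT D := measurable_funB mT mN.
have Dint : (mu \x mu)%E.-integrable setT (EFin \o D).
  have := integrableB measurableT Tint Nint; apply: eq_integrable => //.
have TE : (\int[mu \x mu]_z (nonlocal_term p J phi v z)%:E =
    \int[mu \x mu]_z (D z)%:E + \int[mu \x mu]_z (nonlocal_energy p J v z)%:E)%E.
  rewrite -(integralD measurableT Dint Nint).
  by apply: eq_integral => z _; rewrite /= -EFinD /D subrK.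
have D0 : (0 < \int[mu \x mu]_z (D z)%:E)%E.
  have cJ : J x @[x --> x0 - y0] --> J (x0 - y0) by exact: (kernel_continuous hJ).
  have : \forall x \near (x0 - y0 : V), 0 < J x by exact: (cvgr_gt _ cJ).
  move=> /nbhs_ballP[r/= r0 HJ].
  have r20 : 0 < r / 2 by rewrite divr_gt0.
  have : \forall y \near y0, Omega y /\ phi y < 0.
    have nO : nbhs y0 Omega by exact: open_nbhs_nbhs.
    have cx : phi y @[y --> y0] --> phi y0 by apply: cphi; rewrite inE.
    have : \forall y \near y0, phi y < 0 by exact: (cvgr_lt _ cx).
    by apply: filterS2 nO => y Oy py; split.
  move=> /nbhs_ballP[s/= s0 Hs].
  have : \forall x \near x0, P x by exact: open_nbhs_nbhs.
  move=> /nbhs_ballP[t/= t0 Ht].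
  (* Radii at most r / 2 keep x - y within r of x0 - y0, where J is positive. *)
  pose A1 : set V := ball x0 (Num.min t (r / 2)).
  pose A2 : set V := ball y0 (Num.min s (r / 2)).
  have mA1 : measurable A1 by exact: measurable_ball_rV.
  have mA2 : measurable A2 by exact: measurable_ball_rV.
  have /andP[A10 _] : (0 < mu A1 < +oo)%E by apply: lebesgue_rV_ball; rewrite lt_min t0.
  have /andP[A20 _] : (0 < mu A2 < +oo)%E by apply: lebesgue_rV_ball; rewrite lt_min s0.
  have A12 : (0 < (mu \x mu)%E (A1 `*` A2))%E by rewrite product_measure1E// mule_gt0.
  apply: (nint_gt0 measurableT mD _ (measurableX mA1 mA2) _ A12) => //.
    move=> [x y] _; rewrite /D /nonlocal_term /nonlocal_energy/= -mulrBl.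
    by rewrite mulr_ge0 ?(kernel_ge0 hJ)// subr_ge0 (signed_pow_pos_part (phi x) (phi y)).
  move=> [x y] [/= Ax Ay].
  have [_ px] : P x by apply: Ht; apply: le_ball Ax; rewrite ge_min lexx.
  have [_ py] : Omega y /\ phi y < 0 by apply: Hs; apply: le_ball Ay; rewrite ge_min lexx.
  rewrite /D /nonlocal_term /nonlocal_energy/= -mulrBl mulr_gt0//; last first.
    apply: HJ; move: Ax Ay; rewrite /A1 /A2 !mx_norm_ball /ball_/= => Ax Ay.
    rewrite (_ : x0 - y0 - (x - y) = (x0 - x) - (y0 - y)); last first.
      by rewrite !opprB addrACA [in RHS]addrACA; congr (_ + _); rewrite addrC.
    rewrite [r]splitr (le_lt_trans (ler_normB _ _))// ltrD//.
      by rewrite (lt_le_trans Ax)// ge_min lexx orbT.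
    by rewrite (lt_le_trans Ay)// ge_min lexx orbT.
  rewrite subr_gt0 lt_neqAle; have [-> ->] := signed_pow_pos_part (phi x) (phi y).
  by rewrite px py.
have Afin : (\int[mu]_(x in P) (enorm (g x) `^ p)%:E)%E \is a fin_num.
  by rewrite ge0_fin_numE ?gfin//; exact: nint_ge0 (fun x _ => powR_ge0 _ _).
have Nfn : (\int[mu \x mu]_z (nonlocal_energy p J v z)%:E)%E \is a fin_num.
  rewrite ge0_fin_numE; first exact: Nfin.
  exact: nint_ge0 (fun z _ => nonlocal_energy_ge0 p hJ v z).
rewrite TE /energy (lteD2lE _ _ Afin) lteDr ?D0//.
Qed.

End interacting_signs.

(** * Picone tests *)

Section picone_tests.
Context {R : realType} {n : nat}.
Local Notation mu := (lebesgue_rV R n).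
Local Notation V := 'rV[R]_n.
Variables (p : R) (J : V -> R) (Omega : set V).
Hypotheses (p2 : 2 <= p) (hJ : is_kernel J) (oO : open Omega) (bO : bounded_set Omega).

Let p1 : 1 < p. Proof. by apply: lt_le_trans p2; rewrite ltr1n. Qed.
Let p0 : 0 < p. Proof. exact: lt_trans p1. Qed.
Let mO : measurable Omega. Proof. exact: open_measurable_rV. Qed.
Let Ofin : (mu Omega < +oo)%E. Proof. exact: lebesgue_rV_bounded. Qed.

Variables (lambda : R) (phi : V -> R) (g : V -> V).
Hypothesis (hphi : weak_solution p J Omega lambda phi g).

Let W : W1p0 p Omega phi g. Proof. by case: hphi. Qed.

Definition picone_test (e : R) (eta : V -> R) (x : V) : R :=
  `|eta x| `^ p * inverse_shift p e (phi x).

Lemma signed_pow_inverse_shift (e t : R) : 0 < e -> 0 <= t ->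
  0 <= signed_pow p t * inverse_shift p e t <= 1.
Proof.
move=> e0 t0; rewrite signed_pow_ge0E// inverse_shiftE//.
have te : 0 < t + e by rewrite ltr_wpDl.
rewrite mulr_ge0 ?powR_ge0//= -(opprB p 1) powRN ler_pdivrMr ?powR_gt0// mul1r.
by rewrite ler_powR_base// ?subr_ge0 ?(ltW p1)// lerDl ltW.
Qed.

(** A sign of phi is asked only where eta is nonzero: elsewhere both coefficients of the gradient h
    vanish. The same test function thus serves locally, near the closure of the positive set, and
    globally. *)
Lemma picone_test_W1p0 (e : R) (eta : V -> R) : 0 < e -> test_function Omega eta ->
  exists h, W1p0 p Omega (picone_test e eta) h /\
   ((forall x, eta x != 0 -> 0 <= phi x) ->
    forall x, local_term p g h x <= enorm (grad eta x) `^ p).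
Proof.
move=> e0 teta; eexists; split.
  exact: (W1p0_pow_inverse_shift p2 mO Ofin W e0 teta).
move=> H x; rewrite /local_term.
have [eta0|eta0] := eqVneq (eta x) 0.
  rewrite eta0 normr0 signed_pow0 powR0 ?gt_eqF// mul0r mulr0 mulr0 !scale0r addr0.
  by rewrite -(scale0r (0 : V)) dotvZr mul0r mulr0 powR_ge0.
have ph := H _ eta0; have pe : 0 < phi x + e by rewrite ltr_wpDl.
rewrite derive_inverse_shiftE// inverse_shiftE//.
have := @gradient_picone R n p `|eta x| (phi x + e) (p * signed_pow p (eta x)) (g x)
  (grad eta x) p1 (normr_ge0 _) pe.
rewrite normrM normr_signed_pow// (gtr0_norm p0) => /(_ erefl).
rewrite [(1 - p) * _]mulrC -[_ * (1 - p) * _]mulrA.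
by rewrite [(phi x + e) `^ (1 - p) * _]mulrC.
Qed.

Lemma picone_test_le (e : R) (eta : V -> R) : 0 < e -> test_function Omega eta ->
  (forall x, eta x != 0 -> 0 <= phi x) ->
  [/\ Lp_off p Omega (picone_test e eta),
    (lambda%:E * \int[mu]_(x in Omega) (signed_pow p (phi x) * picone_test e eta x)%:E <=
     \int[mu]_(x in Omega) (enorm (grad eta x) `^ p)%:E +
     \int[mu \x mu]_z (nonlocal_term p J phi (picone_test e eta) z)%:E)%E &
    forall x, 0 <= signed_pow p (phi x) * picone_test e eta x <= `|eta x| `^ p].
Proof.
move=> e0 teta H; have [h [Wh Hh]] := picone_test_W1p0 e0 teta.
split; first exact: (W1p0_Lp_off p2 oO Wh).
  have [_ /(_ _ _ Wh) <-] := hphi.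
  apply: leeD; last exact: lexx.
  have Lint := local_term_integrable p2 oO W Wh.
  have [_ Gfin] := test_integrable (ltW p0) mO Ofin teta.
  have Gint := nint_integrable (measurable_enorm_powR p (measurable_test_grad mO teta))
    (fun x _ => powR_ge0 _ _) Gfin.
  by apply: (le_integral mO Lint Gint) => x _; rewrite lee_fin; exact: Hh.
move=> x; rewrite /picone_test mulrCA.
have [->|eta0] := eqVneq (eta x) 0; first by rewrite normr0 powR0 ?mul0r ?lexx// gt_eqF.
have /andP[h1 h2] := signed_pow_inverse_shift e0 (H _ eta0).
by rewrite mulr_ge0 ?powR_ge0//= -[leRHS]mulr1 ler_wpM2l ?powR_ge0.
Qed.

(** The two Picone inequalities bound the tested equation by the energy of eta, independently of e.
    The mass density is |eta|^p (phi / (phi + e))^(p-1), which tends to |eta|^p wherever phi > 0,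
    hence almost everywhere. *)
Lemma nonneg_picone (eta : V -> R) : (forall x, 0 <= phi x) ->
  {ae mu, forall x, Omega x -> 0 < phi x} -> test_function Omega eta ->
  (lambda%:E * \int[mu]_(x in Omega) (`|eta x| `^ p)%:E <= energy p J Omega eta (grad eta))%E.
Proof.
move=> phi0 phipos teta.
pose e k : R := k.+1%:R^-1; have e0 k : 0 < e k by rewrite invr_gt0.
have Weta := test_W1p0 (ltW p1) mO Ofin teta.
have Leta := W1p0_Lp_off p2 oO Weta; have [meta _ _] := Leta.
have Lphi := W1p0_Lp_off p2 oO W; have [mphi _ _] := Lphi.
pose f k x := signed_pow p (phi x) * picone_test (e k) eta x.
have main k : (lambda%:E * \int[mu]_(x in Omega) (f k x)%:E <=
    energy p J Omega eta (grad eta))%E.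
  have [Lk + _] := picone_test_le (e0 k) teta (fun x _ => phi0 x).
  move/le_trans; apply; apply: leeD; first exact: lexx.
  apply: (le_integral measurableT (nonlocal_term_integrable p2 hJ bO Lphi Lk)
    (nonlocal_energy_integrable p2 hJ bO Leta)) => -[x y] _.
  rewrite lee_fin /nonlocal_term /nonlocal_energy /picone_test/= ler_wpM2r ?(kernel_ge0 hJ)//.
  rewrite !inverse_shiftE//.
  apply: le_trans (discrete_picone p1 (phi0 x) (phi0 y) (e0 k) (normr_ge0 _) (normr_ge0 _)) _.
  by rewrite ler_powR_base ?(ltW p0)// ler_dist_dist.
have [efin _] := test_integrable (ltW p0) mO Ofin teta.
have mf k : measurable_fun Omega (f k).
  have [[mpsi _ _] _ _] := picone_test_le (e0 k) teta (fun x _ => phi0 x).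
  apply: measurable_funTS.
  exact: (measurable_funM (measurable_signed_pow p2 mphi) mpsi).
have meta' : measurable_fun Omega (fun x => `|eta x| `^ p).
  by apply: measurable_norm_powR; exact: measurable_funTS.
have fb k x : 0 <= f k x <= `|eta x| `^ p.
  by have [_ _] := picone_test_le (e0 k) teta (fun x _ => phi0 x); apply.
pose d k x := `|eta x| `^ p - f k x.
have md k : measurable_fun Omega (d k) := measurable_funB meta' (mf k).
have db k x : 0 <= d k x <= `|eta x| `^ p.
  have /andP[h1 h2] := fb k x; rewrite subr_ge0 h2/= gerBl//.
have dcvg : (\int[mu]_(x in Omega) (d k x)%:E)%E @[k --> \oo] --> 0%E.
  apply: (nint_dominated mO md meta' (fun k x _ => db k x) efin).
  apply: filterS phipos => x Hx /Hx px.
  rewrite -[X in _ --> X](subrr (`|eta x| `^ p)); apply: cvgB; first exact: cvg_cst.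
  rewrite (_ : (fun k => f k x) = fun k => `|eta x| `^ p *
      (phi x `^ (p - 1) * (`|phi x + e k| `^ (p - 1))^-1)); last first.
    apply/funext => k; rewrite /f /picone_test mulrCA inverse_shiftE ?(ltW px)//.
    by rewrite signed_pow_ge0E ?(ltW px)// (gtr0_norm (addr_gt0 px (e0 k))) -(opprB p 1) powRN.
  have pw : 0 < phi x `^ (p - 1) by rewrite powR_gt0.
  have E : `|eta x| `^ p * (phi x `^ (p - 1) * (`|phi x| `^ (p - 1))^-1) = `|eta x| `^ p.
    by rewrite (gtr0_norm px) (mulfV (lt0r_neq0 pw)) mulr1.
  rewrite -[X in _ --> X]E.
  apply: cvgM; first exact: cvg_cst.
  apply: cvgM; first exact: cvg_cst.
  apply: cvgV; first by rewrite (gtr0_norm px) (lt0r_neq0 pw).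
  have h0 : e k @[k --> \oo] --> (0 : R) by exact: cvg_harmonic.
  have h1 : phi x + e k @[k --> \oo] --> phi x.
    by rewrite -[X in _ --> X]addr0; apply: cvgD => //; exact: cvg_cst.
  have p10 : 0 <= p - 1 by rewrite subr_ge0 ltW.
  have cp := continuous_norm_powR p10 (x := phi x).
  exact: (@cvg_comp _ _ _ (fun k => phi x + e k) (fun t : R => `|t| `^ (p - 1)) _ _ _ h1 cp).
have dle k : (lambda%:E * \int[mu]_(x in Omega) (`|eta x| `^ p)%:E <=
   energy p J Omega eta (grad eta) + lambda%:E * \int[mu]_(x in Omega) (d k x)%:E)%E.
  have -> : (\int[mu]_(x in Omega) (`|eta x| `^ p)%:E = \int[mu]_(x in Omega) (f k x)%:E +
      \int[mu]_(x in Omega) (d k x)%:E)%E.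
    rewrite -(nintD mu mO (mf k) (md k)).
    - by apply: eq_integral => x _; rewrite /d addrC subrK.
    - by move=> x _; have /andP[] := fb k x.
    - by move=> x _; have /andP[] := db k x.
  rewrite ge0_muleDr; [|apply: nint_ge0 => x _; by have /andP[] := fb k x|
    apply: nint_ge0 => x _; by have /andP[] := db k x].
  by apply: leeD; [exact: main|exact: lexx].
have cG : (energy p J Omega eta (grad eta) + lambda%:E * \int[mu]_(x in Omega) (d k x)%:E)%E
    @[k --> \oo] --> energy p J Omega eta (grad eta).
  rewrite -[X in _ --> X]adde0; apply: cvgeD.
  - by rewrite fin_num_adde_defl.
  - exact: cvg_cst.
  - by rewrite -[X in _ --> X](mule0 lambda%:E); apply: cvgeZl.
by apply: (cvge_to_ge cG); exact: nearW.
Qed.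

End picone_tests.

(** * Density of test functions in the Rayleigh quotient *)

Section rayleigh_density.
Context {R : realType} {n : nat}.
Local Notation mu := (lebesgue_rV R n).
Local Notation V := 'rV[R]_n.
Variables (p : R) (J : V -> R) (Omega : set V).
Hypotheses (p2 : 2 <= p) (hJ : is_kernel J) (oO : open Omega) (bO : bounded_set Omega).

Let p1 : 1 < p. Proof. by apply: lt_le_trans p2; rewrite ltr1n. Qed.
Let p0 : 0 < p. Proof. exact: lt_trans p1. Qed.
Let mO : measurable Omega. Proof. exact: open_measurable_rV. Qed.
Let Ofin : (mu Omega < +oo)%E. Proof. exact: lebesgue_rV_bounded. Qed.

Lemma nonneg_fin_real (x : \bar R) : (0 <= x)%E -> (x < +oo)%E ->
  exists2 r : R, 0 <= r & x = r%:E.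
Proof.
move=> x0 xoo; have xE : x = (fine x)%:E by rewrite fineK// ge0_fin_numE.
by exists (fine x) => //; exact: fine_ge0.
Qed.

Lemma powR_split (t a b : R) : 0 < t < 1 ->
  `|a| `^ p <= (1 - t) `^ (1 - p) * `|b| `^ p + t `^ (1 - p) * `|a - b| `^ p.
Proof.
move=> t01; apply: le_trans (powRD_eps (ltW p1) t01 (normr_ge0 b) (normr_ge0 (a - b))).
rewrite (ler_powR_base (ltW p0))// -{1}(subrK b a) addrC; exact: ler_normD.
Qed.

Lemma powR_enorm_split (t : R) (a b : V) : 0 < t < 1 ->
  enorm a `^ p <= (1 - t) `^ (1 - p) * enorm b `^ p + t `^ (1 - p) * enorm (a - b) `^ p.
Proof.
move=> t01; apply: le_trans (powRD_eps (ltW p1) t01 (enorm_ge0 b) (enorm_ge0 (a - b))).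
rewrite (ler_powR_base (ltW p0)) ?enorm_ge0// -{1}(subrK b a) addrC; exact: ler_enormD.
Qed.

(** Replace an admissible u by a test function eta with error d, using [powRD_eps] with parameter t.
    The factor (1 - t)^(1-p) is paid twice: from u to eta in the norm, and from eta to u in the
    energy. *)
Lemma lambda1_ge (lambda : R) : 0 <= lambda ->
  (forall eta, test_function Omega eta ->
    (lambda%:E * \int[mu]_(x in Omega) (`|eta x| `^ p)%:E <=
     energy p J Omega eta (grad eta))%E) ->
  (lambda%:E <= lambda1 p J Omega)%E.
Proof.
move=> l0 H; apply: le_ereal_inf_tmp => _ [u [gu [Wu u1 ->]]].
have [[mu_ mg _ ufin gfin] u0 Au] := Wu.
have Lu := W1p0_Lp_off p2 oO Wu; have [mu' _ _] := Lu.
have [C C0 HC] := nonlocal_energy_le p2 hJ bO.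
have [G G0 GE] := nonneg_fin_real (nint_ge0 mu (fun x _ => powR_ge0 (enorm (gu x)) p)) gfin.
have [N N0 NE] := nonneg_fin_real
  (nint_ge0 (mu \x mu)%E (fun z _ => nonlocal_energy_ge0 p hJ u z)) (nonlocal_energy_fin p2 hJ bO Lu).
rewrite /energy GE (NE : (\int[mu \x mu]_z (`|u z.1 - u z.2| `^ p * J (z.1 - z.2))%:E)%E = _).
rewrite -EFinD lee_fin.
have step t d : 0 < t < 1 -> 0 < d ->
    lambda <= (1 - t) `^ (1 - p) * ((1 - t) `^ (1 - p) * (G + N)) +
      ((1 - t) `^ (1 - p) * (t `^ (1 - p) * (1 + C)) + lambda * t `^ (1 - p)) * d.
  move=> t01 d0; set s := (1 - t) `^ (1 - p); set s' := t `^ (1 - p).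
  have s0 : 0 <= s by exact: powR_ge0.
  have s'0 : 0 <= s' by exact: powR_ge0.
  have [eta teta Hd] := Au d d0.
  have Weta := test_W1p0 (ltW p1) mO Ofin teta.
  have Leta := W1p0_Lp_off p2 oO Weta; have [meta' _ _] := Leta.
  have meta := measurable_test (D := Omega) teta.
  have mgeta := measurable_test_grad mO teta.
  have mdif := measurable_sub_norm_powR p mu_ meta.
  have mgdif := measurable_sub_enorm_powR p mO mg mgeta.
  have [efin gefin] := test_integrable (ltW p0) mO Ofin teta.
  have D1nn := nint_ge0 (D := Omega) mu (fun x _ => powR_ge0 `|u x - eta x| p).
  have D2nn := nint_ge0 (D := Omega) mu (fun x _ => powR_ge0 (enorm (gu x - grad eta x)) p).
  have doo : (d%:E < +oo)%E by rewrite ltry.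
  have [d1 d10 d1E] := nonneg_fin_real D1nn
    (lt_trans (le_lt_trans (leeDl _ D2nn) Hd) doo).
  have [d2 d20 d2E] := nonneg_fin_real D2nn
    (lt_trans (le_lt_trans (leeDr _ D1nn) Hd) doo).
  rewrite d1E d2E -EFinD lte_fin in Hd.
  have [A A0 AE] := nonneg_fin_real (nint_ge0 mu (fun x _ => powR_ge0 `|eta x| p)) efin.
  have [B B0 BE] := nonneg_fin_real (nint_ge0 mu (fun x _ => powR_ge0 (enorm (grad eta x)) p)) gefin.
  have [Nc Nc0 NcE] := nonneg_fin_real
    (nint_ge0 (mu \x mu)%E (fun z _ => nonlocal_energy_ge0 p hJ eta z)) (nonlocal_energy_fin p2 hJ bO Leta).
  pose w x := u x - eta x.
  have mw : measurable_fun setT w := measurable_funB mu' meta'.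
  have w0 x : ~ Omega x -> w x = 0.
    by move=> nO; rewrite /w u0// (test_eq0 teta nO) subrr.
  have wE : (\int[mu]_x (`|w x| `^ p)%:E = d1%:E)%E.
    rewrite -d1E -(integral_support (U := Omega))// => x /w0 ->.
    by rewrite normr0 powR0// gt_eqF.
  have Lw : Lp_off p Omega w by split; [exact: mw|exact: w0|rewrite wE; exact: ltry].
  have [Nd Nd0 NdE] := nonneg_fin_real
    (nint_ge0 (mu \x mu)%E (fun z _ => nonlocal_energy_ge0 p hJ w z)) (nonlocal_energy_fin p2 hJ bO Lw).
  have h1 : 1 <= s * A + s' * d1.
    have := nint_lin_le mu mO (measurable_norm_powR p mu_) (measurable_norm_powR p meta) mdif
      (fun x _ => powR_ge0 _ _) (fun x _ => powR_ge0 _ _) s0 s'0.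
    rewrite u1 AE d1E -!EFinM -EFinD lee_fin; apply=> x _.
    by rewrite powR_ge0/=; exact: powR_split.
  have h2 : B <= s * G + s' * d2.
    have := nint_lin_le mu mO (measurable_enorm_powR p mgeta) (measurable_enorm_powR p mg) mgdif
      (fun x _ => powR_ge0 _ _) (fun x _ => powR_ge0 _ _) s0 s'0.
    rewrite BE GE d2E -!EFinM -EFinD lee_fin; apply=> x _.
    rewrite powR_ge0/= -[X in s' * X `^ p]enormN opprB; exact: powR_enorm_split.
  have h3 : Nc <= s * N + s' * Nd.
    have := nint_lin_le (mu \x mu)%E measurableT (measurable_nonlocal_energy p hJ meta')
      (measurable_nonlocal_energy p hJ mu') (measurable_nonlocal_energy p hJ mw)
      (fun z _ => nonlocal_energy_ge0 p hJ _ z) (fun z _ => nonlocal_energy_ge0 p hJ _ z) s0 s'0.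
    rewrite NcE NE NdE -!EFinM -EFinD lee_fin; apply=> z _.
    rewrite nonlocal_energy_ge0//= /nonlocal_energy !mulrA -mulrDl ler_wpM2r ?(kernel_ge0 hJ)//.
    have -> : w z.1 - w z.2 = - ((eta z.1 - eta z.2) - (u z.1 - u z.2)) by rewrite /w; ring.
    by rewrite normrN; exact: powR_split.
  have h4 : Nd <= C * d1 by have := HC w Lw; rewrite NdE wE -EFinM lee_fin.
  have h5 : lambda * A <= B + Nc.
    have := H eta teta; rewrite /energy AE BE.
    rewrite (NcE : (\int[mu \x mu]_z (`|eta z.1 - eta z.2| `^ p * J (z.1 - z.2))%:E)%E = _).
    by rewrite -EFinM -EFinD lee_fin.
  have d1d : d1 <= d by lra.
  have d2d : d2 <= d by lra.
  have k1 : lambda <= lambda * (s * A + s' * d1) by rewrite ler_peMr.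
  have k2 : s * (lambda * A) <= s * (B + Nc) by rewrite ler_wpM2l.
  have k3 : s * (B + Nc) <= s * (s * G + s' * d2 + (s * N + s' * Nd)).
    by rewrite ler_wpM2l// lerD.
  have k4 : s * s' * Nd <= s * s' * (C * d).
    rewrite ler_wpM2l ?mulr_ge0// (le_trans h4)// ler_wpM2l//.
  have k5 : s * s' * d2 <= s * s' * d by rewrite ler_wpM2l ?mulr_ge0.
  have k6 : lambda * s' * d1 <= lambda * s' * d by rewrite ler_wpM2l ?mulr_ge0.
  lra.
(* The order of limits matters: d tends to 0 with t fixed, since t^(1-p) multiplies d; only then may
   t tend to 0. *)
have step2 t : 0 < t < 1 -> ((1 - t) `^ (p - 1)) ^+ 2 * lambda <= G + N.
  move=> t01; have t1 : 0 < 1 - t by lra.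
  have : lambda <= (1 - t) `^ (1 - p) * ((1 - t) `^ (1 - p) * (G + N)).
    apply/ler_addgt0Pr => e e0.
    set K := ((1 - t) `^ (1 - p) * (t `^ (1 - p) * (1 + C)) + lambda * t `^ (1 - p)).
    have K0 : 0 <= K.
      by rewrite addr_ge0// ?mulr_ge0 ?powR_ge0// addr_ge0.
    have K1 : 0 < K + 1 by rewrite ltr_wpDl.
    apply: le_trans (step t (e / (K + 1)) t01 (divr_gt0 e0 K1)) _.
    by rewrite lerD2l mulrCA ger_pMr// ler_pdivrMr// mul1r lerDl.
  rewrite -(opprB p 1) powRN; set q := (1 - t) `^ (p - 1).
  have q0 : 0 < q by rewrite powR_gt0.
  by rewrite mulrA -invfM -expr2 ler_pdivlMl ?exprn_gt0.
(* With [k.+2] the condition t < 1 holds from k = 0 on. *)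
pose e k : R := k.+2%:R^-1.
have h0 : e k @[k --> \oo] --> (0 : R).
  have := @cvg_harmonic R; rewrite -(cvg_shiftS _) => h; exact: h.
have h1 : 1 - e k @[k --> \oo] --> (1 : R).
  by rewrite -[X in _ --> X]subr0; apply: cvgB => //; exact: cvg_cst.
have p10 : 0 <= p - 1 by rewrite subr_ge0 ltW.
have cp := continuous_norm_powR p10 (x := 1).
have h2 := @cvg_comp _ _ _ (fun k => 1 - e k) (fun t : R => `|t| `^ (p - 1)) _ _ _ h1 cp.
have h3 : (`|1 - e k| `^ (p - 1)) ^+ 2 * lambda @[k --> \oo] --> lambda.
  rewrite -[X in _ --> X]mul1r; apply: cvgM; last exact: cvg_cst.
  have h4 : `|1 - e k| `^ (p - 1) @[k --> \oo] --> (1 : R).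
    by move: h2; rewrite normr1 powR1.
  rewrite -[X in _ --> X](mulr1 (1 : R)); exact: (cvgM h4 h4).
apply: (ler_cvg_to h3 (cvg_cst (G + N))); apply: nearW => k.
have ek : 0 < e k < 1 by rewrite invr_gt0 ltr0n/= invf_lt1// ltr1n.
by rewrite ger0_norm; [exact: step2|lra].
Qed.

End rayleigh_density.

(** * Signs that do not interact *)

Lemma cvg_kernel_sub (R : realType) (n : nat) (J : 'rV[R]_n -> R) (T : Type)
    (F : set_system T) {FF : Filter F} (a b : T -> 'rV[R]_n) (x y : 'rV[R]_n) :
  is_kernel J -> a t @[t --> F] --> x -> b t @[t --> F] --> y ->
  J (a t - b t) @[t --> F] --> J (x - y).
Proof.
move=> hJ ca cb.
have h : a t - b t @[t --> F] --> x - y by exact: (@cvgB R 'rV[R]_n T F FF a b x y ca cb).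
have cJ := kernel_continuous hJ (x := x - y).
exact: (@cvg_comp _ _ _ (fun t => a t - b t) J _ _ _ h cJ).
Qed.

Section zero_set_inequality.
Context {R : realType}.
Variable p : R.
Hypothesis p2 : 2 <= p.

Let p1 : 1 < p. Proof. by apply: lt_le_trans p2; rewrite ltr1n. Qed.

(** The summand 2^(p-1) bounds |s - t|^p after the discrete Picone inequality when both values are
    positive; the summand 1 serves when one of them vanishes. *)
Let K : R := 1 + 2 `^ (p - 1).

Let K1 : 1 <= K. Proof. by rewrite lerDl powR_ge0. Qed.

(* Picone's inequality, improved where phi (whose values are a and b) vanishes:
   the factor e^(1-p), unbounded as e tends to 0, will force the zero set of phi
   to be negligible. *)
Lemma zero_set_picone (a b s t e : R) : 0 < e -> 0 <= s -> 0 <= t ->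
  (s != 0 -> 0 <= a) -> (t != 0 -> 0 <= b) ->
  ~~ ((0 < a) && (b < 0)) -> ~~ ((0 < b) && (a < 0)) ->
  signed_pow p (a - b) * (s `^ p * inverse_shift p e a - t `^ p * inverse_shift p e b) <=
  K * (s `^ p + t `^ p) - e `^ (1 - p) * ((a == 0)%:R * s `^ p * signed_pow p b +
    (b == 0)%:R * t `^ p * signed_pow p a).
Proof.
move=> e0; wlog ab : a b s t / a <= b => [H|s0 t0 sa tb nab nba].
  move=> s0 t0 sa tb nab nba; have [ab|/ltW ba] := leP a b; first exact: H.
  have := H b a t s ba t0 s0 tb sa nba nab.
  rewrite -(opprB a b) signed_powN mulNr -mulrN opprB [t `^ p + _]addrC.
  by rewrite [(b == 0)%:R * _ * _ + _]addrC.
have F0 : inverse_shift p e 0 = e `^ (1 - p) by rewrite inverse_shiftE// add0r.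
have z0 : (0 : R) `^ p = 0 by rewrite powR0// gt_eqF// (lt_trans _ p1).
have S0 : 0 <= s `^ p by exact: powR_ge0.
have T0 : 0 <= t `^ p by exact: powR_ge0.
have KST : s `^ p + t `^ p <= K * (s `^ p + t `^ p) by rewrite ler_peMl// addr_ge0.
have [b0|b0] := ltP b 0.
  have -> : t = 0 by apply/eqP; apply: contraTT b0 => /tb; rewrite -leNgt.
  have -> : s = 0.
    by apply/eqP; apply: contraTT (le_lt_trans ab b0) => /sa; rewrite -leNgt.
  rewrite z0; move: (signed_pow _ _) (signed_pow _ _) (signed_pow _ _) => x1 x2 x3.
  move: (inverse_shift _ _ _) (inverse_shift _ _ _) (e `^ _) => x4 x5 x6.
  by rewrite !(mul0r, mulr0, addr0, subr0).
(* For a < 0 the absence of interaction forces b = 0, and the singular terms of the two sides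
   coincide. *)
have [a_lt0|a_ge0] := ltP a 0.
  have sz : s = 0 by apply/eqP; apply: contraTT a_lt0 => /sa; rewrite -leNgt.
  have bz : b = 0 by apply/le_anti; rewrite b0 andbT leNgt; move: nba; rewrite a_lt0 andbT.
  rewrite sz bz z0 subr0 mul0r sub0r F0 eqxx (lt_eqF a_lt0) mulr0 mul0r mul1r !add0r.
  by rewrite sz z0 add0r in KST; lra.
have [a0|a_neq0] := eqVneq a 0; last first.
  have a_gt0 : 0 < a by rewrite lt_neqAle eq_sym a_neq0.
  have b_gt0 : 0 < b by exact: lt_le_trans ab.
  rewrite (gt_eqF b_gt0) !mul0r addr0 mulr0 subr0 !inverse_shiftE//.
  apply: le_trans (discrete_picone p1 a_ge0 b0 e0 s0 t0) _.
  apply: le_trans (norm_diff_powR_le p2 s t) _.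
  by rewrite (ger0_norm s0) (ger0_norm t0) -mulrDr ler_wpM2r ?addr_ge0// lerDr.
rewrite a0 sub0r signed_powN signed_pow0 mulr0 addr0 mul1r F0.
have /andP[h1 h2] := signed_pow_inverse_shift p2 e0 b0.
have : t `^ p * (signed_pow p b * inverse_shift p e b) <= t `^ p by rewrite ler_piMr.
move: S0 KST; move: (K * (s `^ p + t `^ p)) (signed_pow p b) (inverse_shift p e b).
move: (s `^ p) (t `^ p) (e `^ (1 - p)).
move=> S T E k Q F h3 h4 h5; clear -h3 h4 h5; lra.
Qed.

End zero_set_inequality.

(** * Negligibility of the zero set near the positive set *)

Section no_interaction.
Context {R : realType} {n : nat}.
Local Notation mu := (lebesgue_rV R n).
Local Notation V := 'rV[R]_n.
Variables (p : R) (J : V -> R) (Omega : set V).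
Hypotheses (p2 : 2 <= p) (hJ : is_kernel J) (oO : open Omega) (bO : bounded_set Omega).

Let p1 : 1 < p. Proof. by apply: lt_le_trans p2; rewrite ltr1n. Qed.
Let p0 : 0 < p. Proof. exact: lt_trans p1. Qed.
Let mO : measurable Omega. Proof. exact: open_measurable_rV. Qed.
Let Ofin : (mu Omega < +oo)%E. Proof. exact: lebesgue_rV_bounded. Qed.
Let J0 x : 0 <= J x. Proof. exact: kernel_ge0 hJ _. Qed.

Variables (phi : V -> R).
Hypotheses (Lphi : Lp_off p Omega phi) (cphi : {in Omega, continuous phi}).
Hypothesis nopair : forall x y, 0 < phi x -> phi y < 0 -> J (x - y) = 0.

Let mphi : measurable_fun setT phi. Proof. by case: Lphi. Qed.
Let phi0 x : ~ Omega x -> phi x = 0. Proof. by case: Lphi => _ + _; apply. Qed.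
Local Notation q := (fun y => signed_pow p (phi y)).

Let mq : measurable_fun setT q. Proof. exact: measurable_signed_pow. Qed.

Lemma signed_pow_fin : (\int[mu]_y (`|signed_pow p (phi y)|)%:E < +oo)%E.
Proof.
have [_ _ fin] := Lphi.
have m1 := measurable_norm_powR p mphi.
have m2 : measurable_fun setT (\1_Omega : V -> R) by exact: measurable_indic.
apply: (@le_lt_trans _ _ (\int[mu]_y (`|phi y| `^ p + \1_Omega y)%:E)%E).
  apply: (nint_le mu measurableT _ (measurable_funD m1 m2)) => [|y _].
    exact: measurableT_comp mq.
  rewrite normr_ge0 normr_signed_pow//=.
  have [Oy|/phi0 ->] := pselect (Omega y).
    rewrite indicE mem_set//=; have := mul_powB1_le p1 (normr_ge0 (phi y)) (ler01 : (0 : R) <= 1).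
    by rewrite mulr1 powR1.
  by rewrite normr0 powR0 ?subr_eq0 ?gt_eqF// addr_ge0 ?powR_ge0// indicE.
rewrite (nintD mu measurableT m1 m2); last 2 first.
- by move=> x _; exact: powR_ge0.
- by move=> x _; rewrite indicE.
apply: lte_add_pinfty; first exact: fin.
by rewrite integral_indic// setIT.
Qed.

Let mJx x : measurable_fun setT (fun y : V => J (x - y)).
Proof.
apply: continuous_measurable_rV => y.
exact: (@cvg_kernel_sub R n J _ (nbhs (y : V)) _ (fun=> x) id x y hJ (cvg_cst x) cvg_id).
Qed.

Let mqJ x : measurable_fun setT (fun y => signed_pow p (phi y) * J (x - y)).
Proof. exact: (measurable_funM mq (mJx x)). Qed.

Lemma potential_integrable x :
  mu.-integrable setT (EFin \o (fun y => signed_pow p (phi y) * J (x - y))).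
Proof.
have mF : measurable_fun setT (fun y => J 0 * `|signed_pow p (phi y)|).
  by apply: measurable_funM; [exact: measurable_cst|exact: measurableT_comp mq].
apply: (integrable_bound measurableT (mqJ x) mF).
  move=> y _; rewrite normrM mulrC ler_wpM2r// ger0_norm//; exact: kernel_le.
rewrite (nintZ mu measurableT _ (fun y _ => normr_ge0 _) (J0 0)).
  by rewrite lte_mul_pinfty ?lee_fin// signed_pow_fin.
exact: measurableT_comp mq.
Qed.

(** The convolution of |phi|^(p-2) phi with [J]. At a zero x of phi its opposite is the integral of
    |phi x - phi y|^(p-2) (phi x - phi y) J (x - y) in y. *)
Definition potential x : R := fine (\int[mu]_y (signed_pow p (phi y) * J (x - y))%:E)%E.

Lemma potentialE x :
  (\int[mu]_y (signed_pow p (phi y) * J (x - y))%:E = (potential x)%:E)%E.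
Proof. by rewrite /potential fineK//; exact: integrable_fin_num (potential_integrable x). Qed.

Lemma closure_pos_no_interaction x0 y : closure (pos_set Omega phi) x0 -> phi y < 0 ->
  J (x0 - y) = 0.
Proof.
move=> cx0 py; apply/eqP; rewrite eq_le J0 andbT leNgt; apply/negP => Jp.
have cJ : J (x - y) @[x --> x0] --> J (x0 - y).
  exact: (@cvg_kernel_sub R n J _ (nbhs (x0 : V)) _ id (fun=> y) x0 y hJ cvg_id (cvg_cst y)).
have hn : \forall x \near x0, 0 < J (x - y) by exact: (cvgr_gt _ cJ).
have [x [[_ px] /=]] := cx0 _ hn.
by rewrite nopair// ltxx.
Qed.

(** From x0 the kernel does not reach negative values of phi, while it is positive on a ball around
    x0, which meets the positive set in a nonempty open set. *)
Lemma potential_gt0 x0 : closure (pos_set Omega phi) x0 -> 0 < potential x0.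
Proof.
move=> cx0; rewrite -lte_fin -potentialE.
have [d d0 Hd] := kernel_gt0_near hJ.
have oP : open (pos_set Omega phi) by exact: open_pos_set.
have oB : open (pos_set Omega phi `&` ball x0 d) by apply: openI => //; exact: ball_open.
have B0 : pos_set Omega phi `&` ball x0 d !=set0.
  by have [x Hx] := cx0 _ (nbhsx_ballx x0 d d0); exists x.
apply: (nint_gt0 measurableT (mqJ x0) _ (open_measurable_rV oB)) => //.
- move=> y _; have [py|py] := ltP (phi y) 0.
    by rewrite closure_pos_no_interaction// mulr0.
  by rewrite mulr_ge0// signed_pow_ge0.
- exact: lebesgue_rV_open.
- move=> y [[_ py] By]; rewrite mulr_gt0 ?signed_pow_gt0//; apply: Hd.
  by move: By; rewrite !mx_norm_ball /ball_/= sub0r normrN.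
Qed.

(** Continuity of the potential, in sequential form: points z k tending to x0 with nonpositive
    potential would give a nonpositive potential at x0, by dominated convergence, [J] being
    continuous and bounded by J 0. *)
Lemma near_potential_gt0 x0 : closure (pos_set Omega phi) x0 ->
  exists2 r : R, 0 < r & forall x, ball x0 r x -> 0 < potential x.
Proof.
move=> cx0; apply: contrapT => H.
have seq k : exists x, ball x0 (k.+1%:R^-1 : R) x /\ potential x <= 0.
  apply: contrapT => Hk; apply: H; exists (k.+1%:R^-1); first by rewrite invr_gt0.
  by move=> x bx; rewrite ltNge; apply/negP => px; apply: Hk; exists x.
have [z Hz] := choice seq.
have cz : z k @[k --> \oo] --> x0.
  apply/cvgrPdist_lt => e e0; have [N _ HN] := near_infty_natSinv_lt (PosNum e0).
  exists N => // k /HN /= ke; have [bz _] := Hz k.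
  by move: bz; rewrite mx_norm_ball /ball_/= => /lt_trans; apply.
pose f k y := `|signed_pow p (phi y)| * `|J (x0 - y) - J (z k - y)|.
have mabs : measurable_fun setT (fun y => `|signed_pow p (phi y)|).
  exact: measurableT_comp mq.
have mf k : measurable_fun setT (f k).
  apply: (measurable_funM mabs); apply: measurableT_comp => //.
  exact: (measurable_funB (mJx x0) (mJx (z k))).
have mF : measurable_fun setT (fun y => `|signed_pow p (phi y)| * J 0).
  by apply: (measurable_funM mabs); exact: measurable_cst.
have fF k y : setT y -> 0 <= f k y <= `|signed_pow p (phi y)| * J 0.
  move=> _; rewrite mulr_ge0//= ler_wpM2l//.
  have := kernel_le hJ (x0 - y); have := kernel_le hJ (z k - y).
  have := J0 (x0 - y); have := J0 (z k - y) => a1 a2 a3 a4.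
  by rewrite ler_norml; apply/andP; split; lra.
have Ffin : (\int[mu]_y (`|signed_pow p (phi y)| * J 0)%:E < +oo)%E.
  under eq_integral do rewrite mulrC.
  rewrite (nintZ mu measurableT mabs (fun y _ => normr_ge0 _) (J0 0)).
  by rewrite lte_mul_pinfty ?lee_fin// signed_pow_fin.
have fcvg : (\int[mu]_y (f k y)%:E)%E @[k --> \oo] --> 0%E.
  apply: (nint_dominated measurableT mf mF fF Ffin).
  apply: aeW => y _; rewrite -[X in _ --> X](mulr0 `|signed_pow p (phi y)|).
  apply: cvgM; first exact: cvg_cst.
  have cJ : J (z k - y) @[k --> \oo] --> J (x0 - y).
    exact: (@cvg_kernel_sub R n J _ \oo _ z (fun=> y) x0 y hJ cz (cvg_cst y)).
  rewrite -(normr0 R) -(subrr (J (x0 - y))); apply: cvg_norm.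
  by apply: cvgB => //; exact: cvg_cst.
suff : ((potential x0)%:E <= 0)%E by rewrite lee_fin leNgt potential_gt0.
apply: (cvge_to_ge fcvg); apply: nearW => k.
have [_ pk] := Hz k; rewrite -lee_fin in pk.
have fint : mu.-integrable setT (EFin \o f k).
  apply: (integrable_bound measurableT (mf k) mF) Ffin => y Ty.
  by have /andP[h1 h2] := fF k y Ty; rewrite ger0_norm.
have sint := integrableD measurableT (potential_integrable (z k)) fint.
rewrite -potentialE.
apply: (@le_trans _ _ ((potential (z k))%:E + \int[mu]_y (f k y)%:E)%E); last first.
  by rewrite -[leRHS]add0e; apply: leeD.
rewrite -potentialE -(integralD measurableT (potential_integrable (z k)) fint).
apply: (le_integral measurableT (potential_integrable x0) sint) => y _.
rewrite lee_fin /f -lerBlDl -mulrBr -normrM; exact: ler_norm.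
Qed.

Variables (lambda : R) (g : V -> V).
Hypotheses (hphi : weak_solution p J Omega lambda phi g) (lambda0 : 0 <= lambda).

Let K : R := 1 + 2 `^ (p - 1).

(** A negative value within d / 2 of x0 would lie within d of a positive one, and J is positive at
    such distances. *)
Lemma nonneg_near_closure_pos x0 : closure (pos_set Omega phi) x0 ->
  exists2 r : R, 0 < r & forall x, ball x0 r x -> 0 <= phi x.
Proof.
move=> cx0; have [d d0 Hd] := kernel_gt0_near hJ.
have d20 : 0 < d / 2 by rewrite divr_gt0.
exists (d / 2) => // x bx; rewrite leNgt; apply/negP => px.
have [y [[_ py] hy]] := cx0 _ (nbhsx_ballx x0 (d / 2) d20).
have hxy : ball x d y by apply: ball_splitr bx hy.
have /Hd : ball 0 d (y - x).
  by move: hxy; rewrite !mx_norm_ball /ball_/= sub0r normrN distrC.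
by rewrite nopair// ltxx.
Qed.

Lemma zero_set_null_near x0 : Omega x0 -> closure (pos_set Omega phi) x0 ->
  exists2 r : R, 0 < r & [/\ ball x0 r `<=` Omega, forall x, ball x0 r x -> 0 <= phi x &
    mu (ball x0 r `&` phi @^-1` [set 0]) = 0%E].
Proof.
move=> Ox0 cx0.
have [r1 r10 Hr1] := open_closed_ball oO Ox0.
have [r2 r20 Hr2] := nonneg_near_closure_pos cx0.
have [r3 r30 Hr3] := near_potential_gt0 cx0.
pose r := Num.min r1 (Num.min r2 r3).
have r0 : 0 < r by rewrite !lt_min r10 r20.
have rr1 : r <= r1 by rewrite ge_min lexx.
have rr2 : r <= r2 by rewrite !ge_min lexx orbT.
have rr3 : r <= r3 by rewrite !ge_min lexx !orbT.
have cb : closed_ball x0 r `<=` Omega.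
  by apply: subset_trans Hr1; apply: closureS; exact: le_ball.
have bO' : ball x0 r `<=` Omega by apply: subset_trans cb; exact: subset_closure.
exists r => //; split=> // [x bx|]; first by apply: Hr2; exact: le_ball bx.
set Z := phi @^-1` [set 0]; set eta := bump x0 r.
have mB : measurable (ball x0 r : set V) by exact: measurable_ball_rV.
have mZ : measurable Z by rewrite -[Z]setTI; exact: mphi.
have teta : test_function Omega eta by exact: test_bump.
have eta0 x : 0 <= eta x by exact: bump_ge0.
have etab x : eta x != 0 -> ball x0 r x.
  by move=> ex; apply/set_mem; rewrite -(bump_gt0 x0 x r0) lt_neqAle eq_sym ex eta0.
have H x : eta x != 0 -> 0 <= phi x by move/etab => bx; apply: Hr2; exact: le_ball bx.
have Leta := W1p0_Lp_off p2 oO (test_W1p0 (ltW p1) mO Ofin teta).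
have [meta etaO etafin] := Leta.
have metap : measurable_fun setT (fun x => `|eta x| `^ p) by exact: measurable_norm_powR.
have [C C0 HC] := test_bounded teta.
pose M := C `^ p; have M0 : 0 <= M by exact: powR_ge0.
have etaM x : `|eta x| `^ p <= M by rewrite (ler_powR_base (ltW p0)).
(* The part of |eta|^p carried by the zero set. The aim is that the integral m of w times the
   potential vanishes; the potential is positive on the ball, so Z is then negligible there. *)
pose w x : R := \1_Z x * `|eta x| `^ p.
have w0 x : 0 <= w x by rewrite mulr_ge0 ?powR_ge0// indicE.
have wM x : w x <= M by rewrite /w indicE; case: (x \in Z); rewrite ?mul1r ?mul0r.
have wE x : w x = (phi x == 0)%:R * `|eta x| `^ p.
  rewrite /w indicE (_ : (x \in Z) = (phi x == 0))//.
  by apply/idP/eqP => [/set_mem//|h]; exact: mem_set.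
have mw : measurable_fun setT w.
  by apply: measurable_funM metap; exact: measurable_indic.
have wball x : w x != 0 -> ball x0 r x.
  move=> wx; apply: etab; apply: contraNN wx => /eqP ex.
  by rewrite /w ex normr0 powR0 ?mulr0// gt_eqF.
(* c1 and c2 are the singular terms of [zero_set_picone] without the factor e^(1-p), and b is its
   bounded term. As J is even, c1 and c2 both integrate to m. *)
pose c1 (z : V * V) := w z.1 * signed_pow p (phi z.2) * J (z.1 - z.2).
pose c2 (z : V * V) := w z.2 * signed_pow p (phi z.1) * J (z.1 - z.2).
pose b (z : V * V) := K * (`|eta z.1| `^ p + `|eta z.2| `^ p) * J (z.1 - z.2).
have mJ := measurable_kernel_sub hJ.
have mc1 : measurable_fun setT c1.
  exact: (measurable_funM (measurable_funM (measurable_fst_fun mw) (measurable_snd_fun mq)) mJ).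
have mc2 : measurable_fun setT c2.
  exact: (measurable_funM (measurable_funM (measurable_snd_fun mw) (measurable_fst_fun mq)) mJ).
have mb : measurable_fun setT b.
  apply: (measurable_funM _ mJ); apply: measurable_funM; first exact: measurable_cst.
  exact: (measurable_funD (measurable_fst_fun metap) (measurable_snd_fun metap)).
have mqn : measurable_fun setT (fun x => `|signed_pow p (phi x)|).
  exact: measurableT_comp mq.
have mMq : measurable_fun setT (fun x => M * `|signed_pow p (phi x)|).
  by apply: measurable_funM => //; exact: measurable_cst.
have Mq0 x : 0 <= M * `|signed_pow p (phi x)| by rewrite mulr_ge0.
have MqO x : ~ Omega x -> M * `|signed_pow p (phi x)| = 0.
  by move/phi0 => ->; rewrite signed_pow0 normr0 mulr0.
have Mqfin : (\int[mu]_x (M * `|signed_pow p (phi x)|)%:E < +oo)%E.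
  rewrite (nintZ mu measurableT mqn (fun x _ => normr_ge0 _) M0).
  by rewrite lte_mul_pinfty ?lee_fin// signed_pow_fin.
have c1int : (mu \x mu)%E.-integrable setT (EFin \o c1).
  apply: (kernel_integrable hJ bO mc1 mMq Mq0 MqO Mqfin) => -[x y].
  rewrite /c1/= 2!normrM (ger0_norm (J0 _)) (ger0_norm (w0 _)) ler_wpM2r//.
  by rewrite -[leLHS]add0r lerD// ler_wpM2r.
have c2int : (mu \x mu)%E.-integrable setT (EFin \o c2).
  apply: (kernel_integrable hJ bO mc2 mMq Mq0 MqO Mqfin) => -[x y].
  rewrite /c2/= 2!normrM (ger0_norm (J0 _)) (ger0_norm (w0 _)) ler_wpM2r//.
  by rewrite -[leLHS]addr0 lerD// ler_wpM2r.
have K0 : 0 <= K by rewrite addr_ge0 ?powR_ge0.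
have bint : (mu \x mu)%E.-integrable setT (EFin \o b).
  have mKe : measurable_fun setT (fun x => K * `|eta x| `^ p).
    by apply: measurable_funM => //; exact: measurable_cst.
  apply: (kernel_integrable hJ bO mb mKe) => [x|x /etaO ->||z].
  - by rewrite mulr_ge0 ?powR_ge0.
  - by rewrite normr0 powR0 ?mulr0// gt_eqF.
  - rewrite (nintZ mu measurableT metap (fun x _ => powR_ge0 _ _) K0).
    by rewrite lte_mul_pinfty.
  - have bz : 0 <= b z by rewrite mulr_ge0// mulr_ge0// addr_ge0// powR_ge0.
    by rewrite (ger0_norm bz) /b mulrDr.
have inner x : (\int[mu]_y (w x * (signed_pow p (phi y) * J (x - y)))%:E =
    (w x * potential x)%:E)%E.
  rewrite EFinM -potentialE -(integralZl measurableT (potential_integrable x)).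
  by apply: eq_integral => y _; rewrite /= EFinM.
have F1 : fubini_F mu (EFin \o c1) = fun x => (w x * potential x)%:E.
  by apply/funext => x; rewrite -inner; apply: eq_integral => y _; rewrite /= /c1/= mulrA.
have G2 : fubini_G mu (EFin \o c2) = fun x => (w x * potential x)%:E.
  apply/funext => x; rewrite -inner; apply: eq_integral => y _.
  by rewrite /= /c2/= mulrA -(kernel_even hJ (x - y)) opprB.
(* Measurability is read off Fubini's theorem for c1. *)
have mwp : measurable_fun setT (fun x => w x * potential x).
  apply/measurable_EFinP; have := measurable_int mu (integrable_fubini_F c1int).
  by rewrite F1.
have I1 := integral12_prod_meas1 c1int; have I2 := integral21_prod_meas1 c2int.
rewrite F1 in I1; rewrite G2 in I2.
have wp0 x : 0 <= w x * potential x.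
  have [->|wx] := eqVneq (w x) 0; first by rewrite mul0r.
  by rewrite mulr_ge0// ltW// Hr3//; apply: le_ball (wball _ wx).
have [m m0 mE] : exists2 m, 0 <= m & (\int[mu]_x (w x * potential x)%:E = m%:E)%E.
  apply: nonneg_fin_real; first exact: nint_ge0 (fun x _ => wp0 x).
  rewrite I1; have := integrable_fin_num measurableT c1int.
  by rewrite fin_numE => /andP[_]; rewrite ltey.
have [B BE] : exists B, (\int[mu \x mu]_z (b z)%:E = B%:E)%E.
  by exists (fine (\int[mu \x mu]_z (b z)%:E)); rewrite fineK//; exact: integrable_fin_num bint.
have [_ Gfin] := test_integrable (ltW p0) mO Ofin teta.
have [G G0 GE] := nonneg_fin_real (nint_ge0 mu (fun x _ => powR_ge0 (enorm (grad eta x)) p)) Gfin.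
(* After multiplication by J the pointwise inequality matters only where J is nonzero, and there the
   absence of interaction supplies the sign conditions of [zero_set_picone]. *)
have fac (X A E u v j : R) : 0 <= j -> (j != 0 -> X <= A - E * (u + v)) ->
    X * j <= A * j - E * (u * j + v * j).
  move=> j0 HX; have [->|/HX h] := eqVneq j 0; first by rewrite !mulr0 addr0 mulr0 subrr.
  by rewrite -mulrDl mulrA -mulrBl ler_wpM2r.
have main e : 0 < e -> e `^ (1 - p) * (m + m) <= G + B.
  move=> e0; have [Lpsi Hle Hmass] := picone_test_le p2 oO bO hphi e0 teta H.
  pose E := e `^ (1 - p).
  have cint := integrableD measurableT c1int c2int.
  have Ecint := integrableZl measurableT E cint.
  have bEc := integrableB measurableT bint Ecint.
  have pw x y : nonlocal_term p J phi (picone_test p phi e eta) (x, y) <=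
      b (x, y) - E * (c1 (x, y) + c2 (x, y)).
    apply: fac => // Jn0; rewrite !wE; apply: zero_set_picone => //.
    - by rewrite normr_eq0; exact: H.
    - by rewrite normr_eq0; exact: H.
    - by apply: contraNN Jn0 => /andP[px py]; rewrite nopair.
    - by apply: contraNN Jn0 => /andP[py px]; rewrite -(kernel_even hJ) opprB nopair.
  have Nle := le_integral measurableT (nonlocal_term_integrable p2 hJ bO Lphi Lpsi) bEc
    (fun z _ => pw z.1 z.2).
  have Ele : (\int[mu \x mu]_z ((EFin \o b) z - E%:E * ((EFin \o c1) z + (EFin \o c2) z)) =
      (B - E * (m + m))%:E)%E.
    rewrite (integralB measurableT bint Ecint) (integralZl measurableT cint).
    rewrite (integralD measurableT c1int c2int).
    by rewrite -I1 -I2 mE (BE : (\int[mu \x mu]_z (EFin \o b) z)%E = _).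
  (* Since lambda >= 0, the mass side is bounded below by 0, uniformly in e. *)
  have mass0 : (0 <= lambda%:E * \int[mu]_(x in Omega)
      (signed_pow p (phi x) * picone_test p phi e eta x)%:E)%E.
    apply: mule_ge0; first by rewrite lee_fin.
    by apply: nint_ge0 => x _; have /andP[] := Hmass x.
  have := le_trans mass0 (le_trans Hle (leeD (lexx _) Nle)).
  rewrite Ele GE -EFinD lee_fin addrA subr_ge0; exact.
have m_eq0 : m = 0.
  apply/le_anti; rewrite m0 andbT leNgt; apply/negP => m_gt0.
  have := main 1 ltr01; rewrite powR1 mul1r => GB.
  have mm : 0 < m + m by rewrite addr_gt0.
  have T0 : 0 < (G + B + 1) / (m + m) by rewrite divr_gt0// ltr_wpDl// (le_trans _ GB)// ltW.
  have p1' : 1 - p != 0 by rewrite subr_eq0 lt_eqF.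
  (* This e satisfies e^(1-p) (m + m) = G + B + 1, contrary to [main]. *)
  have := main (((G + B + 1) / (m + m)) `^ (1 - p)^-1) (powR_gt0 _ T0).
  rewrite -powRrM mulVf// powRr1 ?(ltW T0)// divfK ?gt_eqF//.
  by rewrite -subr_ge0 opprD addrA subrr sub0r oppr_ge0 leNgt ltr01.
have mBZ : measurable (ball x0 r `&` Z) by exact: measurableI.
apply/eqP; rewrite eq_le measure_ge0 andbT leNgt; apply/negP => BZ0.
have : (0 < \int[mu]_x (w x * potential x)%:E)%E.
  apply: (nint_gt0 measurableT mwp (fun x _ => wp0 x) mBZ _ BZ0) => // x [bx Zx].
  have phx : phi x == 0 by apply/eqP.
  rewrite wE phx mul1r mulr_gt0//; last by apply: Hr3; exact: le_ball bx.
  by rewrite powR_gt0// ger0_norm// bump_gt0// mem_set.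
by rewrite mE m_eq0 ltxx.
Qed.

End no_interaction.

(** * Connectedness and the final contradiction *)

Section conclusion.
Context {R : realType} {n : nat}.
Local Notation mu := (lebesgue_rV R n).
Local Notation V := 'rV[R]_n.

(** A Lindelof argument: each point of A lies in a small ball with rational centre and radius
    1/(k+1) whose trace on A is negligible. These balls are enumerated by [unpickle], and those with
    a non-negligible trace are replaced by the empty set. *)
Lemma locally_negligible (A : set V) :
  (forall x, A x -> exists2 r : R, 0 < r & mu.-negligible (A `&` ball x r)) ->
  mu.-negligible A.
Proof.
move=> HA.
pose Q (q : 'rV[rat]_n) : V := map_mx ratr q.
pose B (c : 'rV[rat]_n * nat) : set V := A `&` ball (Q c.1) (c.2.+1%:R^-1 : R).
pose F k : set V := if unpickle k is Some c then
  (if `[< mu.-negligible (B c) >] then B c else set0) else set0.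
apply: (@negligibleS _ _ _ mu (\bigcup_k F k)); last first.
  apply: negligible_bigcup => k; rewrite /F; case: unpickle => [c|]; last exact: negligible_set0.
  by case: ifPn => [/asboolP//|_]; exact: negligible_set0.
move=> x Ax; have [r r0 Hr] := HA x Ax.
have [k _ /(_ _ (leqnn k)) Hk] := near_infty_natSinv_lt (PosNum (divr_gt0 r0 (ltr0n R 2))).
have k0 : (0 : R) < k.+1%:R^-1 by rewrite invr_gt0.
have [q Hq] := rat_approx_rV x k0.
exists (pickle (q, k)) => //; rewrite /F pickleK ifT.
  by split=> //; exact: ball_sym.
apply/asboolP; apply: negligibleS Hr => y [Ay qy]; split=> //.
rewrite [r]splitr; apply: (@ball_triangle _ _ (Q q)); first exact: le_ball (ltW Hk) _ Hq.
exact: le_ball (ltW Hk) _ qy.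
Qed.

Variables (p : R) (J : V -> R) (Omega : set V).
Hypotheses (p2 : 2 <= p) (hJ : is_kernel J) (oO : open Omega) (bO : bounded_set Omega).

Let p1 : 1 < p. Proof. by apply: lt_le_trans p2; rewrite ltr1n. Qed.
Let p0 : 0 < p. Proof. exact: lt_trans p1. Qed.
Let mO : measurable Omega. Proof. exact: open_measurable_rV. Qed.

Lemma lambda1_ge0 (U : set V) : (0 <= lambda1 p J U)%E.
Proof.
apply: le_ereal_inf_tmp => _ [u [gu [_ _ ->]]]; apply: adde_ge0.
  exact: nint_ge0 (fun x _ => powR_ge0 _ _).
exact: nint_ge0 (fun z _ => nonlocal_energy_ge0 p hJ u z).
Qed.

Variable lambda : R.

Lemma no_interaction_le_lambda1 phi g : connected Omega ->
  weak_solution p J Omega lambda phi g -> {in Omega, continuous phi} -> 0 <= lambda ->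
  (forall x y, 0 < phi x -> phi y < 0 -> J (x - y) = 0) ->
  (exists x, 0 < phi x) -> (lambda%:E <= lambda1 p J Omega)%E.
Proof.
move=> cO hphi cphi l0 nopair [x1 px1].
have W : W1p0 p Omega phi g by case: hphi.
have Lphi := W1p0_Lp_off p2 oO W; have [mphi phi0 _] := Lphi.
have Ox1 : Omega x1 by apply: contrapT => /phi0 h; move: px1; rewrite h ltxx.
set P := pos_set Omega phi; set Z := phi @^-1` [set 0].
have mZ : measurable Z by rewrite -[Z]setTI; exact: mphi.
have null := zero_set_null_near p2 hJ oO bO Lphi cphi nopair hphi l0.
(* Balls have positive measure, so none inside this one is contained in the null set Z; each
   contains a point where phi is nonnegative and nonzero. *)
have ballP x0 (r : R) : 0 < r -> ball x0 r `<=` Omega -> (forall x, ball x0 r x -> 0 <= phi x) ->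
    mu (ball x0 r `&` Z) = 0%E -> ball x0 r `<=` closure P.
  move=> r0 bO' nn m0 y by_ N Ny; apply: contrapT => H.
  have nb : \forall z \near y, N z /\ ball x0 r z.
    have nB : nbhs y (ball x0 r) by apply: open_nbhs_nbhs; split=> //; exact: ball_open.
    by apply: filterS2 Ny nB => z; split.
  have /nbhs_ballP[s/= s0 Hs] := nb.
  have /andP[mys _] := lebesgue_rV_ball y s0.
  move: mys; rewrite (@subset_measure0 _ _ _ mu _ (ball x0 r `&` Z)) ?ltxx//.
  - exact: measurable_ball_rV.
  - by apply: measurableI => //; exact: measurable_ball_rV.
  - move=> z /Hs[Nz bz]; split=> //; apply/le_anti; rewrite nn// andbT leNgt.
    by apply/negP => pz; apply: H; exists z; split=> //; split=> //; exact: bO'.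
(* The trace of [closure P] on [Omega] is nonempty, relatively closed, and relatively open by [null]
   and [ballP]. *)
have OE : Omega `&` closure P = Omega.
  apply: cO.
  - by exists x1; split=> //; apply: subset_closure.
  - exists (\bigcup_(x in Omega `&` closure P) (interior (Omega `&` closure P))).
      by apply: bigcup_open => x _; exact: open_interior.
    apply/seteqP; split=> [x [Ox cx]|x [Ox [y _ /interior_subset[]]]]; last by split.
    split=> //; exists x => //.
    have [r r0 [h1 h2 h3]] := null x Ox cx.
    apply/nbhs_ballP; exists r => //= y by_; split; first exact: h1.
    exact: ballP r0 h1 h2 h3 y by_.
  - by exists (closure P) => //; exact: closed_closure.
have cP x : Omega x -> closure P x by rewrite -{1}OE => -[].
have nn x : 0 <= phi x.
  have [Ox|/phi0 ->//] := pselect (Omega x).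
  have [r r0 [_ h _]] := null x Ox (cP x Ox); apply: h; exact: ballxx.
have Znull : mu.-negligible (Omega `&` Z).
  apply: locally_negligible => x [Ox Zx]; have [r r0 [_ _ h]] := null x Ox (cP x Ox).
  exists r => //; exists (ball x r `&` Z); split=> //.
    by apply: measurableI => //; exact: measurable_ball_rV.
  by move=> y [[_ Zy] by_].
have phipos : {ae mu, forall x, Omega x -> 0 < phi x}.
  apply: negligibleS Znull => x /= /not_implyP[Ox /negP]; rewrite -leNgt => px.
  by split=> //; apply/le_anti; rewrite px nn.
apply: lambda1_ge => // eta teta.
exact: (nonneg_picone p2 hJ oO bO hphi nn phipos teta).
Qed.

(** As t |-> |t|^(p-2) t is odd, testing the equation of - phi with v amounts to testing that of phi
    with - v. *)
Lemma weak_solutionN phi g : weak_solution p J Omega lambda phi g ->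
  weak_solution p J Omega lambda (fun x => - phi x) (fun x => - g x).
Proof.
move=> [W H].
have N v h : W1p0 p Omega v h -> W1p0 p Omega (fun x => - v x) (fun x => - h x).
  move=> /(W1p0Z p2 oO bO (-1)); congr W1p0; apply/funext => x; first by rewrite mulN1r.
  by rewrite scaleN1r.
split; first exact: N.
move=> v h /N Wv; have := H _ _ Wv; congr (_ = _).
- congr (_ + _)%E; apply: eq_integral => x _; congr EFin.
    by rewrite /local_term enormN -[- h x]scaleN1r -[- g x]scaleN1r dotvZr dotvZl.
  by rewrite /nonlocal_term -!opprD signed_powN mulrN !mulNr.
- by congr (_ * _)%E; apply: eq_integral => x _; rewrite signed_powN mulrN mulNr.
Qed.

End conclusion.

Theorem lemma4p2 (R : realType) (n : nat) (p alpha lambda : R)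
    (J : 'rV[R]_n.+1 -> R) (Omega : set 'rV[R]_n.+1)
    (phi : 'rV[R]_n.+1 -> R)
    (hJ : is_kernel J) (hp : 2 <= p)
    (Omega_open : open Omega) (Omega_bounded : bounded_set Omega)
    (Omega_connected : connected Omega)
    (halpha : 0 < alpha < 1) (Omega_C1 : C1holder_boundary alpha Omega)
    (hlambda : is_eigenvalue p J Omega lambda)
    (lambda_gt : (lambda1 p J Omega < lambda%:E)%E)
    (hphi : is_eigenfunction p J Omega lambda phi)
    (phi_continuous : {in Omega, continuous phi}) :
  (maxe (lambda1 p J [set x | Omega x /\ 0 < phi x]%R)
        (lambda1 p J [set x | Omega x /\ phi x < 0]%R) < lambda%:E)%E.
Proof.
have [g hg] := eigenfunction_weak_solution hp hJ Omega_open Omega_bounded hphi.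
have hgN := weak_solutionN hp Omega_open Omega_bounded hg.
have cN : {in Omega, continuous (fun x => - phi x)}.
  by move=> x xO; exact: (cvgN (phi_continuous x xO)).
have l0 : 0 <= lambda.
  by rewrite -lee_fin; exact: le_trans (lambda1_ge0 p hJ Omega) (ltW lambda_gt).
(* One interacting pair serves both signs, since J is even. Its absence is likewise symmetric in phi
   and - phi. *)
have [x0 [y0 [px0 py0 Jxy]]] : exists x0 y0, [/\ 0 < phi x0, phi y0 < 0 & 0 < J (x0 - y0)].
  apply: contrapT => H.
  have nopair x y : 0 < phi x -> phi y < 0 -> J (x - y) = 0.
    move=> px py; apply/le_anti; rewrite (kernel_ge0 hJ) andbT leNgt.
    by apply/negP => Jp; apply: H; exists x, y.
  have nopairN x y : 0 < - phi x -> - phi y < 0 -> J (x - y) = 0.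
    by rewrite oppr_gt0 oppr_lt0 => px py; rewrite -(kernel_even hJ) opprB nopair.
  have le1 := no_interaction_le_lambda1 hp hJ Omega_open Omega_bounded Omega_connected
    hg phi_continuous l0 nopair.
  have le2 := no_interaction_le_lambda1 hp hJ Omega_open Omega_bounded Omega_connected
    hgN cN l0 nopairN.
  (* A nonzero value of either sign would give lambda <= lambda1(Omega); so phi would vanish
     identically. *)
  have [nae _] := hphi; apply: nae; apply: aeW => x; apply: contrapT => /eqP.
  move: lambda_gt; rewrite ltNge => /negP gt; rewrite neq_lt => /orP[px|px]; apply: gt.
    by apply: le2; exists x; rewrite oppr_gt0.
  by apply: le1; exists x.
rewrite gt_max; apply/andP; split.
  exact: (lambda1_pos_set_lt hp hJ Omega_open Omega_bounded hg phi_continuous px0 py0 Jxy).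
rewrite (_ : [set x | _] = pos_set Omega (fun x => - phi x)); last first.
  by apply/seteqP; split=> x [Ox]; rewrite ?oppr_gt0// => px; split=> //; rewrite oppr_gt0.
apply: (lambda1_pos_set_lt hp hJ Omega_open Omega_bounded hgN cN (x0 := y0) (y0 := x0)).
- by rewrite oppr_gt0.
- by rewrite oppr_lt0.
- by rewrite -(kernel_even hJ) opprB.
Qed.
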